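(* Let $r,s\in C^1[0,\infty)$ and $u\in C[0,\infty)$ be real-valued functions satisfying $$\dot s(t)=-2u(t)r(t),\qquad \dot r(t)=-2u(t)s(t),$$ with $\operatorname{sgn}(u(t))=-\operatorname{sgn}(r(t))$ for all $t>0$, $s(0)>0$ and $r(0)>0$ (so that $r(t),s(t)>0$ for all $t>0$, and $s^2-r^2$ is constant). Assume $s^2-r^2<0$ and let $k>0$. For $\phi(t)=\arccos\big(\frac{s(t)}{r(t)}\big)$ let $$W_t(x)=w(x;k,\phi(t)),\qquad x\in\mathbb R,$$ and let $U_t:\ell^2(\mathbb N)\to L^2(\mathbb R,W_t(x)dx)$ be defined by $$[U_te_n](x)=P_n(x;k,\phi(t)).$$ Then $U_t$ is unitary and $U_t\circ\pi_k(L(t))\circ U_t^*=M(-2Cx)$, where $C=\sqrt{r^2-s^2}$.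
   Context: $\mathbb N=\{0,1,2,\dots\}$; $(a)_n=a(a+1)\cdots(a+n-1)$. The Lie algebra considered has basis $H,E,F$ with $[H,E]=2E$, $[H,F]=-2F$, $[E,F]=H$ and $*$-structure $H^*=H$, $E^*=-F$ (i.e. $\mathfrak{su}(1,1)$). The Lax operator is $L(t)=s(t)H+r(t)(E-F)$; its Lax partner is $u(t)(E+F)$, and the differential equations in the claim are the Lax equation $\dot L=[u(E+F),L]$. The positive discrete series representation $\pi_k$, $k>0$, on $\ell^2(\mathbb N)$ with standard orthonormal basis $\{e_n\}_{n\in\mathbb N}$ is given by $\pi_k(H)e_n=2(k+n)e_n$, $\pi_k(E)e_n=\sqrt{(n+1)(2k+n)}\,e_{n+1}$, $\pi_k(F)e_n=-\sqrt{n(2k+n-1)}\,e_{n-1}$, with $e_{-1}=0$. Hence $$\pi_k(L(t))e_n=r(t)\sqrt{(n+1)(n+2k)}\,e_{n+1}+s(t)(2k+2n)e_n+r(t)\sqrt{n(n+2k-1)}\,e_{n-1}.$$ These operators are unbounded and densely defined, with dense domain the finite linear combinations of the $e_n$. The orthonormal Meixner-Pollaczek polynomials and their weight are, for $\lambda>0$, $0<\phi<\pi$, $$P_n(x;\lambda,\phi)=e^{in\phi}\sqrt{\frac{(2\lambda)_n}{n!}}\;{}_2F_1\Big({-n,\lambda+ix\atop2\lambda};1-e^{-2i\phi}\Big),\qquad w(x;\lambda,\phi)=\frac{(2\sin\phi)^{2\lambda}}{2\pi\,\Gamma(2\lambda)}e^{(2\phi-\pi)x}|\Gamma(\lambda+ix)|^2.$$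 $M(f)$ denotes the multiplication operator: $[M(f)g](x)=f(x)g(x)$.
   Formalization: The printed identity fails: U_t π_k(L(t)) U_t^* 1 = 4ks+2Cx, not -2Cx. The identity is proved instead for U_t J π_k(L(t)) J U_t^* with J e_n = (-1)^n e_n, i.e. with e_n ↦ (-1)^n P_n; unitarity of U_t is as printed. *)

(* Defs.v *)
(* MathComp / MathComp-Analysis; the complex numbers are R[i] for R : realType. *)
From HB Require Import structures.
From mathcomp Require Import all_boot all_order all_algebra.
From mathcomp Require Export complex.
From mathcomp Require Import all_classical all_reals all_analysis.
From mathcomp Require Import measurable_realfun.

Set Implicit Arguments.
Unset Strict Implicit.
Unset Printing Implicit Defensive.

Import Order.TTheory GRing.Theory Num.Theory.
Import numFieldNormedType.Exports.

Local Open Scope classical_set_scope.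
Local Open Scope ring_scope.

Notation Rec := (@complex.Re _).
Notation Imc := (@complex.Im _).
Notation normc := (@ComplexField.Normc.normc _).
Notation "x %:C" := (real_complex _ x) : ring_scope.
Notation "x +i* y" := (@Complex _ x y) : ring_scope.

Section calculus_on_the_half_line.
Variable R : realType.
Implicit Types f df : R -> R.

(* The derivative of f : [0, oo[ -> R at t >= 0; it is one-sided at t = 0. *)
Definition is_derive_halfline f (t l : R) : Prop :=
  (f (t + h) - f t) / h @[h --> within [set h | 0 <= t + h] 0^'] --> l.

Definition C0_halfline f : Prop := {within `[0, +oo[, continuous f}.

Definition C1_halfline f : Prop :=
  exists2 df, C0_halfline df & forall t, 0 <= t -> is_derive_halfline f t (df t).

End calculus_on_the_half_line.

Section complex_functions.
Variable R : realType.
Local Notation C := R[i].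

Definition cexp (z : C) : C :=
  (expR (Rec z) * cos (Imc z)) +i* (expR (Rec z) * sin (Imc z)).

Definition cintegral d (T : measurableType d) (mu : {measure set T -> \bar R})
    (D : set T) (f : T -> C) : C :=
  (Rintegral mu D (Rec \o f)) +i* (Rintegral mu D (Imc \o f)).

(* Euler's integral of y ^ (z - 1) * e ^ (- y); it is the Gamma function for
   0 < Re z only, which is the only range in which it is used. *)
Definition cGamma (z : C) : C :=
  cintegral lebesgue_measure `]0, +oo[
    (fun y : R => cexp ((z - 1) * (ln y)%:C - y%:C)).

Definition pochhammer (F : pzRingType) (a : F) (n : nat) : F :=
  \prod_(j < n) (a + j%:R).

(* 2F1(- n, a; c; z), a finite sum because (- n)_j = 0 for j > n. *)
Definition hyp2F1_terminating (n : nat) (a c z : C) : C :=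
  \sum_(j < n.+1) pochhammer (- n%:R) j * pochhammer a j
                  / (pochhammer c j * (j`!)%:R) * z ^+ j.

Definition MP_poly (lambda phi : R) (n : nat) (x : R) : C :=
  cexp (0 +i* (n%:R * phi))
  * (Num.sqrt (pochhammer (2 * lambda) n / (n`!)%:R))%:C
  * hyp2F1_terminating n (lambda +i* x) (2 * lambda)%:C
      (1 - cexp (0 +i* (- (2 * phi)))).

(* Gamma (2 lambda) is real; Rec only changes its type. *)
Definition MP_weight (lambda phi x : R) : R :=
  (2 * sin phi) `^ (2 * lambda) / (2 * pi * Rec (cGamma (2 * lambda)%:C))
  * expR ((2 * phi - pi) * x) * normc (cGamma (lambda +i* x)) ^+ 2.

End complex_functions.

Section MP_weight_properties.
Variable R : realType.
Implicit Types lambda phi x : R.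

Lemma cGamma_real_ge0 (a : R) : 0 <= Rec (cGamma a%:C).
Proof.
rewrite /cGamma /cintegral /=; apply: Rintegral_ge0 => y _ /=.
rewrite !(subr0, oppr0, mulr0, mul0r, addr0) cos0 mulr1; exact: expR_ge0.
Qed.

Lemma MP_weight_ge0 lambda phi x : 0 <= MP_weight lambda phi x.
Proof.
apply: mulr_ge0; [apply: mulr_ge0; [apply: divr_ge0|]|].
- exact: powR_ge0.
- by rewrite !mulr_ge0 ?pi_ge0// cGamma_real_ge0.
- exact: expR_ge0.
- by apply: exprn_ge0; case: (cGamma _) => a b; exact: sqrtr_ge0.
Qed.

Lemma measurable_Rintegral_section (D : set R) (h : R * R -> R) :
  measurable D -> measurable_fun setT h ->
  measurable_fun setT (fun x => Rintegral lebesgue_measure D (fun y => h (x, y))).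
Proof.
move=> mD mh; rewrite /Rintegral.
apply: (measurableT_comp (fine_measurable measurableT)) => /=.
pose g (z : R * R) : \bar R := (h z * \1_D z.2)%:E.
have mg : measurable_fun setT g.
  apply/measurable_EFinP; apply: measurable_funM => //.
  exact: (measurableT_comp (measurable_indic mD)).
have -> : (fun x => (\int[lebesgue_measure]_(y in D) (h (x, y))%:E)%E) =
    (fun x => (fubini_F lebesgue_measure (g^\+)%E x
             - fubini_F lebesgue_measure (g^\-)%E x)%E).
  apply/funext => x; rewrite integral_mkcond.
  rewrite (_ : _ \_ D = fun y => g (x, y)); last first.
    apply/funext => y; rewrite patchE /g indicE /=.
    by case: ifPn => _; rewrite ?mulr1 ?mulr0.
  rewrite integralE /fubini_F; congr (_ - _)%E; apply: eq_integral => y _.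
  - by rewrite !funeposE.
  - by rewrite !funenegE.
apply: emeasurable_funB; apply: measurable_fun_fubini_tonelli_F => //.
- exact: measurable_funepos.
- exact: measurable_funeneg.
Qed.

Lemma measurable_MP_weight lambda phi :
  measurable_fun setT (MP_weight lambda phi).
Proof.
have mlin (a b : R) : measurable_fun setT (fun x : R => a * x + b).
  by apply: measurable_funD => //; exact: measurable_funM.
rewrite /MP_weight; apply: measurable_funM; first apply: measurable_funM => //.
  by apply: (measurableT_comp (@measurable_expR R)); exact: measurable_funM.
have mG (h : R * R -> R) : measurable_fun setT h -> measurable_fun setT
    (fun x => Rintegral lebesgue_measure `]0, +oo[ (fun y => h (x, y))).
  exact: measurable_Rintegral_section.
have mln : measurable_fun setT (fun z : R * R => ln z.2).
  exact: (measurableT_comp (@measurable_ln R)).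
have mre : measurable_fun setT (fun z : R * R =>
    Rec ((lambda +i* z.1 - 1) * (ln z.2)%:C - (z.2)%:C)).
  rewrite /=; apply: measurable_funB => //.
  apply: measurable_funB; first exact: measurable_funM.
  by apply: measurable_funM => //; exact: measurable_funB.
have mim : measurable_fun setT (fun z : R * R =>
    Imc ((lambda +i* z.1 - 1) * (ln z.2)%:C - (z.2)%:C)).
  rewrite /=; apply: measurable_funB => //.
  apply: measurable_funD; first exact: measurable_funM.
  by apply: measurable_funM => //; exact: measurable_funB.
have mexp := measurableT_comp (@measurable_expR R) mre.
have mcos := measurableT_comp (continuous_measurable_fun (@continuous_cos R)) mim.
have msin := measurableT_comp (continuous_measurable_fun (@continuous_sin R)) mim.
have mR := mG _ (measurable_funM mexp mcos).
have mI := mG _ (measurable_funM mexp msin).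
rewrite [X in measurable_fun _ X](_ : _ = fun x =>
  Rec (cGamma (lambda +i* x)) ^+ 2 + Imc (cGamma (lambda +i* x)) ^+ 2); last first.
  apply/funext => x; case: (cGamma _) => a b /=.
  by rewrite sqr_sqrtr// addr_ge0 ?sqr_ge0.
by apply: measurable_funD; apply: measurable_funX; [exact: mR|exact: mI].
Qed.

End MP_weight_properties.

(* The measure w(x; lambda, phi) dx on the real line. *)
Definition MP_measure (R : realType) (lambda phi : R) (A : set R) : \bar R :=
  (\int[lebesgue_measure]_(x in A) (MP_weight lambda phi x)%:E)%E.

Section MP_measure_is_measure.
Variables (R : realType) (lambda phi : R).
Local Notation mp := (MP_measure lambda phi).

Let mp0 : mp set0 = 0%E.
Proof. exact: integral_set0. Qed.

Let mp_ge0 A : (0 <= mp A)%E.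
Proof. by apply: integral_ge0 => x _; rewrite lee_fin MP_weight_ge0. Qed.

Let mp_sigma_additive : semi_sigma_additive mp.
Proof.
move=> A mA tA mUA; rewrite /MP_measure ge0_integral_bigcup//=.
- apply: is_cvg_ereal_nneg_natsum_cond => n _ _.
  by apply: integral_ge0 => x _; rewrite lee_fin MP_weight_ge0.
- apply: measurable_funTS; apply/measurable_EFinP.
  exact: measurable_MP_weight.
- by move=> x _; rewrite lee_fin MP_weight_ge0.
Qed.

HB.instance Definition _ := isMeasure.Build _ _ _ mp
  mp0 mp_ge0 mp_sigma_additive.

End MP_measure_is_measure.

(* Elements of L2 are represented by functions, and equality in L2 is equality
   almost everywhere. *)
Section complex_L2.
Context d (T : measurableType d) (R : realType).
Variable mu : {measure set T -> \bar R}.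
Local Notation C := R[i].

Definition cmeasurable (f : T -> C) : Prop :=
  measurable_fun setT (Rec \o f) /\ measurable_fun setT (Imc \o f).

Definition L2 : set (T -> C) :=
  [set f | cmeasurable f /\ (\int[mu]_x (normc (f x) ^+ 2)%:E < +oo)%E].

Definition L2_inner (f g : T -> C) : C :=
  cintegral mu setT (fun x => f x * (g x)^*%C).

Definition mult_op (h : T -> C) (f : T -> C) : T -> C := fun x => h x * f x.

End complex_L2.

Section operators_between_L2_spaces.
Context d1 d2 (T1 : measurableType d1) (T2 : measurableType d2) (R : realType).
Variables (mu : {measure set T1 -> \bar R}) (nu : {measure set T2 -> \bar R}).
Local Notation C := R[i].
Implicit Types (U : (T1 -> C) -> (T2 -> C)) (V : (T2 -> C) -> (T1 -> C)).

Definition L2_linear U : Prop :=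
  (forall f, L2 mu f -> L2 nu (U f)) /\
  (forall (a : C) f g, L2 mu f -> L2 mu g ->
     U (a *: f + g) = a *: U f + U g %[ae nu]).

Definition L2_adjoint U V : Prop :=
  (forall g, L2 nu g -> L2 mu (V g)) /\
  (forall f g, L2 mu f -> L2 nu g ->
     L2_inner nu (U f) g = L2_inner mu f (V g)).

Definition L2_unitary U V : Prop :=
  [/\ L2_linear U, L2_adjoint U V,
      forall f, L2 mu f -> V (U f) = f %[ae mu] &
      forall g, L2 nu g -> U (V g) = g %[ae nu]].

End operators_between_L2_spaces.

Section discrete_series.
Variable R : realType.
Local Notation C := R[i].

(* ell^2(N) is L2 (counting : set nat -> \bar R), where almost everywhere means
   everywhere. *)

Definition ebasis (n : nat) : nat -> C := fun m => (m == n)%:R.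

(* The finite linear combinations of the basis vectors. *)
Definition finsupp : set (nat -> C) :=
  [set a | finite_set [set n | a n != 0]].

(* The linear map on finsupp that sends each e_n to v n. *)
Definition on_basis (v : nat -> nat -> C) (a : nat -> C) : nat -> C :=
  fun m => \sum_(n \in [set: nat]) a n * v n m.

(* sl_2(C) as the traceless 2 x 2 matrices. *)
Definition slH : 'M[C]_2 := delta_mx 0 0 - delta_mx 1 1.
Definition slE : 'M[C]_2 := delta_mx 0 1.
Definition slF : 'M[C]_2 := delta_mx 1 0.

Definition discH (k : R) : (nat -> C) -> nat -> C :=
  on_basis (fun n => (2 * (k + n%:R))%:C *: ebasis n).

Definition discE (k : R) : (nat -> C) -> nat -> C :=
  on_basis (fun n => (Num.sqrt (n.+1%:R * (2 * k + n%:R)))%:C *: ebasis n.+1).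

(* For n = 0 the coefficient vanishes, which agrees with e_{-1} = 0. *)
Definition discF (k : R) : (nat -> C) -> nat -> C :=
  on_basis (fun n =>
    (- Num.sqrt (n%:R * (2 * k + n%:R - 1)))%:C *: ebasis n.-1).

(* X 0 0, X 0 1, X 1 0 are the coordinates of a traceless X in H, E, F. *)
Definition disc_series (k : R) (X : 'M[C]_2) (a : nat -> C) : nat -> C :=
  X 0 0 *: discH k a + X 0 1 *: discE k a + X 1 0 *: discF k a.

Definition lax_operator (s r : R -> R) (t : R) : 'M[C]_2 :=
  (s t)%:C *: slH + (r t)%:C *: (slE - slF).

(* The sign change e_n |-> (-1)^n e_n.  It relates disc_series to MP_poly: with
   s = r cos phi, C = r sin phi and c_n = sqrt ((n + 1) (2 k + n)), MP_poly has
     r c_n P_(n+1) - 2 s (k + n) P_n + r c_(n-1) P_(n-1) = 2 C x P_n,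
   whereas in disc_series k (s H + r (E - F)) the diagonal and off-diagonal
   coefficients have the same sign.  Without this factor the conjugated operator
   sends P_0 = 1 to 4 k s + 2 C x, which is not - 2 C x. *)
Definition alternate (a : nat -> C) : nat -> C := fun n => (-1) ^+ n * a n.

End discrete_series.

(* Main.v *)
(* On ell^2(N) the Lax operator is, up to the sign change e_n |-> (-1)^n e_n, the
   Jacobi operator given by the three-term recurrence of the Meixner-Pollaczek
   polynomials P_n, with s = r cos phi and C = r sin phi; C is constant because
   s^2 - r^2 is conserved by the Lax equation.  It remains to show that the P_n form
   an orthonormal basis of L^2(w); the unitary then comes from Riesz-Fischer.

   Up to elementary factors, Gamma(k + i x) is the Fourier transform of
   exp (k u - e^(i th) e^u), so Plancherel's identity yields, for |th| < pi / 2,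
     int e^(2 th x) |Gamma(k + i x)|^2 dx = 2 pi Gamma(2 k) (2 cos th)^(- 2 k).
   Let E_th be the expectation with respect to the weight e^(2 th x) |Gamma(k + i x)|^2.
   As d/dth E_th(p) = 2 E_th(x p), the recurrence shows by induction that the
   multiple q_n of P_n normalised by q_n = e^(i n phi) 2F1(...) satisfies
     E_th(q_n) = (cos phi + tan th sin phi)^n E_th(1).
   At th = phi - pi / 2 the weight is proportional to w and the right side vanishes
   for n > 0; combined with the recurrence this gives orthogonality.

   If g in L^2(w) is orthogonal to every P_n, all moments of g w vanish.  Since
   g(x) w(x) e^(d |x|) is integrable for some d > 0, the Fourier transform of g w
   continues analytically to a strip, so it is zero and g = 0 almost everywhere. *)
Require Import Defs.
From mathcomp Require Import all_boot all_order all_algebra.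
From mathcomp Require Import all_classical all_reals all_analysis.
From mathcomp Require Import measurable_realfun ring lra.

Set Implicit Arguments.
Unset Strict Implicit.
Unset Printing Implicit Defensive.

Import Order.TTheory GRing.Theory Num.Theory.
Import numFieldNormedType.Exports.

Local Open Scope classical_set_scope.
Local Open Scope ring_scope.

(** * Real-valued integrals *)

(** All analysis is done with real integrals, complex functions being split into real and imaginary
    parts. The transform with parameter [th] is Euler's integral with its ray of integration rotated
    by [th]. Cauchy's theorem is replaced by a linear differential equation in [th] for the rotated
    integral, obtained from an integration by parts; only its modulus [e^(th x) |Gamma(k + i x)|] is
    extracted, because Plancherel's identity sees nothing else. This is the origin of the
    exponential factor in the weight. The total mass is then an explicit function of [th], and its
    derivatives encode all moments, so the means of the q_n follow without further information on
    Gamma. The freedom in [th] also supplies the exponential moments that make the moment problem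
    determinate.

    Plancherel's identity and the injectivity of the Fourier transform share one regularised
    identity: damping by [e^(- e |x|)] makes the frequency integral absolutely convergent and turns
    it into a convolution with the Poisson kernel, which is an approximate identity as [e] tends to
    0. *)

Notation rintegrable mu f := (mu.-integrable setT (EFin \o f)).

Section real_integrable.
Context d (T : measurableType d) (R : realType).
Variable mu : {measure set T -> \bar R}.
Implicit Types f g h : T -> R.

Lemma rintegrable_measurable f : rintegrable mu f -> measurable_fun setT f.
Proof. by move=> /integrableP[/measurable_EFinP]. Qed.

Lemma rintegrable_le f g : measurable_fun setT f ->
  (forall x, `|f x| <= g x) -> rintegrable mu g -> rintegrable mu f.
Proof.
move=> mf fg; apply: le_integrable => //; first exact/measurable_EFinP.
by move=> x _ /=; rewrite lee_fin (le_trans (fg x))// ler_norm.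
Qed.

Lemma rintegrableM f h (M : R) : rintegrable mu f -> measurable_fun setT h ->
  (forall x, `|h x| <= M) -> rintegrable mu (fun x => f x * h x).
Proof.
move=> fi mh hM; apply: (@rintegrable_le _ (fun x => `|M| * `|f x|)).
- apply: measurable_funM => //; exact: rintegrable_measurable.
- move=> x; rewrite normrM mulrC ler_wpM2r//.
  by rewrite (le_trans (hM x))// ler_norm.
- apply: (@eq_integrable _ _ _ _ _ _ (fun x => `|M|%:E * (abse \o (EFin \o f)) x)%E) => //.
  by apply: integrableZl => //; exact: integrable_abse.
Qed.

Lemma rintegrableD f g : rintegrable mu f -> rintegrable mu g ->
  rintegrable mu (fun x => f x + g x).
Proof. by move=> fi gi; exact: (integrableD measurableT fi gi). Qed.

Lemma rintegrableB f g : rintegrable mu f -> rintegrable mu g ->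
  rintegrable mu (fun x => f x - g x).
Proof. by move=> fi gi; exact: (integrableB measurableT fi gi). Qed.

Lemma rintegrableZ (c : R) f : rintegrable mu f ->
  rintegrable mu (fun x => c * f x).
Proof. by move=> fi; exact: (integrableZl measurableT c fi). Qed.

Lemma rintegrable_norm f : rintegrable mu f -> rintegrable mu (fun x => `|f x|).
Proof. by move=> fi; exact: integrable_norm. Qed.

Lemma rintegrable0 : rintegrable mu (fun=> 0).
Proof. exact: integrable0. Qed.

Lemma Rintegral0 : \int[mu]_x (0 : R) = 0.
Proof. by rewrite /Rintegral integral0. Qed.

Lemma rintegrable_sum I (s : seq I) (P : pred I) (F : I -> T -> R) :
  (forall i, P i -> rintegrable mu (F i)) ->
  rintegrable mu (fun x => \sum_(i <- s | P i) F i x).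
Proof.
move=> Fi; elim: s => [|i s IH].
  have -> : (fun x => \sum_(j <- [::] | P j) F j x) = fun=> 0.
    by apply/funext => x; rewrite big_nil.
  exact: rintegrable0.
have -> : (fun x => \sum_(j <- i :: s | P j) F j x) =
    fun x => (if P i then F i x else 0) + \sum_(j <- s | P j) F j x.
  by apply/funext => x; rewrite big_cons; case: ifP; rewrite ?add0r.
apply: rintegrableD => //; case E: (P i); [exact: Fi|exact: rintegrable0].
Qed.

Lemma Rintegral_sum I (s : seq I) (P : pred I) (F : I -> T -> R) :
  (forall i, P i -> rintegrable mu (F i)) ->
  \int[mu]_x (\sum_(i <- s | P i) F i x) = \sum_(i <- s | P i) \int[mu]_x F i x.
Proof.
move=> Fi; elim: s => [|i s IH].
  by under eq_Rintegral do rewrite big_nil; rewrite big_nil Rintegral0.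
under eq_Rintegral do rewrite big_cons; rewrite big_cons.
case: ifP => // Pi; rewrite RintegralD// ?IH//; first exact: Fi.
exact: rintegrable_sum.
Qed.

Lemma EFin_Rintegral f : rintegrable mu f ->
  (\int[mu]_x f x)%:E = (\int[mu]_x (f x)%:E)%E.
Proof. by move=> fi; rewrite fineK//; exact: integrable_fin_num. Qed.

Lemma rintegrable_ge0P f : measurable_fun setT f -> (forall x, 0 <= f x) ->
  (\int[mu]_x (f x)%:E < +oo)%E -> rintegrable mu f.
Proof.
move=> mf f0 fi; apply/integrableP; split; first exact/measurable_EFinP.
by under eq_integral do rewrite /= ger0_norm//.
Qed.

Lemma Rdominated_cvg (f_ : nat -> T -> R) f g :
  (forall n, measurable_fun setT (f_ n)) ->
  measurable_fun setT f ->
  {ae mu, forall x, f_ n x @[n --> \oo] --> f x} ->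
  rintegrable mu g -> (forall n x, `|f_ n x| <= g x) ->
  rintegrable mu f /\ \int[mu]_x f_ n x @[n --> \oo] --> \int[mu]_x f x.
Proof.
move=> mf_ mf f_f gi fg.
have [] := @dominated_convergence _ _ _ mu setT measurableT
   (fun n => EFin \o f_ n) (EFin \o f) (EFin \o g).
- by move=> n; exact/measurable_EFinP.
- exact/measurable_EFinP.
- by apply: filterS f_f => x fx _; apply/fine_cvgP; split; [exact: nearW|].
- by [].
- by apply: aeW => x n _; rewrite /= lee_fin.
move=> fi _ cv; split => //.
by apply: fine_cvg; rewrite EFin_Rintegral.
Qed.

End real_integrable.

Section bounded_kernel_Fubini.
Context d1 d2 (T1 : measurableType d1) (T2 : measurableType d2) (R : realType).
Variables (m1 : {sigma_finite_measure set T1 -> \bar R}).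
Variables (m2 : {sigma_finite_measure set T2 -> \bar R}).

(** The bound [|M| |a x| |b y|] gives absolute integrability on the product, so Fubini's theorem
    applies. The Fourier transforms below need it with sines and cosines as kernels. *)
Lemma Rintegral_swap_bounded (a : T1 -> R) (b : T2 -> R) (k : T1 * T2 -> R) (M : R) :
  rintegrable m1 a -> rintegrable m2 b -> measurable_fun setT k ->
  (forall z, `|k z| <= M) ->
  \int[m1]_x (a x * \int[m2]_y (b y * k (x, y))) =
  \int[m2]_y (b y * \int[m1]_x (a x * k (x, y))).
Proof.
move=> ai bi mk kM.
have ma := rintegrable_measurable ai; have mb := rintegrable_measurable bi.
pose f (z : T1 * T2) := a z.1 * b z.2 * k z.
have mf : measurable_fun setT f.
  apply: measurable_funM => //; apply: measurable_funM.
  - exact: (measurableT_comp ma measurable_fst).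
  - exact: (measurableT_comp mb measurable_snd).
have kx x : measurable_fun setT (fun y => k (x, y)).
  by apply: (measurableT_comp mk); exact: measurable_pair1.
have ky y : measurable_fun setT (fun x => k (x, y)).
  by apply: (measurableT_comp mk); exact: measurable_pair2.
have bki x : rintegrable m2 (fun y => b y * k (x, y)).
  exact: (rintegrableM bi).
have aki y : rintegrable m1 (fun x => a x * k (x, y)).
  exact: (rintegrableM ai).
have fi : (m1 \x m2)%E.-integrable setT (EFin \o f).
  apply/integrable12ltyP; first exact/measurable_EFinP.
  pose B := \int[m2]_y `|b y|.
  apply: (@le_lt_trans _ _ (\int[m1]_x (`|M| * B * `|a x|)%:E)%E).
    apply: ge0_le_integral => //.
    - by move=> x _; apply: integral_ge0.
    - apply: (@measurable_fun_fubini_tonelli_F _ _ _ _ _ m2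
        (fun z => `|(EFin \o f) z|%E)) => //.
      by apply: measurableT_comp => //; exact/measurable_EFinP.
    - apply/measurable_EFinP; apply: measurable_funM => //.
      exact: measurableT_comp.
    - move=> x _; rewrite [X in (_ <= X%:E)%E](_ : _ = (`|M| * `|a x|) * B); last by ring.
      rewrite /B -RintegralZl//; last exact: rintegrable_norm.
      have abi : rintegrable m2 (fun y => `|M| * `|a x| * `|b y|).
        by apply: rintegrableZ; exact: rintegrable_norm.
      rewrite EFin_Rintegral//; apply: ge0_le_integral => //.
      + apply: measurableT_comp => //; apply/measurable_EFinP.
        by apply: (measurableT_comp mf); exact: measurable_pair1.
      + by apply/measurable_EFinP; exact: rintegrable_measurable abi.
      + move=> y _ /=; rewrite lee_fin /f/= !normrM [leLHS]mulrC -[leRHS]mulrA.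
        by rewrite ler_wpM2r ?mulr_ge0// (le_trans (kM _))// ler_norm.
  have := rintegrableZ (`|M| * B) (rintegrable_norm ai).
  by move=> Mi; rewrite -EFin_Rintegral// ltry.
have := Fubini fi; rewrite /f/=.
under eq_integral => x _.
  rewrite (_ : \int[m2]_y _ = (a x * \int[m2]_y (b y * k (x, y)))%:E)%E; last first.
    under eq_integral do rewrite -mulrA.
    by rewrite -EFin_Rintegral ?RintegralZl//; exact: rintegrableZ.
  over.
move=> E; rewrite /Rintegral -/(Rintegral _ _ _).
rewrite {1}/Rintegral E; congr fine; apply: eq_integral => y _.
rewrite [LHS](eq_integral (fun x => (b y * (a x * k (x, y)))%:E)); last first.
  by move=> x _ /=; congr EFin; ring.
by rewrite -(EFin_Rintegral (rintegrableZ (b y) (aki y))) RintegralZl.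
Qed.

End bounded_kernel_Fubini.

(* Pointwise forms of the library lemmas: applying them to a lambda term is
   first-order. *)
Section pointwise_continuity.
Variables (R : realType) (T : topologicalType).
Implicit Types f g : T -> R.

Lemma continuous_funD f g : continuous f -> continuous g ->
  continuous (fun x => f x + g x).
Proof. by move=> cf cg x; apply: cvgD; [exact: cf|exact: cg]. Qed.

Lemma continuous_funN f : continuous f -> continuous (fun x => - f x).
Proof. by move=> cf x; apply: cvgN; exact: cf. Qed.

Lemma continuous_funM f g : continuous f -> continuous g ->
  continuous (fun x => f x * g x).
Proof. by move=> cf cg x; apply: cvgM; [exact: cf|exact: cg]. Qed.

Lemma continuous_funX f n : continuous f -> continuous (fun x => f x ^+ n).
Proof.
move=> cf; elim: n => [|n IH]; first by move=> x; exact: cvg_cst.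
under eq_fun do rewrite exprS.
exact: continuous_funM.
Qed.

Lemma continuous_fun_comp (h : R -> R) f : continuous h -> continuous f ->
  continuous (fun x => h (f x)).
Proof. by move=> ch cf x; apply: (continuous_comp (cf x)); exact: ch. Qed.

Lemma continuous_fun_expR f : continuous f -> continuous (fun x => expR (f x)).
Proof. by apply: continuous_fun_comp; exact: continuous_expR. Qed.

Lemma continuous_fun_cos f : continuous f -> continuous (fun x => cos (f x)).
Proof. by apply: continuous_fun_comp; exact: continuous_cos. Qed.

Lemma continuous_fun_sin f : continuous f -> continuous (fun x => sin (f x)).
Proof. by apply: continuous_fun_comp; exact: continuous_sin. Qed.

Lemma continuous_fun_norm f : continuous f -> continuous (fun x => `|f x|).
Proof. by apply: continuous_fun_comp; exact: norm_continuous. Qed.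

Lemma continuous_fun_cst (c : R) : continuous (fun _ : T => c).
Proof. by move=> x; exact: cvg_cst. Qed.

End pointwise_continuity.

Lemma continuous_fun_id (R : realType) : continuous (fun x : R => x).
Proof. by move=> x. Qed.

Ltac ctns := cbv beta; lazymatch goal with
  | |- forall x, @continuous_at _ _ _ ?h => lazymatch h with
    | fun _ => ?c => exact: continuous_fun_cst
    | fun x => x => exact: continuous_fun_id
    | fun x => @Algebra.add _ (@?f x) (@?g x) => apply: continuous_funD; ctns
    | fun x => @Algebra.opp _ (@?f x) => apply: continuous_funN; ctns
    | fun x => @GRing.mul _ (@?f x) (@?g x) => apply: continuous_funM; ctns
    | fun x => @GRing.exp _ (@?f x) _ => apply: continuous_funX; ctns
    | fun x => @expR _ (@?f x) => apply: continuous_fun_expR; ctns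
    | fun x => @cos _ (@?f x) => apply: continuous_fun_cos; ctns
    | fun x => @sin _ (@?f x) => apply: continuous_fun_sin; ctns
    | fun x => @Num.norm _ _ (@?f x) => apply: continuous_fun_norm; ctns
    | _ => first [ assumption | exact: norm_continuous
        | exact: (continuous_funN (@continuous_fun_id _)) | exact: mulrl_continuous
        | exact: continuous_expR | exact: continuous_cos | exact: continuous_sin ]
    end
  end.

(** * Integrals over the line by exhaustion with symmetric intervals *)

Section integral_on_the_line.
Variable R : realType.
Local Notation mu := (@lebesgue_measure R).
Implicit Types f F : R -> R.

Lemma Rintegral_cvg_set d (T : measurableType d) (m : {measure set T -> \bar R})
    (D : nat -> set T) (f : T -> R) :
  (forall n, measurable (D n)) -> (forall x, \forall n \near \oo, D n x) ->
  rintegrable m f ->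
  \int[m]_(x in D n) f x @[n --> \oo] --> \int[m]_x f x.
Proof.
move=> mD Dx fi; have mf := rintegrable_measurable fi.
under eq_fun do rewrite Rintegral_mkcond.
apply: (Rdominated_cvg (g := fun x => `|f x|) _ _ _ _ _).2 => //.
- move=> n; apply/measurable_restrict => //; exact: measurable_funTS.
- apply: aeW => x; apply: cvg_near_cst.
  by apply: filterS (Dx x) => n Dnx; rewrite patchE mem_set.
- exact: rintegrable_norm.
- by move=> n x; rewrite patchE; case: ifP; rewrite ?normr0.
Qed.

Lemma near_itv_symmetric (x : R) : \forall n \near \oo, `[- n%:R, n%:R]%classic x.
Proof.
near=> n; rewrite /= in_itv/= -ler_norml; near: n; exact: nbhs_infty_ger.
Unshelve. all: by end_near. Qed.

Lemma Rintegral_FTC2 f F (a b : R) : a <= b -> continuous f ->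
  (forall x : R, is_derive x 1 F (f x)) ->
  \int[mu]_(x in `[a, b]) f x = F b - F a.
Proof.
move=> + cf dF; rewrite le_eqVlt => /predU1P[<-|ab].
  by rewrite set_itv1 Rintegral_set1 subrr.
have cF : continuous F.
  by move=> x; apply: differentiable_continuous; apply/derivable1_diffP; case: (dF x).
rewrite /Rintegral (@continuous_FTC2 _ f F)//.
- exact: continuous_subspaceT.
- by split => [x _||]; [case: (dF x)|by apply: cvg_at_right_filter; exact: cF
    |by apply: cvg_at_left_filter; exact: cF].
- by move=> x _; rewrite derive1E; case: (dF x).
Qed.

Lemma Rintegral_derivative f F (l1 l2 : R) : continuous f ->
  (forall x : R, is_derive x 1 F (f x)) -> rintegrable mu f ->
  F n%:R @[n --> \oo] --> l1 -> F (- n%:R) @[n --> \oo] --> l2 ->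
  \int[mu]_x f x = l1 - l2.
Proof.
move=> cf dF fi Fl1 Fl2.
have := @Rintegral_cvg_set _ _ mu (fun n => `[- n%:R, n%:R]%classic) f
  (fun n => measurable_itv _) near_itv_symmetric fi.
under eq_fun => n do rewrite (@Rintegral_FTC2 _ F) ?ge0_cp//.
have h : F n%:R - F (- n%:R) @[n --> \oo] --> l1 - l2 by exact: cvgB.
by move/(@cvg_unique _ (@Rhausdorff R) _ _ _ _ h) => <-.
Qed.

Lemma ge0_integral_line f (a : nat -> R) (l : R) :
  measurable_fun setT f -> (forall x, 0 <= f x) ->
  (forall n, (\int[mu]_(x in `[(- n%:R)%R, n%:R%R]) (f x)%:E)%E = (a n)%:E) ->
  a @ \oo --> l -> (\int[mu]_x (f x)%:E)%E = l%:E.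
Proof.
move=> mf f0 fa al.
have E : \bigcup_i `[- i%:R, i%:R]%classic = [set: R].
  apply/seteqP; split => // x _.
  by have [n _ /(_ n (leqnn _)) nx] := near_itv_symmetric x; exists n.
have H : (\int[mu]_(x in `[(- i%:R)%R, i%:R%R]) (f x)%:E)%E @[i --> \oo] -->
    (\int[mu]_x (f x)%:E)%E.
  rewrite -E; apply: (@ge0_nondecreasing_set_cvg_integral _ (measurableTypeR R) R
    (fun i => `[- i%:R, i%:R]%classic : set R) (fun x => (f x)%:E)) => //.
  - move=> n m nm; apply/subsetPset => x /=; rewrite !in_itv/= => /andP[h1 h2].
    have : n%:R <= m%:R :> R by rewrite ler_nat.
    lra.
  - by move=> n; apply/measurable_EFinP; exact: measurable_funTS.
  - by move=> n x _; rewrite lee_fin.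
have Ha : (a n)%:E @[n --> \oo] --> (\int[mu]_x (f x)%:E)%E.
  by move: H; under eq_fun do rewrite fa.
have h : (a n)%:E @[n --> \oo] --> l%:E.
  by apply/fine_cvgP; split; [exact: nearW|].
by apply: (cvg_unique _ Ha h).
Qed.

(** The sign of [f] takes the place of integrability: monotone convergence along [[- n, n]] both
    shows that the integral is finite and evaluates it. *)
Lemma ge0_integral_derivative f F (l1 l2 : R) : continuous f ->
  (forall x, 0 <= f x) -> (forall x : R, is_derive x 1 F (f x)) ->
  F n%:R @[n --> \oo] --> l1 -> F (- n%:R) @[n --> \oo] --> l2 ->
  (\int[mu]_x (f x)%:E)%E = (l1 - l2)%:E.
Proof.
move=> cf f0 dF Fl1 Fl2.
apply: (@ge0_integral_line f (fun n => F n%:R - F (- n%:R))) => //.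
- exact: continuous_measurable_fun.
- move=> n; have n0 : 0 <= n%:R :> R by [].
  rewrite -(@Rintegral_FTC2 f) //; last lra.
  rewrite fineK//; apply: integrable_fin_num => //.
  apply: continuous_compact_integrable; first exact: segment_compact.
  exact: continuous_subspaceT.
- exact: cvgB.
Qed.

Lemma integral_affine f (b c : R) : 0 < c -> continuous f ->
  (forall x, 0 <= f x) ->
  (\int[mu]_x (f x)%:E)%E = (\int[mu]_x (f (b + c * x) * c)%:E)%E.
Proof.
move=> c0 cf f0; pose F x := b + c * x.
have dF (x : R) : is_derive x 1 F c.
  by apply: is_derive_eq; rewrite add0r /GRing.scale/=; ring.
have F'E : F^`()%classic = cst c.
  by apply/funext => x; rewrite derive1E; case: (dF x).
rewrite (@increasing_ge0_integration_by_substitutionT _ F f)// ?F'E//.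
- by move=> x y xy; rewrite /F ltrD2l ltr_pM2l.
- by move=> x; exact: cvg_cst.
- exact: is_cvg_cst.
- exact: is_cvg_cst.
- apply/cvgrNyPle => A; near=> x.
  have h : x <= (A - b) / c by near: x; apply: nbhs_ninfty_le; exact: num_real.
  by rewrite /F -lerBrDl mulrC -ler_pdivlMr.
- apply/cvgryPge => A; near=> x.
  have h : (A - b) / c <= x by near: x; apply: nbhs_pinfty_ge; exact: num_real.
  by rewrite /F -lerBlDl mulrC -ler_pdivrMr.
Unshelve. all: by end_near. Qed.

End integral_on_the_line.

(** * The Poisson kernel and the Plancherel identity *)

Section Poisson_kernel.
Variable R : realType.
Local Notation mu := (@lebesgue_measure R).
Implicit Types f F : R -> R.

(** Meant for integrands containing [|x|], which have a different elementary antiderivative on each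
    side of 0. *)
Lemma Rintegral_FTC2_glue f f1 f2 F1 F2 (a : R) : 0 <= a -> continuous f ->
  continuous f1 -> continuous f2 ->
  (forall x : R, is_derive x 1 F1 (f1 x)) -> (forall x : R, is_derive x 1 F2 (f2 x)) ->
  (forall x, x <= 0 -> f x = f1 x) -> (forall x, 0 <= x -> f x = f2 x) ->
  \int[mu]_(x in `[- a, a]) f x = F1 0 - F1 (- a) + (F2 a - F2 0).
Proof.
move=> a0 cf cf1 cf2 dF1 dF2 ff1 ff2.
have fi : mu.-integrable `[- a, a] (EFin \o f).
  apply: continuous_compact_integrable; first exact: segment_compact.
  exact: continuous_subspaceT.
have E : \int[mu]_(x in `[- a, a]) f x - \int[mu]_(x in `[- a, 0]) f x =
    \int[mu]_(x in `]0, a]) f x.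
  apply: Rintegral_itvB => //; rewrite ?bnd_simp ?oppr_le0//.
rewrite -(Rintegral_FTC2 _ cf1 dF1) ?oppr_le0// -(Rintegral_FTC2 _ cf2 dF2)//.
have f2i : mu.-integrable `[0, a] (EFin \o f2).
  apply: continuous_compact_integrable; first exact: segment_compact.
  exact: continuous_subspaceT.
rewrite -[X in _ = _ + X]Rintegral_itv_obnd_cbnd; last first.
  by apply: integrableS f2i => //; exact: subset_itv_oc_cc.
have -> : \int[mu]_(x in `[- a, 0]) f1 x = \int[mu]_(x in `[- a, 0]) f x.
  by apply: eq_Rintegral => x; rewrite inE/= in_itv/= => /andP[_ /ff1].
have -> : \int[mu]_(x in `]0, a]) f2 x = \int[mu]_(x in `]0, a]) f x.
  by apply: eq_Rintegral => x; rewrite inE/= in_itv/= => /andP[/ltW /ff2].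
by rewrite -E; ring.
Qed.

Lemma cvg_expRN_nat (e : R) (b : nat -> R) (M : R) : 0 < e ->
  (forall n, `|b n| <= M) -> expR (- (e * n%:R)) * b n @[n --> \oo] --> 0.
Proof.
move=> e0 bM.
have h : expR (- (e * n%:R)) @[n --> \oo] --> 0.
  have : e * n%:R @[n --> \oo] --> +oo.
    apply/cvgryPge => A; near=> n.
    have h : A / e <= n%:R by near: n; exact: nbhs_infty_ger.
    by rewrite mulrC -ler_pdivrMr.
  by move=> h; exact: (cvg_comp _ _ h (@cvgr_expR R)).
have h1 : expR (- (e * n%:R)) * M @[n --> \oo] --> 0.
  by rewrite -(mul0r M); apply: cvgMl.
apply: norm_cvg0; apply: (squeeze_cvgr _ (cvg_cst 0) h1).
apply: nearW => n; rewrite normr_ge0 normrM ger0_norm ?expR_ge0//=.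
by rewrite ler_wpM2l ?expR_ge0.
Unshelve. all: by end_near. Qed.

Lemma continuous_expRNabs (e : R) : continuous (fun x : R => expR (- (e * `|x|))).
Proof. by ctns. Qed.

Lemma rintegrable_expRNabs (e : R) : 0 < e ->
  rintegrable mu (fun x : R => expR (- (e * `|x|))).
Proof.
move=> e0.
have E : (\int[mu]_x (expR (- (e * `|x|)))%:E)%E = (2 / e)%:E.
  apply: (@ge0_integral_line _ _ (fun n => 2 / e - expR (- (e * n%:R)) * (2 / e))).
  - apply: continuous_measurable_fun; exact: continuous_expRNabs.
  - by move=> x; exact: expR_ge0.
  - move=> n.
    rewrite -[LHS]fineK; last first.
      apply: integrable_fin_num => //.
      apply: continuous_compact_integrable; first exact: segment_compact.
      apply: continuous_subspaceT; exact: continuous_expRNabs.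
    congr EFin; rewrite -/(Rintegral mu _ _).
    have dF1 (x : R) : is_derive x 1 (fun x => e^-1 * expR (e * x)) (expR (e * x)).
      by apply: is_derive_eq; rewrite /GRing.scale/=; field; rewrite gt_eqF.
    have dF2 (x : R) : is_derive x 1 (fun x => - e^-1 * expR (- e * x)) (expR (- e * x)).
      by apply: is_derive_eq; rewrite /GRing.scale/=; field; rewrite gt_eqF.
    have cE (c : R) : continuous (fun x : R => expR (c * x)).
      by ctns.
    rewrite (Rintegral_FTC2_glue _ _ (cE e) (cE (- e)) dF1 dF2)//.
    + by rewrite !mulr0 expR0 mulrN !mulNr; field; rewrite gt_eqF.
    + exact: continuous_expRNabs.
    + by move=> x x0; rewrite ler0_norm// mulrN opprK.
    + by move=> x x0; rewrite ger0_norm// mulNr.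
  - rewrite -[X in _ --> X]subr0; apply: cvgB; first exact: cvg_cst.
    by apply: (@cvg_expRN_nat _ _ `|2 / e|).
apply: rintegrable_ge0P.
- apply: continuous_measurable_fun; exact: continuous_expRNabs.
- by move=> x; exact: expR_ge0.
- by rewrite E ltry.
Qed.

(** This is 2 pi times the Poisson kernel of the upper half plane at height [e]; the factor is kept
    so that it is exactly the Fourier transform of [e^(- e |x|)]. *)
Definition poisson (e w : R) : R := 2 * e / (e ^+ 2 + w ^+ 2).

Lemma Rintegral_expRNabs_cos (e w : R) : 0 < e ->
  \int[mu]_x (expR (- (e * `|x|)) * cos (x * w)) = poisson e w.
Proof.
move=> e0.
have ew : e ^+ 2 + w ^+ 2 != 0 by rewrite gt_eqF// ltr_pwDl ?sqr_ge0 ?exprn_gt0.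
pose g c x := expR (c * x) * cos (x * w).
(* One formula serves both half-lines, with [c = e] on the left and [c = - e] on the right:
   differentiating it only requires [c ^+ 2 = e ^+ 2]. *)
pose F c x := expR (c * x) * ((c * cos (x * w) + w * sin (x * w)) / (e ^+ 2 + w ^+ 2)).
have dF c (x : R) : c ^+ 2 = e ^+ 2 -> is_derive x 1 (F c) (g c x).
  move=> ce; rewrite /F /g; apply: is_derive_eq; rewrite /GRing.scale/= -ce; field.
  by rewrite ce.
have cf : continuous (fun x : R => expR (- (e * `|x|)) * cos (x * w)).
  by ctns.
have cg c : continuous (g c).
  by rewrite /g; ctns.
have fi : rintegrable mu (fun x : R => expR (- (e * `|x|)) * cos (x * w)).
  apply: (@rintegrableM _ _ _ _ _ _ 1); first exact: rintegrable_expRNabs.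
    by apply: continuous_measurable_fun; ctns.
  by move=> x; rewrite ler_norml cos_geN1 cos_le1.
have H := @Rintegral_cvg_set _ _ _ mu (fun n => `[- n%:R, n%:R]%classic) _
  (fun n => measurable_itv _) (@near_itv_symmetric R) fi.
have dF1 (x : R) : is_derive x 1 (F e) (g e x) by exact: dF.
have dF2 (x : R) : is_derive x 1 (F (- e)) (g (- e) x) by apply: dF; rewrite sqrrN.
have HE n : \int[mu]_(x in `[- n%:R, n%:R]) (expR (- (e * `|x|)) * cos (x * w)) =
    F e 0 - F e (- n%:R) + (F (- e) n%:R - F (- e) 0).
  apply: (Rintegral_FTC2_glue _ cf (cg e) (cg (- e)) dF1 dF2) => // x x0.
    by rewrite ler0_norm// mulrN opprK.
  by rewrite ger0_norm// -mulNr.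
move: H; under eq_fun do rewrite HE; move=> H; apply: (@cvg_unique _ (@Rhausdorff R) _ _ _ _ H).
have FE c n x : c * x = - (e * n%:R) -> F c x = expR (- (e * n%:R)) *
    ((c * cos (x * w) + w * sin (x * w)) / (e ^+ 2 + w ^+ 2)).
  by move=> cx; rewrite /F cx.
have bnd c x : `|c| = e ->
    `|(c * cos (x * w) + w * sin (x * w)) / (e ^+ 2 + w ^+ 2)| <=
    (e + `|w|) / (e ^+ 2 + w ^+ 2).
  move=> ce; rewrite normrM [X in _ * X]ger0_norm; last first.
    by rewrite invr_ge0 addr_ge0 ?sqr_ge0.
  rewrite ler_wpM2r ?invr_ge0 ?addr_ge0 ?sqr_ge0// (le_trans (ler_normD _ _))//.
  rewrite !normrM ce lerD//.
    by rewrite ler_piMr ?(ltW e0)// ler_norml cos_geN1 cos_le1.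
  by rewrite ler_piMr// ler_norml sin_geN1 sin_le1.
have -> : poisson e w = F e 0 - 0 + (0 - F (- e) 0).
  by rewrite /poisson /F !(mulr0, mul0r) expR0 cos0 sin0; field.
apply: cvgD; apply: cvgB; try exact: cvg_cst.
  under eq_fun do rewrite (@FE _ _ _ (mulrN _ _)).
  by apply: (cvg_expRN_nat e0) => n; apply: bnd; rewrite gtr0_norm.
under eq_fun do rewrite (@FE _ _ _ (mulNr _ _)).
by apply: (cvg_expRN_nat e0) => n; apply: bnd; rewrite normrN gtr0_norm.
Qed.

Lemma Rintegral_expRNabs_sin (e w : R) : 0 < e ->
  \int[mu]_x (expR (- (e * `|x|)) * sin (x * w)) = 0.
Proof.
move=> e0.
have ew : e ^+ 2 + w ^+ 2 != 0 by rewrite gt_eqF// ltr_pwDl ?sqr_ge0 ?exprn_gt0.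
pose g c x := expR (c * x) * sin (x * w).
pose F c x := expR (c * x) * ((c * sin (x * w) - w * cos (x * w)) / (e ^+ 2 + w ^+ 2)).
have dF c (x : R) : c ^+ 2 = e ^+ 2 -> is_derive x 1 (F c) (g c x).
  move=> ce; rewrite /F /g; apply: is_derive_eq; rewrite /GRing.scale/= -ce; field.
  by rewrite ce.
have cf : continuous (fun x : R => expR (- (e * `|x|)) * sin (x * w)) by ctns.
have cg c : continuous (g c) by rewrite /g; ctns.
have fi : rintegrable mu (fun x : R => expR (- (e * `|x|)) * sin (x * w)).
  apply: (@rintegrableM _ _ _ _ _ _ 1); first exact: rintegrable_expRNabs.
    by apply: continuous_measurable_fun; ctns.
  by move=> x; rewrite ler_norml sin_geN1 sin_le1.
have H := @Rintegral_cvg_set _ _ _ mu (fun n => `[- n%:R, n%:R]%classic) _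
  (fun n => measurable_itv _) (@near_itv_symmetric R) fi.
have dF1 (x : R) : is_derive x 1 (F e) (g e x) by exact: dF.
have dF2 (x : R) : is_derive x 1 (F (- e)) (g (- e) x) by apply: dF; rewrite sqrrN.
have HE n : \int[mu]_(x in `[- n%:R, n%:R]) (expR (- (e * `|x|)) * sin (x * w)) = 0.
  rewrite (Rintegral_FTC2_glue _ cf (cg e) (cg (- e)) dF1 dF2) => //.
  - by rewrite /F !(mulrN, mulNr, sinN, cosN, mulr0, mul0r, opprK, oppr0, sin0); ring.
  - by move=> x x0; rewrite ler0_norm// mulrN opprK.
  - by move=> x x0; rewrite ger0_norm// -mulNr.
by move: H; under eq_fun do rewrite HE; move=> H;
  apply: (@cvg_unique _ (@Rhausdorff R) _ _ _ _ H); exact: cvg_cst.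
Qed.

Lemma poisson_ge0 e w : 0 < e -> 0 <= poisson e w.
Proof. by move=> e0; rewrite divr_ge0 ?addr_ge0 ?sqr_ge0// mulr_ge0// ltW. Qed.

Lemma continuous_poisson e : 0 < e -> continuous (poisson e).
Proof.
move=> e0 x; apply: cvgM; first exact: cvg_cst.
apply: cvgV; first by rewrite gt_eqF// ltr_pwDl ?sqr_ge0 ?exprn_gt0.
have c : continuous (fun w : R => e ^+ 2 + w ^+ 2) by ctns.
exact: c.
Qed.

(* The limit is 2 pi, the mass of the kernel at every scale. *)
Lemma integral_poisson_unit :
  (\int[mu]_x (poisson 1 x)%:E)%E = (2 * pi)%:E.
Proof.
have dF (x : R) : is_derive x 1 (fun x => 2 * atan x) (poisson 1 x).
  have -> : poisson 1 x = 2 * (1 + x ^+ 2)^-1 by rewrite /poisson expr1n mulr1.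
  have dA : is_derive x 1 atan (1 + x ^+ 2)^-1.
    by split; [exact: derivable_atan|rewrite -derive1E derive1_atan].
  by apply: is_derive_eq.
rewrite (@ge0_integral_derivative _ _ _ pi (- pi) _ _ dF).
- by congr EFin; ring.
- exact: continuous_poisson.
- by move=> x; exact: poisson_ge0.
- have -> : pi = 2 * (pi / 2) :> R by field.
  apply: cvgM; first exact: cvg_cst.
  exact: (cvg_comp _ _ (@cvgr_idn R) (@cvgy_atan R)).
- have -> : - pi = 2 * - (pi / 2) :> R by field.
  apply: cvgM; first exact: cvg_cst.
  under eq_fun do rewrite atanN; apply: cvgN.
  exact: (cvg_comp _ _ (@cvgr_idn R) (@cvgy_atan R)).
Qed.

End Poisson_kernel.

(** * The Poisson kernel as an approximate identity *)

Section Poisson_convolution.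
Variable R : realType.
Local Notation mu := (@lebesgue_measure R).
Implicit Types (f g h k : R -> R) (e M : R).

Lemma normr_cos_le1 (x : R) : `|cos x| <= 1.
Proof. by rewrite ler_norml cos_geN1 cos_le1. Qed.

Lemma normr_sin_le1 (x : R) : `|sin x| <= 1.
Proof. by rewrite ler_norml sin_geN1 sin_le1. Qed.

Lemma poisson_le e w : 0 < e -> poisson e w <= 2 / e.
Proof.
move=> e0; rewrite /poisson ler_pdivrMr; last by rewrite ltr_pwDl ?sqr_ge0 ?exprn_gt0.
rewrite -subr_ge0 (_ : _ - _ = 2 / e * w ^+ 2); last by field; rewrite gt_eqF.
by rewrite mulr_ge0 ?sqr_ge0// divr_ge0// ltW.
Qed.

Lemma poissonN e w : poisson e (- w) = poisson e w.
Proof. by rewrite /poisson sqrrN. Qed.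

Lemma poisson_rescale e w : 0 < e -> poisson e (e * w) * e = poisson 1 w.
Proof.
move=> e0; rewrite /poisson; field.
have ew : 1 + w ^+ 2 != 0 by rewrite gt_eqF// ltr_pwDl ?sqr_ge0.
have e2 : e ^+ 2 + (e * w) ^+ 2 != 0.
  by rewrite gt_eqF// ltr_pwDl ?sqr_ge0 ?exprn_gt0.
by rewrite ?expr1n ?ew ?e2.
Qed.

Lemma ge0_integral_poisson_rescale e u g : 0 < e -> continuous g ->
  (forall x, 0 <= g x) ->
  (\int[mu]_v (g v * poisson e (u - v))%:E =
   \int[mu]_w (g (u + e * w) * poisson 1 w)%:E)%E.
Proof.
move=> e0 cg g0; rewrite (@integral_affine _ _ u e)//.
- apply: eq_integral => w _; rewrite -mulrA; congr (_ * _)%:E.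
  by rewrite opprD addNKr poissonN poisson_rescale.
- apply: continuous_funM => //; apply: continuous_fun_comp; last by ctns.
  exact: continuous_poisson.
- by move=> x; rewrite mulr_ge0 ?poisson_ge0.
Qed.

Lemma rintegrable_poisson1 : rintegrable mu (poisson 1 : R -> R).
Proof.
apply: rintegrable_ge0P.
- by apply: continuous_measurable_fun; exact: continuous_poisson.
- by move=> x; exact: poisson_ge0.
- by rewrite integral_poisson_unit ltry.
Qed.

Lemma integral_poisson e u : 0 < e ->
  (\int[mu]_v (poisson e (u - v))%:E = (2 * pi)%:E)%E.
Proof.
move=> e0; rewrite -integral_poisson_unit.
transitivity (\int[mu]_v (1 * poisson e (u - v))%:E)%E.
  by under [RHS]eq_integral do rewrite mul1r.
rewrite (@ge0_integral_poisson_rescale e u (fun=> 1))//; last by ctns.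
by under eq_integral do rewrite mul1r.
Qed.

Lemma rintegrable_poisson e u : 0 < e -> rintegrable mu (fun v => poisson e (u - v)).
Proof.
move=> e0; apply: rintegrable_ge0P.
- apply: continuous_measurable_fun; apply: continuous_fun_comp; last by ctns.
  exact: continuous_poisson.
- by move=> x; exact: poisson_ge0.
- by rewrite integral_poisson// ltry.
Qed.

Lemma Rintegral_poisson_rescale e u g M : 0 < e -> continuous g ->
  (forall x, `|g x| <= M) ->
  \int[mu]_v (g v * poisson e (u - v)) =
  \int[mu]_w (g (u + e * w) * poisson 1 w).
Proof.
move=> e0 cg gM.
(* The substitution lemma concerns nonnegative functions, so [g] is replaced by [g + M >= 0]. The
   added constant cancels in the end, because both kernels have the same mass. *)
have shifted (c : R -> R) (q : R -> R) : continuous c -> (forall x, `|c x| <= M) ->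
    rintegrable mu q ->
    \int[mu]_v (c v * q v) = \int[mu]_v ((c v + M) * q v) - M * \int[mu]_v q v.
  move=> cc cM qi; under [in RHS]eq_Rintegral do rewrite mulrDl.
  have ci : rintegrable mu (fun v => c v * q v).
    under [X in EFin \o X]eq_fun do rewrite mulrC.
    by apply: (rintegrableM qi) => //; exact: continuous_measurable_fun.
  by rewrite RintegralD//; [rewrite RintegralZl//; ring|exact: rintegrableZ].
have gM0 x : 0 <= g x + M.
  by have := gM x; rewrite ler_norml => /andP[]; lra.
rewrite shifted//; last exact: rintegrable_poisson.
rewrite [RHS](shifted (fun w => g (u + e * w)))//; last 2 first.
- by apply: continuous_fun_comp; ctns.
- exact: rintegrable_poisson1.
congr (_ - _ * _); rewrite /Rintegral.
  by rewrite (@ge0_integral_poisson_rescale _ _ (fun v => g v + M))//; ctns.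
by rewrite integral_poisson// integral_poisson_unit.
Qed.

Definition poisson_conv e g u := \int[mu]_v (g v * poisson e (u - v)).

Lemma normr_poisson_conv_le e u g M : 0 < e -> continuous g ->
  (forall x, `|g x| <= M) -> `|poisson_conv e g u| <= 2 * pi * M.
Proof.
move=> e0 cg gM; rewrite /poisson_conv (Rintegral_poisson_rescale _ e0 cg gM).
have pE : 2 * pi = \int[mu]_w poisson 1 w by rewrite /Rintegral integral_poisson_unit.
have gi : rintegrable mu (fun w => g (u + e * w) * poisson 1 w).
  under [X in EFin \o X]eq_fun do rewrite mulrC.
  apply: (rintegrableM rintegrable_poisson1) => //.
  by apply: continuous_measurable_fun; apply: continuous_fun_comp; ctns.
rewrite mulrC pE -RintegralZl//; last exact: rintegrable_poisson1.
apply: (le_trans (le_normr_Rintegral _ _)) => //.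
apply: le_Rintegral => //; first exact: rintegrable_norm.
  exact: rintegrableZ rintegrable_poisson1.
by move=> x _; rewrite normrM (ger0_norm (poisson_ge0 _ _))// ler_wpM2r ?poisson_ge0.
Qed.

(** Rescaling moves the parameter from the kernel into the argument of [g]. The kernel is then
    fixed, continuity of [g] gives the pointwise limit, and [M * poisson 1] dominates. *)
Lemma cvg_poisson_conv u g M : continuous g -> (forall x, `|g x| <= M) ->
  poisson_conv n.+1%:R^-1 g u @[n --> \oo] --> 2 * pi * g u.
Proof.
move=> cg gM; rewrite /poisson_conv.
under eq_fun => n do rewrite (Rintegral_poisson_rescale u _ cg gM)//.
have -> : 2 * pi * g u = \int[mu]_w (g u * poisson 1 w).
  rewrite RintegralZl//; last exact: rintegrable_poisson1.
  by rewrite /Rintegral integral_poisson_unit mulrC.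
have mp : measurable_fun setT (poisson 1 : R -> R).
  by apply: continuous_measurable_fun; exact: continuous_poisson.
apply: (@Rdominated_cvg _ _ _ mu (fun n w => g (u + n.+1%:R^-1 * w) * poisson 1 w)
  (fun w => g u * poisson 1 w) (fun w => M * poisson 1 w) _ _ _ _ _).2.
- move=> n; apply: measurable_funM => //.
  by apply: continuous_measurable_fun; apply: continuous_fun_comp; ctns.
- exact: measurable_funM.
- apply: aeW => w; apply: cvgMl.
  have h : u + n.+1%:R^-1 * w @[n --> \oo] --> u.
    rewrite -[X in _ --> X]addr0; apply: cvgD; first exact: cvg_cst.
    rewrite -(mul0r w); apply: cvgMl; exact: cvg_harmonic.
  exact: (cvg_comp _ _ h (cg u)).
- exact: rintegrableZ rintegrable_poisson1.
- by move=> n x; rewrite normrM (ger0_norm (poisson_ge0 _ _))// ler_wpM2r ?poisson_ge0.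
Qed.

End Poisson_convolution.

(** * Cosine and sine transforms *)

Section Fourier.
Variable R : realType.
Local Notation mu := (@lebesgue_measure R).
Implicit Types (f g h k : R -> R) (e M x : R).

Definition cosT f x := \int[mu]_u (f u * cos (x * u)).
Definition sinT f x := \int[mu]_u (f u * sin (x * u)).

Lemma measurable_mul2 : measurable_fun setT (fun z : R * R => z.1 * z.2).
Proof. by apply: measurable_funM. Qed.

Lemma measurable_cos2 : measurable_fun setT (fun z : R * R => cos (z.1 * z.2)).
Proof.
exact: (measurableT_comp (continuous_measurable_fun (@continuous_cos R)) measurable_mul2).
Qed.

Lemma measurable_sin2 : measurable_fun setT (fun z : R * R => sin (z.1 * z.2)).
Proof.
exact: (measurableT_comp (continuous_measurable_fun (@continuous_sin R)) measurable_mul2).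
Qed.

Lemma measurable_int_kernel (f : R -> R) (k : R * R -> R) :
  measurable_fun setT f -> measurable_fun setT k ->
  measurable_fun setT (fun x => \int[mu]_u (f u * k (x, u))).
Proof.
move=> mf mk; apply: (@measurable_Rintegral_section _ setT (fun z => f z.2 * k z)) => //.
by apply: measurable_funM => //; exact: (measurableT_comp mf measurable_snd).
Qed.

Lemma normr_int_kernel_le f (k : R -> R) : rintegrable mu f -> measurable_fun setT k ->
  (forall x, `|k x| <= 1) ->
  `|\int[mu]_u (f u * k u)| <= \int[mu]_u `|f u|.
Proof.
move=> fi mk k1; apply: (le_trans (le_normr_Rintegral _ _)) => //.
  exact: (rintegrableM fi mk k1).
apply: le_Rintegral => //.
- apply: rintegrable_norm; exact: (rintegrableM fi mk k1).
- exact: rintegrable_norm.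
- by move=> x _; rewrite normrM ler_piMr.
Qed.

Local Notation E e := (fun x : R => expR (- (e * `|x|))).

Lemma Rintegral_swap_lebesgue (a b : R -> R) (k : R * R -> R) M :
  rintegrable mu a -> rintegrable mu b -> measurable_fun setT k ->
  (forall z, `|k z| <= M) ->
  \int[mu]_x (a x * \int[mu]_y (b y * k (x, y))) =
  \int[mu]_y (b y * \int[mu]_x (a x * k (x, y))).
Proof.
exact: (@Rintegral_swap_bounded _ _ (measurableTypeR R) (measurableTypeR R) R mu mu).
Qed.

(** The transforms of integrable functions are merely bounded; the damping factor [E e] is what
    makes the integral over [x] absolutely convergent. Two exchanges then leave an elementary inner
    integral in [x]. *)
Let bilinear e f g (k1 k2 : R -> R) : 0 < e ->
  rintegrable mu f -> rintegrable mu g ->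
  continuous k1 -> continuous k2 ->
  (forall x, `|k1 x| <= 1) -> (forall x, `|k2 x| <= 1) ->
  \int[mu]_x (E e x * ((\int[mu]_u (f u * k1 (x * u))) * \int[mu]_v (g v * k2 (x * v)))) =
  \int[mu]_u (f u * \int[mu]_v (g v * \int[mu]_x (E e x * (k1 (x * u) * k2 (x * v))))).
Proof.
move=> e0 fi gi ck1 ck2 k11 k21.
have mk (k : R -> R) : continuous k -> measurable_fun setT (fun z : R * R => k (z.1 * z.2)).
  by move=> ck; exact: (measurableT_comp (continuous_measurable_fun ck) measurable_mul2).
have mk' (k : R -> R) u : continuous k -> measurable_fun setT (fun x : R => k (x * u)).
  by move=> ck; apply: continuous_measurable_fun; apply: continuous_fun_comp; ctns.
have mk'' (k : R -> R) x : continuous k -> measurable_fun setT (fun u : R => k (x * u)).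
  by move=> ck; apply: continuous_measurable_fun; apply: continuous_fun_comp; ctns.
have Ei := rintegrable_expRNabs e0.
pose G x := \int[mu]_v (g v * k2 (x * v)).
have mG : measurable_fun setT G.
  apply: (@measurable_int_kernel g (fun z => k2 (z.1 * z.2))); last exact: mk.
  exact: rintegrable_measurable gi.
have Gle x : `|G x| <= \int[mu]_u `|g u|.
  by apply: normr_int_kernel_le => //; exact: mk''.
have EGi : rintegrable mu (fun x => E e x * G x) by exact: (rintegrableM Ei mG Gle).
transitivity (\int[mu]_x ((E e x * G x) * \int[mu]_u (f u * k1 (x * u)))).
  by apply: eq_Rintegral => x _; rewrite -/(G x) mulrCA mulrC.
rewrite (Rintegral_swap_lebesgue (k := fun z : R * R => k1 (z.1 * z.2)) EGi fi (mk _ ck1) (fun=> k11 _)).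
apply: eq_Rintegral => u _; congr (_ * _) => /=.
transitivity (\int[mu]_x ((E e x * k1 (x * u)) * \int[mu]_v (g v * k2 (x * v)))).
  by apply: eq_Rintegral => x _; rewrite -/(G x) mulrAC.
have Ek1i : rintegrable mu (fun x => E e x * k1 (x * u)).
  by apply: (rintegrableM Ei _ (fun=> k11 _)); exact: mk'.
rewrite (Rintegral_swap_lebesgue (k := fun z : R * R => k2 (z.1 * z.2)) Ek1i gi (mk _ ck2) (fun=> k21 _)).
by apply: eq_Rintegral => v _ /=; congr (_ * _); apply: eq_Rintegral => x _; rewrite mulrA.
Qed.

Let Ecosi e w : 0 < e -> rintegrable mu (fun x => E e x * cos (x * w)).
Proof.
move=> e0; apply: (rintegrableM (rintegrable_expRNabs e0) _ (fun=> normr_cos_le1 _)).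
by apply: continuous_measurable_fun; ctns.
Qed.

Let Esini e w : 0 < e -> rintegrable mu (fun x => E e x * sin (x * w)).
Proof.
move=> e0; apply: (rintegrableM (rintegrable_expRNabs e0) _ (fun=> normr_sin_le1 _)).
by apply: continuous_measurable_fun; ctns.
Qed.

Let Ecc e u v : 0 < e -> \int[mu]_x (E e x * (cos (x * u) * cos (x * v))) =
  2^-1 * (poisson e (u - v) + poisson e (u + v)).
Proof.
move=> e0; rewrite -!Rintegral_expRNabs_cos// -RintegralD//; [|exact: Ecosi..].
rewrite -RintegralZl//; last by apply: rintegrableD; exact: Ecosi.
by apply: eq_Rintegral => x _; rewrite (mulrBr x) (mulrDr x) cosB cosD; field.
Qed.

Let Ess e u v : 0 < e -> \int[mu]_x (E e x * (sin (x * u) * sin (x * v))) =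
  2^-1 * (poisson e (u - v) - poisson e (u + v)).
Proof.
move=> e0; rewrite -!Rintegral_expRNabs_cos// -RintegralB//; [|exact: Ecosi..].
rewrite -RintegralZl//; last by apply: rintegrableB; exact: Ecosi.
by apply: eq_Rintegral => x _; rewrite (mulrBr x) (mulrDr x) cosB cosD; field.
Qed.

Let Esc e u v : 0 < e -> \int[mu]_x (E e x * (sin (x * u) * cos (x * v))) = 0.
Proof.
move=> e0; transitivity (2^-1 * (\int[mu]_x (E e x * sin (x * (u + v))) +
   \int[mu]_x (E e x * sin (x * (u - v))))); last first.
  by rewrite !Rintegral_expRNabs_sin// addr0 mulr0.
rewrite -RintegralD//; [|exact: Esini..].
rewrite -RintegralZl//; last by apply: rintegrableD; exact: Esini.
by apply: eq_Rintegral => x _; rewrite (mulrBr x) (mulrDr x) sinB sinD; field.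
Qed.

(** The inner integrand of [Esc] is odd in [x]. This removes the cross terms in Plancherel's
    identity. *)
Lemma Rintegral_sinT_cosT e f g : 0 < e -> rintegrable mu f -> rintegrable mu g ->
  \int[mu]_x (E e x * (sinT f x * cosT g x)) = 0.
Proof.
move=> e0 fi gi; rewrite bilinear//; [|exact: continuous_sin|exact: continuous_cos
  |exact: normr_sin_le1|exact: normr_cos_le1].
rewrite -[RHS](Rintegral0 mu); apply: eq_Rintegral => u _.
rewrite -[RHS](mulr0 (f u)) -[in RHS](Rintegral0 mu); congr (_ * _).
by apply: eq_Rintegral => v _; rewrite Esc// mulr0.
Qed.

(** A regularised Parseval identity: the contributions of [poisson e (u + v)] from cosines and sines
    cancel, and those of [poisson e (u - v)] add up to the convolution. *)
Lemma Rintegral_cosT2_sinT2 e f g : 0 < e -> rintegrable mu f -> rintegrable mu g ->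
  \int[mu]_x (E e x * (cosT f x * cosT g x)) +
  \int[mu]_x (E e x * (sinT f x * sinT g x)) =
  \int[mu]_u (f u * poisson_conv e g u).
Proof.
move=> e0 fi gi.
have c1 := normr_cos_le1; have s1 := normr_sin_le1.
rewrite !bilinear//; [|exact: continuous_sin|exact: continuous_sin
  |exact: continuous_cos|exact: continuous_cos].
have mP (q : R * R -> R) : measurable_fun setT q -> measurable_fun setT (fun z => poisson e (q z)).
  move=> mq; apply: (measurableT_comp _ mq); apply: continuous_measurable_fun.
  exact: continuous_poisson.
(* The two kernels [Ecc] ([b = false]) and [Ess] ([b = true]) differ in one sign only, so that
   measurability and bounds are proved once. *)
pose K (z : R * R) (b : bool) := 2^-1 * (poisson e (z.1 - z.2) + (-1) ^+ b * poisson e (z.1 + z.2)).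
have mK b : measurable_fun setT (K^~ b).
  apply: measurable_funM => //; apply: measurable_funD.
    by apply: mP; exact: measurable_funB.
  by apply: measurable_funM => //; apply: mP; exact: measurable_funD.
have Kle z b : `|K z b| <= 2 / e.
  rewrite normrM (le_trans (y := 2^-1 * (2 / e + 2 / e)))//; last first.
    by rewrite le_eqVlt; apply/orP; left; apply/eqP; field; rewrite gt_eqF.
  rewrite ger0_norm// ler_wpM2l// (le_trans (ler_normD _ _))//.
  rewrite normrMsign !ger0_norm ?poisson_ge0//.
  by rewrite lerD ?poisson_le.
have Gi b u : rintegrable mu (fun v => g v * K (u, v) b).
  apply: (rintegrableM gi _ (fun=> Kle _ _)).
  by apply: (measurableT_comp (mK b)); exact: measurable_pair1.
have Fi b : rintegrable mu (fun u => f u * \int[mu]_v (g v * K (u, v) b)).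
  apply: (@rintegrableM _ _ _ _ _ _ (`|2 / e| * \int[mu]_v `|g v|) fi).
    by apply: (@measurable_int_kernel g (K^~ b)) => //; exact: rintegrable_measurable gi.
  move=> u; apply: (le_trans (le_normr_Rintegral _ _)) => //.
  rewrite -RintegralZl//; last exact: rintegrable_norm.
  apply: le_Rintegral => //; first exact: rintegrable_norm.
    by apply: rintegrableZ; exact: rintegrable_norm.
  by move=> v _; rewrite normrM mulrC ler_wpM2r// (le_trans (Kle _ _))// ler_norm.
have -> : \int[mu]_u (f u * \int[mu]_v (g v * \int[mu]_x (E e x * (cos (x * u) * cos (x * v)))))
    = \int[mu]_u (f u * \int[mu]_v (g v * K (u, v) false)).
  apply: eq_Rintegral => u _; congr (_ * _); apply: eq_Rintegral => v _.
  by rewrite Ecc// /K/= expr0 mul1r.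
have -> : \int[mu]_u (f u * \int[mu]_v (g v * \int[mu]_x (E e x * (sin (x * u) * sin (x * v)))))
    = \int[mu]_u (f u * \int[mu]_v (g v * K (u, v) true)).
  apply: eq_Rintegral => u _; congr (_ * _); apply: eq_Rintegral => v _.
  by rewrite Ess// /K/= expr1 mulN1r.
rewrite -RintegralD//; apply: eq_Rintegral => u _.
rewrite -mulrDr -RintegralD//; congr (_ * _); apply: eq_Rintegral => v _.
by rewrite /K/=; field.
Qed.

Lemma measurable_cosT f : rintegrable mu f -> measurable_fun setT (cosT f).
Proof.
move=> /rintegrable_measurable mf.
exact: (measurable_int_kernel mf measurable_cos2).
Qed.

Lemma measurable_sinT f : rintegrable mu f -> measurable_fun setT (sinT f).
Proof.
move=> /rintegrable_measurable mf.
exact: (measurable_int_kernel mf measurable_sin2).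
Qed.

Lemma normr_cosT_le f x : rintegrable mu f -> `|cosT f x| <= \int[mu]_u `|f u|.
Proof.
move=> fi; apply: normr_int_kernel_le => //; last by move=> ?; exact: normr_cos_le1.
by apply: continuous_measurable_fun; ctns.
Qed.

Lemma normr_sinT_le f x : rintegrable mu f -> `|sinT f x| <= \int[mu]_u `|f u|.
Proof.
move=> fi; apply: normr_int_kernel_le => //; last by move=> ?; exact: normr_sin_le1.
by apply: continuous_measurable_fun; ctns.
Qed.

Lemma cvg_Rintegral_poisson_conv f g M : rintegrable mu f -> rintegrable mu g ->
  continuous g -> (forall x, `|g x| <= M) ->
  \int[mu]_u (f u * poisson_conv n.+1%:R^-1 g u) @[n --> \oo] -->
  2 * pi * \int[mu]_u (f u * g u).
Proof.
move=> fi gi cg gM.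
have mg : measurable_fun setT g by exact: continuous_measurable_fun.
have fgi : rintegrable mu (fun u => f u * g u) by exact: (rintegrableM fi mg gM).
rewrite -RintegralZl//.
apply: (@Rdominated_cvg _ _ _ mu (fun n u => f u * poisson_conv n.+1%:R^-1 g u)
  (fun u => 2 * pi * (f u * g u)) (fun u => 2 * pi * M * `|f u|) _ _ _ _ _).2.
- move=> n; apply: measurable_funM; first exact: rintegrable_measurable fi.
  apply: (@measurable_int_kernel g (fun z => poisson n.+1%:R^-1 (z.1 - z.2))) => //.
  apply: measurableT_comp; last exact: measurable_funB.
  by apply: continuous_measurable_fun; exact: continuous_poisson.
- exact: rintegrable_measurable (rintegrableZ _ fgi).
- by apply: aeW => u; rewrite mulrCA; apply: cvgM; [exact: cvg_cst|exact: (cvg_poisson_conv cg gM)].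
- by apply: rintegrableZ; exact: rintegrable_norm.
- move=> n u; rewrite normrM mulrC ler_wpM2r//.
  by apply: normr_poisson_conv_le.
Qed.

(* Plancherel's identity for the complex-valued function f + i g. *)
Lemma Plancherel f g M : rintegrable mu f -> rintegrable mu g ->
  continuous f -> continuous g ->
  (forall x, `|f x| <= M) -> (forall x, `|g x| <= M) ->
  (\int[mu]_x ((cosT f x - sinT g x) ^+ 2 + (sinT f x + cosT g x) ^+ 2)%:E)%E =
  (2 * pi * \int[mu]_u (f u ^+ 2 + g u ^+ 2))%:E.
Proof.
move=> fi gi cf cg fM gM.
pose T x := (cosT f x - sinT g x) ^+ 2 + (sinT f x + cosT g x) ^+ 2.
have mT : measurable_fun setT T.
  apply: measurable_funD; apply: measurable_funX.
    apply: measurable_funB; [exact: measurable_cosT|exact: measurable_sinT].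
  apply: measurable_funD; [exact: measurable_sinT|exact: measurable_cosT].
have T0 x : 0 <= T x by rewrite addr_ge0 ?sqr_ge0.
have sq h : rintegrable mu h -> continuous h -> (forall x, `|h x| <= M) ->
    rintegrable mu (fun u => h u ^+ 2).
  move=> hi ch hM; apply: (rintegrableM hi _ hM); exact: continuous_measurable_fun.
have key e : 0 < e -> rintegrable mu (fun x => E e x * T x) /\
    \int[mu]_x (E e x * T x) = \int[mu]_u (f u * poisson_conv e f u) +
      \int[mu]_u (g u * poisson_conv e g u).
  move=> e0; have Ei := rintegrable_expRNabs e0.
  have EE (p q : R -> R) P Q : measurable_fun setT p -> measurable_fun setT q ->
      (forall x, `|p x| <= P) -> (forall x, `|q x| <= Q) ->
      rintegrable mu (fun x => E e x * (p x * q x)).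
    move=> mp mq pP qQ; apply: (@rintegrableM _ _ _ _ _ _ (P * Q) Ei).
      exact: measurable_funM.
    by move=> x; rewrite normrM ler_pM.
  have [mcf mcg] := (measurable_cosT fi, measurable_cosT gi).
  have [msf msg] := (measurable_sinT fi, measurable_sinT gi).
  have [bcf bcg] := ((fun x => normr_cosT_le x fi), (fun x => normr_cosT_le x gi)).
  have [bsf bsg] := ((fun x => normr_sinT_le x fi), (fun x => normr_sinT_le x gi)).
  have i1 := EE _ _ _ _ mcf mcf bcf bcf; have i2 := EE _ _ _ _ msf msf bsf bsf.
  have i3 := EE _ _ _ _ mcg mcg bcg bcg; have i4 := EE _ _ _ _ msg msg bsg bsg.
  have i5 := EE _ _ _ _ msf mcg bsf bcg; have i6 := EE _ _ _ _ msg mcf bsg bcf.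
  have TE : (fun x => E e x * T x) = fun x =>
      ((E e x * (cosT f x * cosT f x) + E e x * (sinT f x * sinT f x)) +
       (E e x * (cosT g x * cosT g x) + E e x * (sinT g x * sinT g x))) +
      (2 * (E e x * (sinT f x * cosT g x)) - 2 * (E e x * (sinT g x * cosT f x))).
    by apply/funext => x; rewrite /T; ring.
  have j1 := rintegrableD i1 i2; have j2 := rintegrableD i3 i4.
  have j3 := rintegrableD j1 j2.
  have j4 := rintegrableB (rintegrableZ 2 i5) (rintegrableZ 2 i6).
  rewrite TE; split; first exact: rintegrableD.
  rewrite RintegralD// (RintegralD _ j1 j2)// (RintegralD _ i1 i2)// (RintegralD _ i3 i4)//.
  rewrite RintegralB//; [|exact: rintegrableZ..].
  rewrite !RintegralZl// !Rintegral_sinT_cosT// !Rintegral_cosT2_sinT2//.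
  by rewrite mulr0 subr0 addr0.
pose G (n : nat) x := E n.+1%:R^-1 x * T x.
have Gcvg : (\int[mu]_x (G n x)%:E)%E @[n --> \oo] -->
    (2 * pi * \int[mu]_u (f u ^+ 2 + g u ^+ 2))%:E.
  have -> : (fun n => \int[mu]_x (G n x)%:E)%E = fun n =>
      (\int[mu]_u (f u * poisson_conv n.+1%:R^-1 f u) +
       \int[mu]_u (g u * poisson_conv n.+1%:R^-1 g u))%:E.
    apply/funext => n; have [] := key n.+1%:R^-1 => // Gi <-.
    by rewrite EFin_Rintegral.
  apply: cvg_EFin; first exact: nearW.
  rewrite RintegralD//; [|exact: sq..]; rewrite mulrDr.
  by apply: cvgD; exact: cvg_Rintegral_poisson_conv.
have Tlim x : G n x @[n --> \oo] --> T x.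
  rewrite -[X in _ --> X]mul1r; apply: cvgMl.
  have h : - (n.+1%:R^-1 * `|x|) @[n --> \oo] --> - (0 * `|x|).
    by apply: cvgN; apply: cvgMl; exact: cvg_harmonic.
  have := cvg_comp _ _ h (@continuous_expR R _).
  by rewrite mul0r oppr0 expR0.
have mG n : measurable_fun setT (G n).
  by have [] := key n.+1%:R^-1 => // /rintegrable_measurable.
(* Integrability of [T] is not known beforehand, hence monotone rather than dominated convergence:
   the damping factors increase to 1 and [T] is nonnegative. *)
have Tcvg : (\int[mu]_x (G n x)%:E)%E @[n --> \oo] --> (\int[mu]_x (T x)%:E)%E.
  have -> : (\int[mu]_x (T x)%:E = \int[mu]_x limn (fun n => (G n x)%:E))%E.
    apply: eq_integral => x _; apply/esym/cvg_lim => //.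
    by apply: cvg_EFin; [exact: nearW|exact: Tlim].
  apply: (@cvg_monotone_convergence _ (measurableTypeR R) R _ setT measurableT
    (fun n x => (G n x)%:E)).
  - by move=> n; apply/measurable_EFinP; exact: mG.
  - by move=> n x _; rewrite lee_fin mulr_ge0 ?expR_ge0.
  - move=> x _ n m nm; rewrite lee_fin ler_wpM2r// ler_expR lerN2 ler_wpM2r//.
    by rewrite lef_pV2 ?posrE// ler_nat ltnS.
by apply: (cvg_unique _ Tcvg Gcvg).
Qed.

End Fourier.

(** * Injectivity of the Fourier transform on integrable functions *)

Section Fourier_injectivity.
Variable R : realType.
Local Notation mu := (@lebesgue_measure R).
Implicit Types (f g h : R -> R).

(* Equals min(1, max(0, t)); this form makes continuity immediate. *)
Definition clamp (t : R) : R := 2^-1 * (`|t| - `|t - 1| + 1).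

Lemma clamp_le0 (t : R) : t <= 0 -> clamp t = 0.
Proof. by move=> t0; rewrite /clamp !ler0_norm; lra. Qed.

Lemma clamp_ge1 (t : R) : 1 <= t -> clamp t = 1.
Proof. by move=> t1; rewrite /clamp !ger0_norm; lra. Qed.

Lemma clamp_itv (t : R) : 0 <= clamp t <= 1.
Proof.
have [t0|t0] := lerP t 0; first by rewrite clamp_le0// lexx ler01.
have [t1|t1] := lerP 1 t; first by rewrite clamp_ge1// lexx ler01.
rewrite /clamp gtr0_norm// ltr0_norm; lra.
Qed.

(** By Lebesgue differentiation, [h] is almost everywhere the derivative of its indefinite integral,
    which is identically 0. The base points [- N] exhaust the line. *)
Lemma ae_eq0_of_Rintegral_itv h : rintegrable mu h ->
  (forall a b, \int[mu]_(x in `]a, b[) h x = 0) -> {ae mu, forall x, h x = 0}.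
Proof.
move=> hi h0.
have hiS (D : set R) : measurable D -> mu.-integrable D (EFin \o h).
  by move=> mD; apply: integrableS hi.
have loch : locally_integrable setT h by rewrite -[h](patch_setT (fun=> 0)); exact: integrable_locally.
have ae N : {ae mu, forall x, - N%:R < x -> h x = 0}.
  have := @FTC1 R h (BRight (- N%:R)) (fun y => hiS _ (measurable_itv _)) loch.
  apply: filterS; first exact: (ae_filter_ringOfSetsType mu).
  move=> x hx Nx; have [] := hx; first exact: Nx.
  move=> _ <-.
  have -> : (fun y => \int[mu]_(t in [set` Interval (BRight (- N%:R)) (BRight y)]) h t)
      = fun=> 0.
    apply/funext => y; rewrite -[RHS](h0 (- N%:R) y) Rintegral_itv_bndo_bndc//.
    exact: hiS.
  by rewrite derive1_cst.
have F : Filter (almost_everywhere mu) by exact: ae_filter_ringOfSetsType.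
have := ae_foralln ae => H; apply: (filterS _ H).

move=> x hx.
have [n _ /(_ n (leqnn _))] := near_itv_symmetric x.
rewrite /= in_itv/= => /andP[nx _]; apply: (hx n.+1).
by rewrite (lt_le_trans _ nx)// ltrN2 ltr_nat.
Qed.

(** By the regularised Parseval identity, [h] is orthogonal to [poisson_conv e g] for every [e],
    hence in the limit to every bounded, continuous and integrable [g]. Such functions approximate
    the indicator of an interval. *)
Lemma ae_eq0_of_Fourier h : rintegrable mu h -> (forall x, cosT h x = 0) ->
  (forall x, sinT h x = 0) -> {ae mu, forall x, h x = 0}.
Proof.
move=> hi c0 s0.
have ortho g M : rintegrable mu g -> continuous g -> (forall x, `|g x| <= M) ->
    \int[mu]_x (h x * g x) = 0.
  move=> gi cg gM.
  have H := cvg_Rintegral_poisson_conv hi gi cg gM.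
  have Z (n : nat) : \int[mu]_u (h u * poisson_conv n.+1%:R^-1 g u) = 0.
    rewrite -Rintegral_cosT2_sinT2// -[RHS]addr0; congr (_ + _);
      rewrite -[RHS](Rintegral0 mu); apply: eq_Rintegral => x _.
      by rewrite c0 mul0r mulr0.
    by rewrite s0 mul0r mulr0.
  move: H; under eq_fun do rewrite Z; move=> H.
  have E : 2 * pi * \int[mu]_u (h u * g u) = 0.
    by apply: (@cvg_unique _ (@Rhausdorff R) _ _ _ _ H); exact: cvg_cst.
  move/eqP: E; rewrite !mulf_eq0 pnatr_eq0/= gt_eqF ?pi_gt0//= => /eqP; exact.
apply: ae_eq0_of_Rintegral_itv => // a b.
have [ba|ab] := leP b a.
  by rewrite set_itv_ge ?Rintegral_set0// bnd_simp -leNgt.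
(* The product [(x - a) * (b - x)] is positive exactly on []a, b[], so [g n] vanishes outside the
   interval and is eventually equal to 1 at each point inside. *)
pose g (n : nat) x := clamp (n%:R * ((x - a) * (b - x))).
have cg n : continuous (g n).
  by rewrite /g /clamp; ctns.
have mg n : measurable_fun setT (g n) by exact: continuous_measurable_fun.
have g1 n x : `|g n x| <= 1.
  by have /andP[g0 gl1] := clamp_itv (n%:R * ((x - a) * (b - x))); rewrite ger0_norm.
have g0 n x : x \notin `]a, b[ -> g n x = 0.
  rewrite in_itv/= negb_and -!leNgt => xab; rewrite /g clamp_le0// mulr_ge0_le0//.
  case/orP: xab => [xa|bx]; first by rewrite mulr_le0_ge0; lra.
  by rewrite mulr_ge0_le0; lra.
have mI : measurable_fun setT (\1_(`]a, b[%classic) : R -> R) by exact: measurable_indic.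
have gi n : rintegrable mu (g n).
  have gI x : `|g n x| <= \1_(`]a, b[%classic) x.
    rewrite indicE mem_setE; have [xab|xab] := boolP (x \in `]a, b[); first exact: g1.
    by rewrite g0// normr0.
  apply: (@rintegrable_le _ (measurableTypeR R) R _ _ (\1_(`]a, b[%classic))); [exact: mg|exact: gI|].
  apply: (@rintegrable_ge0P _ (measurableTypeR R) R _ (\1_(`]a, b[%classic))) => //.
  rewrite integral_indic// setIT; have := @lebesgue_measure_itv R `]a, b[.
  by rewrite /= lte_fin ab => ->; rewrite -EFinD ltry.
have mh := rintegrable_measurable hi.
have H : \int[mu]_x (h x * g n x) @[n --> \oo] --> \int[mu]_x (h x * \1_(`]a, b[%classic) x).
  apply: (@Rdominated_cvg _ _ _ mu (fun n x => h x * g n x)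
    (fun x => h x * \1_(`]a, b[%classic) x) (fun x => `|h x|) _ _ _ _ _).2.
  - by move=> n; apply: measurable_funM; [exact: mh|exact: mg].
  - by apply: measurable_funM; [exact: mh|exact: mI].
  - apply: aeW => x; apply: cvgM; first exact: cvg_cst.
    apply: cvg_near_cst; near=> n; rewrite indicE mem_setE.
    have [xab|xab] := boolP (x \in `]a, b[); last exact: g0.
    apply: clamp_ge1; move: xab; rewrite in_itv/= => /andP[ax xb].
    have p : 0 < (x - a) * (b - x) by rewrite mulr_gt0 ?subr_gt0.
    rewrite -ler_pdivrMr// mul1r; near: n; exact: nbhs_infty_ger.
  - exact: rintegrable_norm.
  - by move=> n x; rewrite normrM ler_piMr.
move: H; under eq_fun => n do rewrite (ortho _ _ (gi n) (cg n) (g1 n)).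
move=> H.
have E : \int[mu]_x (h x * \1_(`]a, b[%classic) x) = 0.
  by apply: (@cvg_unique _ (@Rhausdorff R) _ _ _ _ H); exact: cvg_cst.
rewrite Rintegral_mkcond -[RHS]E; apply: eq_Rintegral => x _.
by rewrite patchE indicE; case: ifP; rewrite ?mulr1 ?mulr0.
Unshelve. all: by end_near. Qed.

End Fourier_injectivity.

(** * Moments of |Gamma(a + i x)| ^ 2 *)

Section logarithmic_substitution.
Variable R : realType.
Local Notation mu := (@lebesgue_measure R).
Implicit Types (G : R -> R).

Let derive1_lnE (y : R) : 0 < y -> (@ln R)^`()%classic y = y^-1.
Proof. by move=> y0; rewrite derive1E; case: (is_derive1_ln y0). Qed.

Let ge0_integral_ln_itv G (a : R) : 0 < a -> continuous G -> (forall v, 0 <= G v) ->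
  (\int[mu]_(v in `[ln a, +oo[) (G v)%:E =
   \int[mu]_(y in `[a, +oo[) (G (ln y) * expR (- ln y))%:E)%E.
Proof.
move=> a0 cG G0.
have inv_cts (y : R) : 0 < y -> (@ln R)^`()%classic z @[z --> y] --> y^-1.
  move=> y0; apply: cvg_trans; last by apply: (@inv_continuous _ y); rewrite gt_eqF.
  apply: near_eq_cvg; near=> z; rewrite derive1_lnE//.
  by near: z; exact: lt_nbhsr.
rewrite (@increasing_ge0_integration_by_substitutiony _ (@ln R) G a).
- by apply: eq_integral => y; rewrite inE/= in_itv/= andbT => ay;
    rewrite fctE/= derive1_lnE ?expRN ?lnK ?posrE ?(lt_le_trans a0).
- move=> x y; rewrite !in_itv/= !andbT => ax ay xy.
  by rewrite ltr_ln// posrE (lt_le_trans a0).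
- move=> y; rewrite in_itv/= andbT => ay.
  rewrite /continuous_at derive1_lnE ?(lt_trans a0)//.
  exact: inv_cts (lt_trans a0 ay).
- apply/cvg_ex; exists a^-1; apply: cvg_at_right_filter; exact: inv_cts.
- apply/cvg_ex; exists 0.
  have h : y^-1 @[y --> +oo] --> (0 : R) 
    by apply/gtr0_cvgV0; [near=> y; near: y; exact: nbhs_pinfty_gt|exact: cvg_id].
  apply: cvg_trans h; apply: near_eq_cvg; near=> z; rewrite derive1_lnE//.
- split => [y|].
    rewrite in_itv/= andbT => ay.
    by case: (is_derive1_ln (lt_trans a0 ay)).
  by apply: cvg_at_right_filter; exact: continuous_ln.
- apply/cvgryPge => A; near=> y.
  have h : expR A <= y by near: y; apply: nbhs_pinfty_ge; exact: num_real.
  by rewrite -ler_expR lnK// posrE (lt_le_trans (expR_gt0 A)).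
- exact: continuous_subspaceT.
- by move=> x _.
Unshelve. all: by end_near. Qed.

(** The substitution is made on [[a, +oo[] with [a > 0], away from the singularity of [ln]; the
    endpoints [e^(- i)] then exhaust the half-line by monotone convergence. *)
Lemma ge0_integral_ln G : continuous G -> (forall v, 0 <= G v) ->
  (\int[mu]_v (G v)%:E = \int[mu]_(y in `]0%R, +oo[) (G (ln y) * expR (- ln y))%:E)%E.
Proof.
move=> cG G0.
have mln : measurable_fun setT (@ln R) by exact: measurable_ln.
have mG : measurable_fun setT G by exact: continuous_measurable_fun.
have mF : measurable_fun setT (fun y => (G (ln y) * expR (- ln y))%:E).
  apply/measurable_EFinP; apply: measurable_funM; first exact: (measurableT_comp mG mln).
  apply: (measurableT_comp (@measurable_expR R)); exact: measurableT_comp.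
have F0 (y : R) : (0 <= (G (ln y) * expR (- ln y))%:E)%E.
  by rewrite lee_fin mulr_ge0 ?expR_ge0.
have E1 : \bigcup_i `[- i%:R, +oo[%classic = [set: R].
  apply/seteqP; split => // x _.
  have [n _ /(_ n (leqnn _))] := near_itv_symmetric x.
  by rewrite /= in_itv/= => /andP[nx _]; exists n => //=; rewrite in_itv/= nx.
have E2 : \bigcup_i `[expR (- i%:R), +oo[%classic = (`]0, +oo[%classic : set R).
  apply/seteqP; split => x.
    by move=> [n _] /=; rewrite !in_itv/= !andbT; apply: lt_le_trans; exact: expR_gt0.
  rewrite /= in_itv/= andbT => x0.
  have [n _ /(_ n (leqnn _))] := near_itv_symmetric (ln x).
  rewrite /= in_itv/= => /andP[nx _]; exists n => //=; rewrite in_itv/= andbT.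
  by rewrite -ler_ln ?posrE ?expR_gt0// expRK.
have nd (b : nat -> R) : {homo b : n m / (n <= m)%N >-> m <= n} ->
    {homo (fun i => `[b i, +oo[%classic) : n m / (n <= m)%N >-> (n <= m)%O}.
  move=> bnd n m nm; apply/subsetPset => x /=; rewrite !in_itv/= !andbT.
  exact/le_trans/bnd.
have H1 : (\int[mu]_(v in `[(- i%:R)%R, +oo[) (G v)%:E)%E @[i --> \oo] -->
    (\int[mu]_v (G v)%:E)%E.
  rewrite -[in X in _ --> X]E1; apply: (@ge0_nondecreasing_set_cvg_integral _ (measurableTypeR R) R
    (fun i => `[- i%:R, +oo[%classic : set R) (fun x => (G x)%:E)) => //.
  - by apply: nd => n m nm; rewrite lerN2 ler_nat.
  - by move=> i; apply/measurable_EFinP; exact: measurable_funTS.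
  - by move=> i x _; rewrite lee_fin.
have H2 : (\int[mu]_(y in `[expR (- i%:R)%R, +oo[) (G (ln y) * expR (- ln y))%:E)%E
    @[i --> \oo] --> (\int[mu]_(y in `]0%R, +oo[) (G (ln y) * expR (- ln y))%:E)%E.
  rewrite -E2; apply: (@ge0_nondecreasing_set_cvg_integral _ (measurableTypeR R) R
    (fun i => `[expR (- i%:R), +oo[%classic : set R)
    (fun y => (G (ln y) * expR (- ln y))%:E)) => //.
  - by apply: nd => n m nm; rewrite ler_expR lerN2 ler_nat.
  - by move=> i; exact: measurable_funTS.
have H12 (i : nat) : (\int[mu]_(v in `[(- i%:R)%R, +oo[) (G v)%:E =
    \int[mu]_(y in `[expR (- i%:R)%R, +oo[) (G (ln y) * expR (- ln y))%:E)%E.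
  by rewrite -ge0_integral_ln_itv ?expR_gt0// expRK.
by move: H1; under eq_fun do rewrite H12; move=> H1; apply: (cvg_unique _ H1 H2).
Qed.

(** The signed case follows by writing [G] as the difference of the nonnegative continuous functions
    [G + |G|] and [|G|]. *)
Lemma Rintegral_ln G : continuous G -> rintegrable mu G ->
  \int[mu]_v (G v) = \int[mu]_(y in `]0, +oo[) (G (ln y) * expR (- ln y)).
Proof.
move=> cG Gi.
have cN : continuous (fun v => `|G v|) by ctns.
have cP : continuous (fun v => G v + `|G v|) by ctns.
have P0 v : 0 <= G v + `|G v| by have := ler_norm (- G v); rewrite normrN; lra.
have intln (F : R -> R) : measurable_fun setT F -> (forall v, 0 <= F v) -> rintegrable mu F ->
    (\int[mu]_v (F v)%:E = \int[mu]_(y in `]0%R, +oo[) (F (ln y) * expR (- ln y))%:E)%E ->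
    mu.-integrable `]0, +oo[ (EFin \o (fun y => F (ln y) * expR (- ln y))).
  move=> mF F0 Fi FE; apply/integrableP; split.
    apply/measurable_EFinP; apply: measurable_funTS; apply: measurable_funM.
      exact: (measurableT_comp mF (@measurable_ln R)).
    apply: (measurableT_comp (@measurable_expR R)).
    exact: (measurableT_comp _ (@measurable_ln R)).
  under eq_integral do rewrite /= ger0_norm ?mulr_ge0 ?expR_ge0//.
  by rewrite -FE -EFin_Rintegral// ltry.
have Ni := rintegrable_norm Gi; have Pi := rintegrableD Gi Ni.
have mN := continuous_measurable_fun cN; have mP := continuous_measurable_fun cP.
have NE := ge0_integral_ln cN (fun=> normr_ge0 _).
have PE := ge0_integral_ln cP P0.
have Nli := intln _ mN (fun=> normr_ge0 _) Ni NE.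
have Pli := intln _ mP P0 Pi PE.
have -> : \int[mu]_v G v = \int[mu]_v (G v + `|G v|) - \int[mu]_v `|G v|.
  by rewrite -RintegralB//; apply: eq_Rintegral => v _; rewrite addrK.
rewrite /Rintegral PE NE -/(Rintegral _ _ _) -/(Rintegral _ _ _) -RintegralB//.
by apply: eq_Rintegral => y _; ring.
Qed.

End logarithmic_substitution.

Lemma is_derive_Rintegral (R : realType) d (T : measurableType d)
    (m : {measure set T -> \bar R}) (f df : R -> T -> R) (G : T -> R) (a lo hi : R) :
  lo < a < hi ->
  (forall t, lo < t < hi -> rintegrable m (f t)) ->
  (forall (t : R) y, lo < t < hi -> is_derive t 1 (f^~ y) (df t y)) ->
  (forall t y, lo < t < hi -> `|df t y| <= G y) -> rintegrable m G ->
  is_derive a 1 (fun t => \int[m]_y f t y) (\int[m]_y df a y).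
Proof.
move=> Ia fi fdf dfG Gi.
have IaE : `]lo, hi[%classic a by rewrite /= in_itv.
have p1 t y : `]lo, hi[%classic t -> partial1of2 f t y = df t y.
  rewrite /= in_itv/= => It; rewrite partial1of2E.
  by have [_ ->] := fdf t y It.
have h1 t : `]lo, hi[%classic t -> m.-integrable setT (EFin \o f t).
  by rewrite /= in_itv/=; exact: fi.
have h2 (t : R) y : `]lo, hi[%classic t -> setT y -> derivable (f^~ y) t 1.
  by rewrite /= in_itv/= => /fdf - /(_ y)[].
have G0 y : 0 <= `|G y| by [].
have h3 t y : `]lo, hi[%classic t -> setT y -> `|partial1of2 f t y| <= `|G y|.
  move=> It _; rewrite p1//; move: It; rewrite /= in_itv/= => It.
  by rewrite (le_trans (dfG _ y It))// ler_norm.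
have Gi' := rintegrable_norm Gi.
split; first exact: (derivable_under_integral measurableT IaE h1 h2 G0 Gi' h3).
rewrite -derive1E (differentiation_under_integral measurableT IaE h1 h2 G0 Gi' h3).
by apply: eq_Rintegral => y _; exact: p1.
Qed.

(** * Euler's integral along a rotated ray *)

Section Gamma_kernel.
Variable R : realType.
Local Notation mu := (@lebesgue_measure R).
Implicit Types (a c s x u th : R).

(* After y = e^u, Euler's integrand y ^ a * e ^ (- c y) dy / y. *)
Definition gamma_ker a c u : R := expR (a * u - c * expR u).

Lemma continuous_gamma_ker a c : continuous (gamma_ker a c).
Proof. by rewrite /gamma_ker; ctns. Qed.

Lemma gamma_ker_ge0 a c u : 0 <= gamma_ker a c u.
Proof. exact: expR_ge0. Qed.

Lemma gamma_kerS a c u : gamma_ker (a + 1) c u = expR u * gamma_ker a c u.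
Proof. by rewrite /gamma_ker -expRD; congr expR; ring. Qed.

Lemma gamma_ker_le a c : 0 < a -> 0 < c -> exists b M,
  0 < b /\ forall u, gamma_ker a c u <= M * expR (- (b * `|u|)).
Proof.
(* At [m] the convex function [c e^u] has slope [a + 1]. Its tangent there leaves decay [e^(- u)]
   for [u >= 0]; for [u < 0] the factor [e^(a u)] suffices. Hence the rate [min a 1]. *)
move=> a0 c0; pose m := ln ((a + 1) / c).
have tangent u : (a + 1) * (1 + (u - m)) <= c * expR u.
  have -> : expR u = (a + 1) / c * expR (u - m).
    by rewrite -[X in X * _](@lnK _ ((a + 1) / c)) ?posrE ?divr_gt0 ?addr_gt0// -expRD subrKC.
  rewrite mulrA (mulrC c) divfK ?gt_eqF// ler_wpM2l ?expR_ge1Dx//.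
  by rewrite addr_ge0// ltW.
exists (Order.min a 1), (expR `|(a + 1) * (m - 1)|); split.
  by rewrite lt_min a0 ltr01.
move=> u; rewrite /gamma_ker -expRD ler_expR.
have K := ler_norm ((a + 1) * (m - 1)).
have t := tangent u; have eu := expR_ge0 u.
have ceu : 0 <= c * expR u by rewrite mulr_ge0// ltW.
have [u0|u0] := lerP 0 u.
  rewrite (ger0_norm u0).
  have : Order.min a 1 * u <= 1 * u by rewrite ler_wpM2r// ge_min lexx orbT.
  move=> h; lra.
rewrite (ltr0_norm u0) mulrN opprK.
have : a * u <= Order.min a 1 * u by rewrite ler_wnM2r ?(ltW u0)// ge_min lexx.
have := normr_ge0 ((a + 1) * (m - 1)).
move=> h1 h2; lra.
Qed.

Lemma gamma_ker_bounded a c : 0 < a -> 0 < c -> exists M, forall u, gamma_ker a c u <= M.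
Proof.
move=> a0 c0; have [b [M [b0 gM]]] := gamma_ker_le a0 c0; exists `|M| => u.
apply: (le_trans (gM u)); apply: (@le_trans _ _ (`|M| * expR (- (b * `|u|)))).
  by rewrite ler_wpM2r ?expR_ge0// ler_norm.
by rewrite ler_piMr// -expR0 ler_expR oppr_le0 mulr_ge0// ltW.
Qed.

Lemma rintegrable_gamma_ker a c : 0 < a -> 0 < c -> rintegrable mu (gamma_ker a c).
Proof.
move=> a0 c0; have [b [M [b0 gM]]] := gamma_ker_le a0 c0.
apply: (@rintegrable_le _ (measurableTypeR R) R mu _ (fun u => M * expR (- (b * `|u|)))).
- by apply: continuous_measurable_fun; exact: continuous_gamma_ker.
- by move=> u; rewrite ger0_norm ?gamma_ker_ge0.
- by apply: rintegrableZ; exact: rintegrable_expRNabs.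
Qed.

Lemma cvg_gamma_ker a c (h : R -> R) (sg : R) : 0 < a -> 0 < c -> `|sg| = 1 ->
  (forall u, `|h u| <= 1) ->
  gamma_ker a c (sg * n%:R) * h (sg * n%:R) @[n --> \oo] --> 0.
Proof.
move=> a0 c0 sg1 h1; have [b [M [b0 gM]]] := gamma_ker_le a0 c0.
have H : expR (- (b * n%:R)) * M @[n --> \oo] --> 0.
  exact: (cvg_expRN_nat b0 (fun=> lexx `|M|)).
apply: norm_cvg0; apply: (squeeze_cvgr _ (cvg_cst 0) H).
apply: nearW => n; rewrite normr_ge0 normrM ger0_norm ?gamma_ker_ge0//=.
rewrite -[leRHS]mulr1 ler_pM ?gamma_ker_ge0// (le_trans (gM _))//.
by rewrite normrM sg1 mul1r normr_nat mulrC.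
Qed.

Section rotation.
Variables (a x : R).
Hypothesis a0 : 0 < a.

Let w th u := x * u - sin th * expR u.
(** Real and imaginary parts of the integral of [exp ((a + i x) u - e^(i th) e^u)]. At [th = 0] this
    is [Gamma(a + i x)]. *)
Definition rot_cos th := \int[mu]_u (gamma_ker a (cos th) u * cos (x * u - sin th * expR u)).
Definition rot_sin th := \int[mu]_u (gamma_ker a (cos th) u * sin (x * u - sin th * expR u)).

Let cw th : continuous (w th).
Proof. by rewrite /w; ctns. Qed.

Let mcw th : measurable_fun setT (fun u => cos (w th u)).
Proof. by apply: continuous_measurable_fun; apply: continuous_fun_cos. Qed.

Let msw th : measurable_fun setT (fun u => sin (w th u)).
Proof. by apply: continuous_measurable_fun; apply: continuous_fun_sin. Qed.

Let icos b th : 0 < b -> 0 < cos th ->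
  rintegrable mu (fun u => gamma_ker b (cos th) u * cos (w th u)).
Proof.
move=> b0 c0; apply: (rintegrableM (rintegrable_gamma_ker b0 c0) _ (fun=> normr_cos_le1 _)).
exact: mcw.
Qed.

Let isin b th : 0 < b -> 0 < cos th ->
  rintegrable mu (fun u => gamma_ker b (cos th) u * sin (w th u)).
Proof.
move=> b0 c0; apply: (rintegrableM (rintegrable_gamma_ker b0 c0) _ (fun=> normr_sin_le1 _)).
exact: msw.
Qed.

(** Derivatives of the two integrands with respect to [th]. The factor [e^u] produced by
    differentiation is absorbed by raising [a] to [a + 1]. *)
Let dcos th u := gamma_ker (a + 1) (cos th) u * (sin th * cos (w th u) + cos th * sin (w th u)).
Let dsin th u := gamma_ker (a + 1) (cos th) u * (sin th * sin (w th u) - cos th * cos (w th u)).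

Let a1 : 0 < a + 1. Proof. by rewrite addr_gt0. Qed.

(* The integral of the u-derivative of gamma_ker * sin w, resp. gamma_ker * cos w,
   vanishes. *)
Let int_dcos th : 0 < cos th ->
  \int[mu]_u dcos th u = x * rot_cos th + a * rot_sin th.
Proof.
move=> c0.
pose F u := gamma_ker a (cos th) u * sin (w th u).
pose f u := (a * (gamma_ker a (cos th) u * sin (w th u)) +
             x * (gamma_ker a (cos th) u * cos (w th u))) - dcos th u.
have dF (u : R) : is_derive u 1 F (f u).
  rewrite /F /f /dcos gamma_kerS /gamma_ker /w.
  by apply: is_derive_eq; rewrite /GRing.scale/=; ring.
have i1 : rintegrable mu (fun u => a * (gamma_ker a (cos th) u * sin (w th u))).
  by apply: rintegrableZ; exact: isin.
have i2 : rintegrable mu (fun u => x * (gamma_ker a (cos th) u * cos (w th u))).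
  by apply: rintegrableZ; exact: icos.
have i12 := rintegrableD i1 i2.
have i3 : rintegrable mu (dcos th).
  have -> : dcos th = fun u => sin th * (gamma_ker (a + 1) (cos th) u * cos (w th u)) +
      cos th * (gamma_ker (a + 1) (cos th) u * sin (w th u)).
    by apply/funext => u; rewrite /dcos; ring.
  by apply: rintegrableD; apply: rintegrableZ; [exact: icos|exact: isin].
have cf : continuous f.
  by rewrite /f /dcos /gamma_ker /w; ctns.
have E : \int[mu]_u f u = 0 - 0.
  apply: (Rintegral_derivative cf dF).
  - exact: rintegrableB.
  - have := @cvg_gamma_ker a (cos th) (fun u => sin (w th u)) 1 a0 c0 (normr1 _) (fun=> normr_sin_le1 _).
    by under eq_fun do rewrite !mul1r.
  - have := @cvg_gamma_ker a (cos th) (fun u => sin (w th u)) (-1) a0 c0 (normrN1 _) (fun=> normr_sin_le1 _).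
    by under eq_fun do rewrite !mulN1r.
move: E; rewrite RintegralB// RintegralD// !RintegralZl//; [|exact: icos|exact: isin].
rewrite /rot_cos /rot_sin; lra.
Qed.

Let int_dsin th : 0 < cos th ->
  \int[mu]_u dsin th u = x * rot_sin th - a * rot_cos th.
Proof.
move=> c0.
pose F u := gamma_ker a (cos th) u * cos (w th u).
pose f u := (a * (gamma_ker a (cos th) u * cos (w th u)) -
             x * (gamma_ker a (cos th) u * sin (w th u))) + dsin th u.
have dF (u : R) : is_derive u 1 F (f u).
  rewrite /F /f /dsin gamma_kerS /gamma_ker /w.
  by apply: is_derive_eq; rewrite /GRing.scale/=; ring.
have i1 : rintegrable mu (fun u => a * (gamma_ker a (cos th) u * cos (w th u))).
  by apply: rintegrableZ; exact: icos.
have i2 : rintegrable mu (fun u => x * (gamma_ker a (cos th) u * sin (w th u))).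
  by apply: rintegrableZ; exact: isin.
have i12 := rintegrableB i1 i2.
have i3 : rintegrable mu (dsin th).
  have -> : dsin th = fun u => sin th * (gamma_ker (a + 1) (cos th) u * sin (w th u)) -
      cos th * (gamma_ker (a + 1) (cos th) u * cos (w th u)).
    by apply/funext => u; rewrite /dsin; ring.
  by apply: rintegrableB; apply: rintegrableZ; [exact: isin|exact: icos].
have cf : continuous f.
  by rewrite /f /dsin /gamma_ker /w; ctns.
have E : \int[mu]_u f u = 0 - 0.
  apply: (Rintegral_derivative cf dF).
  - exact: rintegrableD.
  - have := @cvg_gamma_ker a (cos th) (fun u => cos (w th u)) 1 a0 c0 (normr1 _) (fun=> normr_cos_le1 _).
    by under eq_fun do rewrite !mul1r.
  - have := @cvg_gamma_ker a (cos th) (fun u => cos (w th u)) (-1) a0 c0 (normrN1 _) (fun=> normr_cos_le1 _).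
    by under eq_fun do rewrite !mulN1r.
move: E; rewrite RintegralD// RintegralB// !RintegralZl//; [|exact: isin|exact: icos].
rewrite /rot_cos /rot_sin; lra.
Qed.

(** Near [th] the cosine stays above a positive constant [cos b], so [gamma_ker] with parameter
    [cos b] dominates when differentiating under the integral. *)
Let near_half_pi th : `|th| < pi / 2 ->
  exists2 b, `|th| < b & 0 < cos b /\ forall t, - b < t < b -> cos b <= cos t.
Proof.
move=> thpi; have p0 := pi_gt0 R; have t0 := normr_ge0 th.
exists ((pi / 2 + `|th|) / 2); first lra.
split; first by apply: cos_gt0_pihalf; lra.
move=> t; rewrite -ltr_norml => tb; rewrite -(cos_norm t).
have t1 := normr_ge0 t.
by rewrite leNgt ltr_cos ?in_itv/= -?leNgt ?(ltW tb)//; lra.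
Qed.

Let gamma_ker_mono b c c' u : c' <= c -> gamma_ker b c u <= gamma_ker b c' u.
Proof. by move=> cc; rewrite ler_expR lerB// ler_wpM2r ?expR_ge0. Qed.

(** Integration by parts in [u] expresses the integral of the [th]-derivative through [rot_cos] and
    [rot_sin] again. The resulting system says that [rot_cos + i rot_sin] has logarithmic derivative
    [x - i a]. *)
Lemma is_derive_rot_cos th : `|th| < pi / 2 ->
  is_derive th 1 rot_cos (x * rot_cos th + a * rot_sin th).
Proof.
move=> thpi; have [b thb [cb0 cb]] := near_half_pi thpi.
have Ith : - b < th < b by rewrite -ltr_norml.
rewrite -int_dcos ?(lt_le_trans cb0)// ?cb//.
apply: (@is_derive_Rintegral R _ _ mu
  (fun th u => gamma_ker a (cos th) u * cos (x * u - sin th * expR u)) dcos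
  (fun u => 2 * gamma_ker (a + 1) (cos b) u) th (- b) b) => //.
- by move=> t It; apply: icos => //; exact: lt_le_trans cb0 (cb _ It).
- move=> t y It; rewrite /dcos gamma_kerS /gamma_ker /w.
  by apply: is_derive_eq; rewrite /GRing.scale/=; ring.
- move=> t y It; rewrite /dcos normrM mulrC ler_pM//.
    rewrite (le_trans (ler_normD _ _))// !normrM (_ : 2 = 1 * 1 + 1 * 1); last by ring.
    by rewrite lerD// ler_pM// ?normr_cos_le1 ?normr_sin_le1.
  by rewrite ger0_norm ?gamma_ker_ge0// gamma_ker_mono// cb.
- by apply: rintegrableZ; exact: rintegrable_gamma_ker.
Qed.

Lemma is_derive_rot_sin th : `|th| < pi / 2 ->
  is_derive th 1 rot_sin (x * rot_sin th - a * rot_cos th).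
Proof.
move=> thpi; have [b thb [cb0 cb]] := near_half_pi thpi.
have Ith : - b < th < b by rewrite -ltr_norml.
rewrite -int_dsin ?(lt_le_trans cb0)// ?cb//.
apply: (@is_derive_Rintegral R _ _ mu
  (fun th u => gamma_ker a (cos th) u * sin (x * u - sin th * expR u)) dsin
  (fun u => 2 * gamma_ker (a + 1) (cos b) u) th (- b) b) => //.
- by move=> t It; apply: isin => //; exact: lt_le_trans cb0 (cb _ It).
- move=> t y It; rewrite /dsin gamma_kerS /gamma_ker /w.
  by apply: is_derive_eq; rewrite /GRing.scale/=; ring.
- move=> t y It; rewrite /dsin normrM mulrC ler_pM//.
    rewrite (le_trans (ler_normB _ _))// !normrM (_ : 2 = 1 * 1 + 1 * 1); last by ring.
    by rewrite lerD// ler_pM// ?normr_cos_le1 ?normr_sin_le1.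
  by rewrite ger0_norm ?gamma_ker_ge0// gamma_ker_mono// cb.
- by apply: rintegrableZ; exact: rintegrable_gamma_ker.
Qed.

(* rot_cos + i rot_sin is e ^ ((x - i a) th) Gamma(a + i x), by the differential
   equation in th. *)
Lemma rot_modulus th : `|th| < pi / 2 ->
  rot_cos th ^+ 2 + rot_sin th ^+ 2 = expR (2 * th * x) * (rot_cos 0 ^+ 2 + rot_sin 0 ^+ 2).
Proof.
move=> thpi.
(* In the derivative of the squared modulus the terms with [a] cancel, being those of a rotation,
   and the remaining factor [2 x] is compensated by the exponential. So [N] is constant. *)
pose N t := expR (- (2 * t * x)) * (rot_cos t ^+ 2 + rot_sin t ^+ 2).
have dN (t : R) : `|t| < pi / 2 -> is_derive t 1 N 0.
  move=> tpi; have dc := is_derive_rot_cos tpi; have ds := is_derive_rot_sin tpi.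
  by apply: is_derive_eq; rewrite /GRing.scale/=; ring.
have cN (t : R) : `|t| < pi / 2 -> {for t, continuous N}.
  move=> tpi; apply: differentiable_continuous; apply/derivable1_diffP.
  by case: (dN t tpi).
have Ncst p q : `|p| < pi / 2 -> `|q| < pi / 2 -> p < q -> N p = N q.
  rewrite !ltr_norml => /andP[p1 p2] /andP[q1 q2] pq.
  have [||c _] := @MVT _ N (fun=> 0) p q pq.
  - by move=> t; rewrite in_itv/= => /andP[t1 t2]; apply: dN; rewrite ltr_norml; lra.
  - apply: continuous_in_subspaceT => t; rewrite inE/= in_itv/= => /andP[t1 t2].
    by apply: cN; rewrite ltr_norml; lra.
  - by rewrite mul0r => /eqP; rewrite subr_eq0 => /eqP.
have pi0 : `|0 : R| < pi / 2 by rewrite normr0 divr_gt0 ?pi_gt0.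
have NE : N th = N 0.
  by have [t0|t0|->] := ltgtP th 0; [exact: Ncst|rewrite (Ncst 0 th)|].
move: NE; rewrite /N mulr0 mul0r oppr0 expR0 mul1r => <-.
by rewrite mulrA -expRD subrr expR0 mul1r.
Qed.

End rotation.
End Gamma_kernel.

Section Gamma_weight.
Variable R : realType.
Local Notation mu := (@lebesgue_measure R).
Implicit Types (a b c x th : R).

Lemma sqr_normc (z : R[i]) : normc z ^+ 2 = Rec z ^+ 2 + Imc z ^+ 2.
Proof. by case: z => p q /=; rewrite sqr_sqrtr// addr_ge0 ?sqr_ge0. Qed.

Let gamma_ker_ln a y : 0 < y ->
  gamma_ker a 1 (ln y) * expR (- ln y) = expR ((a - 1) * ln y - y).
Proof. by move=> y0; rewrite /gamma_ker -expRD lnK ?posrE//; congr expR; ring. Qed.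

Lemma Re_cGamma a x : 0 < a -> Rec (cGamma (a +i* x)) = rot_cos a x 0.
Proof.
move=> a0; rewrite /rot_cos cos0 sin0.
have i : rintegrable mu (fun u => gamma_ker a 1 u * cos (x * u - 0 * expR u)).
  apply: (rintegrableM (rintegrable_gamma_ker a0 ltr01) _ (fun=> normr_cos_le1 _)).
  by apply: continuous_measurable_fun; ctns.
rewrite (Rintegral_ln _ i); last by rewrite /gamma_ker; ctns.
rewrite /cGamma /cintegral /=; apply: eq_Rintegral => y; rewrite inE/= in_itv/= andbT => y0.
transitivity (expR ((a - 1) * ln y - y) * cos (x * ln y)).
  by congr (expR _ * cos _); ring.
by rewrite -gamma_ker_ln// mul0r subr0 mulrAC.
Qed.

Lemma Im_cGamma a x : 0 < a -> Imc (cGamma (a +i* x)) = rot_sin a x 0.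
Proof.
move=> a0; rewrite /rot_sin cos0 sin0.
have i : rintegrable mu (fun u => gamma_ker a 1 u * sin (x * u - 0 * expR u)).
  apply: (rintegrableM (rintegrable_gamma_ker a0 ltr01) _ (fun=> normr_sin_le1 _)).
  by apply: continuous_measurable_fun; ctns.
rewrite (Rintegral_ln _ i); last by rewrite /gamma_ker; ctns.
rewrite /cGamma /cintegral /=; apply: eq_Rintegral => y; rewrite inE/= in_itv/= andbT => y0.
transitivity (expR ((a - 1) * ln y - y) * sin (x * ln y)).
  by congr (expR _ * sin _); ring.
by rewrite -gamma_ker_ln// mul0r subr0 mulrAC.
Qed.

Lemma cGamma_realE b : 0 < b -> Rec (cGamma b%:C) = \int[mu]_u gamma_ker b 1 u.
Proof.
move=> b0; rewrite (Re_cGamma 0 b0) /rot_cos; apply: eq_Rintegral => u _.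
by rewrite cos0 sin0 !mul0r subr0 cos0 mulr1.
Qed.

Lemma cGamma_real_gt0 b : 0 < b -> 0 < Rec (cGamma b%:C).
Proof.
move=> b0; rewrite cGamma_realE//.
have gi := rintegrable_gamma_ker b0 ltr01.
(* On [[0, 1]] the exponent [b u - e^u] is at least [- e], and this interval has length 1. *)
apply: (@lt_le_trans _ _ (expR (- expR 1))); first exact: expR_gt0.
have mg : measurable_fun setT (gamma_ker b 1).
  by apply: continuous_measurable_fun; exact: continuous_gamma_ker.
have m01 : mu `[0, 1] = 1%E.
  by have := @lebesgue_measure_itv R `[0, 1]; rewrite /= lte_fin ltr01 oppr0 adde0.
rewrite -lee_fin EFin_Rintegral//.
apply: (@le_trans _ _ (\int[mu]_(u in `[0%R, 1%R]) (gamma_ker b 1 u)%:E)%E); last first.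
  apply: ge0_subset_integral => //; first exact/measurable_EFinP.
  by move=> u _; rewrite lee_fin gamma_ker_ge0.
rewrite -[leLHS]mule1 -m01 -integral_cst//.
apply: ge0_le_integral => //.
- by move=> u _; rewrite lee_fin expR_ge0.
- by apply/measurable_EFinP; exact: measurable_funTS.
- move=> u /=; rewrite in_itv/= => /andP[u0 u1]; rewrite lee_fin ler_expR mul1r.
  have : expR u <= expR 1 by rewrite ler_expR.
  have : 0 <= b * u by rewrite mulr_ge0// ltW.
  by move=> h1 h2; lra.
Qed.

Lemma integral_gamma_ker_scale b c : 0 < b -> 0 < c ->
  \int[mu]_u gamma_ker b c u = expR (- (b * ln c)) * Rec (cGamma b%:C).
Proof.
move=> b0 c0; rewrite cGamma_realE//.
rewrite -RintegralZl//; last exact: rintegrable_gamma_ker.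
rewrite /Rintegral (@integral_affine _ _ (- ln c) 1)//.
- congr fine; apply: eq_integral => u _; congr EFin.
  rewrite mulr1 mul1r /gamma_ker -expRD expRD expRN lnK ?posrE//; congr expR.
  by field; rewrite gt_eqF.
- exact: continuous_gamma_ker.
- by move=> u; exact: gamma_ker_ge0.
Qed.

Lemma integral_cGamma_sqr a th : 0 < a -> `|th| < pi / 2 ->
  (\int[mu]_x (expR (2 * th * x) * normc (cGamma (a +i* x)) ^+ 2)%:E =
   (2 * pi * (expR (- (2 * a * ln (2 * cos th))) * Rec (cGamma (2 * a)%:C)))%:E)%E.
Proof.
move=> a0 thpi.
have c0 : 0 < cos th by apply: cos_gt0_pihalf; rewrite -ltr_norml.
have [M gM] := gamma_ker_bounded a0 c0.
(* [f + i g] is [exp (a u - e^(i th) e^u)]. Its transform at [x] is [rot_cos + i rot_sin], and its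
   squared modulus is again a [gamma_ker], with [2 a] and [2 cos th]. *)
pose f u := gamma_ker a (cos th) u * cos (sin th * expR u).
pose g u := - (gamma_ker a (cos th) u * sin (sin th * expR u)).
have cf : continuous f by rewrite /f /gamma_ker; ctns.
have cg : continuous g by rewrite /g /gamma_ker; ctns.
have gi := rintegrable_gamma_ker a0 c0.
have f_le u : `|f u| <= gamma_ker a (cos th) u.
  by rewrite normrM ger0_norm ?gamma_ker_ge0// ler_piMr ?gamma_ker_ge0 ?normr_cos_le1.
have g_le u : `|g u| <= gamma_ker a (cos th) u.
  by rewrite normrN normrM ger0_norm ?gamma_ker_ge0// ler_piMr ?gamma_ker_ge0 ?normr_sin_le1.
have fi : rintegrable mu f.
  by apply: (@rintegrable_le _ (measurableTypeR R) R mu _ (gamma_ker a (cos th))) => //;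
     exact: continuous_measurable_fun.
have gi' : rintegrable mu g.
  by apply: (@rintegrable_le _ (measurableTypeR R) R mu _ (gamma_ker a (cos th))) => //;
     exact: continuous_measurable_fun.
have ck (h k : R -> R) x : rintegrable mu h -> continuous k -> (forall x, `|k x| <= 1) ->
    rintegrable mu (fun u => h u * k (x * u)).
  move=> hi ck k1; apply: (rintegrableM hi _ (fun=> k1 _)).
  by apply: continuous_measurable_fun; apply: continuous_fun_comp => //; ctns.
have := Plancherel fi gi' cf cg (fun u => le_trans (f_le u) (gM u)) (fun u => le_trans (g_le u) (gM u)).
have -> : \int[mu]_u (f u ^+ 2 + g u ^+ 2) = \int[mu]_u gamma_ker (2 * a) (2 * cos th) u.
  apply: eq_Rintegral => u _; rewrite /f /g sqrrN !exprMn -mulrDr cos2Dsin2 mulr1.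
  by rewrite /gamma_ker -expRM_natl; congr expR; ring.
rewrite integral_gamma_ker_scale ?mulr_gt0// => <-.
apply: eq_integral => x _; congr EFin.
have -> : cosT f x - sinT g x = rot_cos a x th.
  rewrite /cosT /sinT -RintegralB//; [|exact: (ck _ _ x fi (@continuous_cos R) (@normr_cos_le1 R))
    |exact: (ck _ _ x gi' (@continuous_sin R) (@normr_sin_le1 R))].
  by apply: eq_Rintegral => u _; rewrite cosB /f /g; ring.
have -> : sinT f x + cosT g x = rot_sin a x th.
  rewrite /cosT /sinT -RintegralD//; [|exact: (ck _ _ x fi (@continuous_sin R) (@normr_sin_le1 R))
    |exact: (ck _ _ x gi' (@continuous_cos R) (@normr_cos_le1 R))].
  by apply: eq_Rintegral => u _; rewrite sinB /f /g; ring.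
by rewrite rot_modulus// sqr_normc Re_cGamma// Im_cGamma.
Qed.

End Gamma_weight.

(** * Exponentially tilted weights and their moments *)

Section Gamma_expectation.
Variables (R : realType) (a : R).
Hypothesis a0 : 0 < a.
Local Notation mu := (@lebesgue_measure R).
Implicit Types (c x th psi : R) (p q : {poly R}).

Definition Gamma_sqr x : R := normc (cGamma (a +i* x)) ^+ 2.

Lemma Gamma_sqr_ge0 x : 0 <= Gamma_sqr x.
Proof. by rewrite /Gamma_sqr sqr_normc addr_ge0 ?sqr_ge0. Qed.

Lemma measurable_Gamma_sqr : measurable_fun setT Gamma_sqr.
Proof.
have a20 : 0 < 2 * a by rewrite mulr_gt0.
(* At [phi = pi / 2] the exponential factor of [MP_weight] is 1, so measurability of the Gamma
   factor is inherited from the weight. *)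
pose K := (2 * sin (pi / 2)) `^ (2 * a) / (2 * pi * Rec (cGamma (2 * a)%:C)) : R.
have K0 : 0 < K.
  by rewrite divr_gt0 ?powR_gt0 ?mulr_gt0 ?pi_gt0 ?cGamma_real_gt0// sin_pihalf.
have -> : Gamma_sqr = fun x => K^-1 * MP_weight a (pi / 2) x.
  apply/funext => x; rewrite /MP_weight -/K -/(Gamma_sqr x).
  have -> : (2 * (pi / 2) - pi) * x = 0 by field.
  by rewrite expR0 mulr1 mulKf// gt_eqF.
by apply: measurable_funM => //; exact: measurable_MP_weight.
Qed.

Definition tilt th x : R := expR (2 * th * x) * Gamma_sqr x.

Lemma tilt_ge0 th x : 0 <= tilt th x.
Proof. by rewrite mulr_ge0 ?expR_ge0 ?Gamma_sqr_ge0. Qed.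

Lemma measurable_tilt th : measurable_fun setT (tilt th).
Proof.
apply: measurable_funM; last exact: measurable_Gamma_sqr.
by apply: continuous_measurable_fun; ctns.
Qed.

Definition tilt_mass th : R :=
  2 * pi * (expR (- (2 * a * ln (2 * cos th))) * Rec (cGamma (2 * a)%:C)).

Lemma integral_tilt th : `|th| < pi / 2 -> (\int[mu]_x (tilt th x)%:E = (tilt_mass th)%:E)%E.
Proof. exact: integral_cGamma_sqr. Qed.

Lemma rintegrable_tilt th : `|th| < pi / 2 -> rintegrable mu (tilt th).
Proof.
move=> thpi; apply: (@rintegrable_ge0P _ (measurableTypeR R) R mu).
- exact: measurable_tilt.
- exact: tilt_ge0.
- by have := integral_tilt thpi => /= ->; rewrite ltry.
Qed.

Lemma Rintegral_tilt th : `|th| < pi / 2 -> \int[mu]_x tilt th x = tilt_mass th.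
Proof. by move=> thpi; rewrite /Rintegral integral_tilt. Qed.

Lemma normX_le_expR (d x : R) n : 0 < d -> `|x| ^+ n <= n`!%:R / d ^+ n * expR (d * `|x|).
Proof.
move=> d0; have dx : 0 <= d * `|x| by rewrite mulr_ge0// ltW.
have h : (d * `|x|) ^+ n / n`!%:R <= expR (d * `|x|).
  case: n => [|n]; last by apply: le_trans (expR_ge1Dxn n dx); lra.
  by rewrite expr0 fact0 divr1 -expR0 ler_expR.
have -> : `|x| ^+ n = n`!%:R / d ^+ n * ((d * `|x|) ^+ n / n`!%:R).
  have f0 : n`!%:R != 0 :> R by rewrite pnatr_eq0 -lt0n fact_gt0.
  have dn0 : d ^+ n != 0 by rewrite expf_neq0 ?gt_eqF.
  by rewrite exprMn; field; rewrite ?f0 ?dn0.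
by rewrite ler_wpM2l// divr_ge0// exprn_ge0// ltW.
Qed.

Lemma expR_norm_le (t : R) : expR `|t| <= expR t + expR (- t).
Proof.
have [t0|t0] := lerP 0 t; first by rewrite ger0_norm// lerDl expR_ge0.
by rewrite ltr0_norm// lerDr expR_ge0.
Qed.

(** [e^(2 d |x|)] is at most [e^(2 d x) + e^(- 2 d x)], which only changes the tilt to [th + d] and
    [th - d]; both are still admissible. *)
Lemma rintegrable_expR_norm_tilt th (d : R) : `|th| + d < pi / 2 -> 0 <= d ->
  rintegrable mu (fun x => expR (2 * d * `|x|) * tilt th x).
Proof.
move=> thd d0.
apply: (@rintegrable_le _ (measurableTypeR R) R mu _ (fun x => tilt (th + d) x + tilt (th - d) x)).
- apply: measurable_funM; last exact: measurable_tilt.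
  by apply: continuous_measurable_fun; ctns.
- move=> x; rewrite (ger0_norm (mulr_ge0 (expR_ge0 _) (tilt_ge0 _ _))).
  rewrite (_ : 2 * d * `|x| = `|2 * d * x|); last first.
    by rewrite normrM (ger0_norm (mulr_ge0 (ler0n R 2) d0)).
  apply: (le_trans (ler_wpM2r (tilt_ge0 _ _) (expR_norm_le _))).
  rewrite /tilt le_eqVlt; apply/orP; left; apply/eqP.
  have -> : 2 * (th + d) * x = 2 * d * x + 2 * th * x by ring.
  have -> : 2 * (th - d) * x = - (2 * d * x) + 2 * th * x by ring.
  by rewrite !expRD; ring.
- have th0 := normr_ge0 th.
  have i1 : rintegrable mu (tilt (th + d)).
    by apply: rintegrable_tilt; apply: le_lt_trans (ler_normD _ _) _; rewrite (ger0_norm d0).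
  have i2 : rintegrable mu (tilt (th - d)).
    by apply: rintegrable_tilt; apply: le_lt_trans (ler_normB _ _) _; rewrite (ger0_norm d0).
  exact: (rintegrableD i1 i2).
Qed.

Lemma rintegrableX_tilt th n : `|th| < pi / 2 ->
  rintegrable mu (fun x => x ^+ n * tilt th x).
Proof.
move=> thpi; pose d := (pi / 2 - `|th|) / 2.
have d0 : 0 < d by rewrite divr_gt0// subr_gt0.
have d20 : 0 < 2 * d by rewrite mulr_gt0.
apply: (@rintegrable_le _ (measurableTypeR R) R mu _ 
  (fun x => n`!%:R / (2 * d) ^+ n * (expR (2 * d * `|x|) * tilt th x))).
- apply: measurable_funM; last exact: measurable_tilt.
  by apply: continuous_measurable_fun; ctns.
- move=> x; rewrite normrM (ger0_norm (tilt_ge0 _ _)) [leRHS]mulrA ler_wpM2r ?tilt_ge0//.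
  by rewrite normrX normX_le_expR.
- apply: rintegrableZ; apply: rintegrable_expR_norm_tilt (ltW d0).
  by rewrite /d; lra.
Qed.

Lemma rintegrable_horner_tilt th p : `|th| < pi / 2 ->
  rintegrable mu (fun x => p.[x] * tilt th x).
Proof.
move=> thpi.
have -> : (fun x => p.[x] * tilt th x) =
    fun x => \sum_(i < size p) p`_i * (x ^+ i * tilt th x).
  apply/funext => x; rewrite horner_coef big_distrl/=.
  by apply: eq_bigr => i _; rewrite -mulrA.
by apply: rintegrable_sum => i _; apply: rintegrableZ; exact: rintegrableX_tilt.
Qed.

Lemma measurable_horner p : measurable_fun setT (fun x => p.[x]).
Proof. by apply: continuous_measurable_fun; exact: continuous_horner. Qed.

Definition tilt_exp th p : R := \int[mu]_x (p.[x] * tilt th x).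

Lemma tilt_expD th p q : `|th| < pi / 2 ->
  tilt_exp th (p + q) = tilt_exp th p + tilt_exp th q.
Proof.
move=> thpi; rewrite /tilt_exp -RintegralD//; [|exact: rintegrable_horner_tilt..].
by apply: eq_Rintegral => x _; rewrite hornerD mulrDl.
Qed.

Lemma tilt_expZ th c p : `|th| < pi / 2 -> tilt_exp th (c *: p) = c * tilt_exp th p.
Proof.
move=> thpi; rewrite /tilt_exp -RintegralZl//; last exact: rintegrable_horner_tilt.
by apply: eq_Rintegral => x _; rewrite hornerZ -mulrA.
Qed.

Lemma tilt_expN th p : `|th| < pi / 2 -> tilt_exp th (- p) = - tilt_exp th p.
Proof. by move=> thpi; rewrite -scaleN1r tilt_expZ// mulN1r. Qed.

Lemma tilt_exp1 th : `|th| < pi / 2 -> tilt_exp th 1 = tilt_mass th.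
Proof.
move=> thpi; rewrite -Rintegral_tilt//; apply: eq_Rintegral => x _.
by rewrite -polyC1 hornerC mul1r.
Qed.

Lemma is_derive_tilt_exp th p : `|th| < pi / 2 ->
  is_derive th 1 (tilt_exp^~ p) (2 * tilt_exp th ('X * p)).
Proof.
(* With [b] halfway between [|th|] and [pi / 2], all tilts by [t] in []- b, b[] are dominated by the
   sum of the tilts by [b] and [- b]. *)
move=> thpi; pose b := (pi / 2 + `|th|) / 2.
have t0 := normr_ge0 th.
have thb : `|th| < b by rewrite /b; lra.
have bpi : b < pi / 2 by rewrite /b; lra.
have b0 : 0 <= b by rewrite /b; have := pi_ge0 R; lra.
have nb : `|b| < pi / 2 by rewrite ger0_norm.
have nNb : `|- b| < pi / 2 by rewrite normrN ger0_norm.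
clearbody b.
have pX th' : `|th'| < pi / 2 -> rintegrable mu (fun x => `|2 * x * p.[x]| * tilt th' x).
  move=> th'pi; have := rintegrable_norm (rintegrableZ 2 (rintegrable_horner_tilt ('X * p) th'pi)).
  congr (is_true (integrable _ _ _)); apply/funext => x /=; congr EFin.
  rewrite hornerM hornerX -[in RHS](ger0_norm (tilt_ge0 th' x)) -normrM.
  by congr (`|_|); ring.
rewrite -RintegralZl//; last exact: rintegrable_horner_tilt.
have -> : \int[mu]_x (2 * (('X * p).[x] * tilt th x)) =
    \int[mu]_x (2 * x * p.[x] * tilt th x).
  by apply: eq_Rintegral => x _; rewrite hornerM hornerX; ring.
apply: (@is_derive_Rintegral R _ _ mu (fun t x => p.[x] * tilt t x)
  (fun t x => 2 * x * p.[x] * tilt t x)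
  (fun x => `|2 * x * p.[x]| * tilt b x + `|2 * x * p.[x]| * tilt (- b) x) th (- b) b).
- by rewrite -ltr_norml.
- move=> t; rewrite -ltr_norml => tb; apply: rintegrable_horner_tilt.
  exact: lt_trans tb bpi.
- move=> t y _; rewrite /tilt.
  by apply: is_derive_eq; rewrite /GRing.scale/=; ring.
- move=> t y; rewrite -ltr_norml => tb.
  rewrite normrM (ger0_norm (tilt_ge0 _ _)) -mulrDr ler_wpM2l//.
  rewrite /tilt -mulrDl ler_wpM2r ?Gamma_sqr_ge0//.
  have -> : 2 * - b * y = - (2 * b * y) by ring.
  apply: le_trans (expR_norm_le _); rewrite ler_expR (le_trans (ler_norm _))//.
  by rewrite !normrM ler_wpM2r// ler_wpM2l// (ger0_norm b0) ltW.
- by apply: rintegrableD; exact: pX.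
Qed.

End Gamma_expectation.

(** * Meixner-Pollaczek polynomials *)

Section Meixner_Pollaczek_recurrence.
Variables (R : realType) (a psi : R).
Hypothesis a0 : 0 < a.
Implicit Types (n m : nat) (E : {poly R} -> R).

(** The pair (q_n, q_(n-1)) makes the three-term recurrence structurally recursive. The entry 0 in
    the initial pair is harmless: the first step multiplies it by 0. *)
Fixpoint MPq_pair n : {poly R} * {poly R} :=
  if n is m.+1 then
    let pq := MPq_pair m in
    ((m%:R + 2 * a)^-1 *: ((2 * sin psi) *: ('X * pq.1)
       + (2 * (m%:R + a) * cos psi) *: pq.1 - m%:R *: pq.2), pq.1)
  else (1, 0).

(* Locked, lest unification unfold MPq n.+1 into a scaled polynomial.
   This is the real polynomial e ^ (i n psi) 2F1(- n, a + i x; 2 a; 1 - e ^ (- 2 i psi)). *)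
Definition MPq : nat -> {poly R} := locked (fun n => (MPq_pair n).1).

Lemma addn2a_neq0 n : n%:R + 2 * a != 0.
Proof. by rewrite gt_eqF// ltr_wpDl// mulr_gt0. Qed.

Lemma MPq_rec n : (n%:R + 2 * a) *: MPq n.+1 =
  (2 * sin psi) *: ('X * MPq n) + (2 * (n%:R + a) * cos psi) *: MPq n
  - n%:R *: MPq n.-1.
Proof.
rewrite /MPq -lock /= scalerA divff ?addn2a_neq0// scale1r; congr (_ - _).
by case: n => [|n]//; rewrite !scale0r.
Qed.

Lemma MPq0 : MPq 0 = 1. Proof. by rewrite /MPq -lock. Qed.

Lemma mulX_MPq n : (2 * sin psi) *: ('X * MPq n) =
  (n%:R + 2 * a) *: MPq n.+1 - (2 * (n%:R + a) * cos psi) *: MPq n + n%:R *: MPq n.-1.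
Proof. by rewrite MPq_rec addrAC subrK addrK. Qed.

(** The squared norm of q_n for a functional with total mass 1, see [MPq_orthogonal]. *)
Definition MPq_norm n : R := n`!%:R / pochhammer (2 * a) n.

Lemma pochhammer2a_gt0 n : 0 < pochhammer (2 * a) n.
Proof. by rewrite prodr_gt0// => i _; rewrite ltr_pwDl// mulr_gt0. Qed.

Lemma MPq_norm_rec n : (n%:R + 2 * a) * MPq_norm n.+1 = n.+1%:R * MPq_norm n.
Proof.
rewrite /MPq_norm /pochhammer big_ord_recr/= factS natrM.
have := pochhammer2a_gt0 n; rewrite /pochhammer => /lt0r_neq0 p0.
have := addn2a_neq0 n => q0; rewrite addrC in q0.
by rewrite (addrC n%:R); field; rewrite p0 q0.
Qed.

(** Induction on [m]: the recurrence for the left factor brings in [X q_m q_n], and [mulX_MPq]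
    passes [X] to the right factor, which leaves only known values of [E (MPq m * _)] and
    [E (MPq m.-1 * _)]. The hypothesis on the means is the case [m = 0]. *)
Lemma MPq_orthogonal E :
  {morph E : p q / p + q} -> (forall c p, E (c *: p) = c * E p) ->
  (forall n, E (MPq n) = (n == 0%N)%:R) ->
  forall m n, E (MPq m * MPq n) = (m == n)%:R * MPq_norm n.
Proof.
move=> ED EZ E0.
have EN p : E (- p) = - E p by rewrite -scaleN1r EZ mulN1r.
have sA (c : R) (p q : {poly R}) : p * (c *: q) = c *: (p * q) by rewrite scalerAr.
(* A three-term recurrence needs two preceding indices. The second statement is multiplied by [m],
   so that it is trivial at [m = 0]; later inductions along the recurrence use the same device. *)
suff H m : (forall n, E (MPq m * MPq n) = (m == n)%:R * MPq_norm n) /\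
    (forall n, m%:R * E (MPq m.-1 * MPq n) = m%:R * ((m.-1 == n)%:R * MPq_norm n)).
  by move=> m n; exact: (H m).1.
elim: m => [|m [IH IH1]].
  split=> n; last by rewrite !mul0r.
  rewrite MPq0 mul1r E0; case: n => [|n]; last by rewrite mul0r.
  by rewrite eqxx /MPq_norm /pochhammer big_ord0 fact0 divr1 mul1r.
split=> [n|n]; last by rewrite IH.
apply: (mulfI (addn2a_neq0 m)).
have -> : (m%:R + 2 * a) * E (MPq m.+1 * MPq n) =
    E (MPq m * ((2 * sin psi) *: ('X * MPq n))) + 2 * (m%:R + a) * cos psi * E (MPq m * MPq n)
    - m%:R * E (MPq m.-1 * MPq n).
  rewrite -!EZ -EN -!ED; congr E; rewrite scalerAl MPq_rec mulrBl mulrDl -!scalerAl.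
  by congr (_ + _ - _); rewrite sA mulrCA mulrA.
rewrite mulX_MPq mulrDr mulrBr !ED EN !sA !EZ !IH IH1.
(* For [n = m + 1] the claim is [MPq_norm_rec]; for [n = m] the cosine terms cancel; for [m = n + 1]
   the two outer terms cancel by [MPq_norm_rec]; otherwise every Kronecker delta vanishes. *)
have [nm|nm] := eqVneq n m.+1.
  subst n; rewrite eqxx /= ?eqxx !mul1r (MPq_norm_rec m).
  have -> : (m == m.+2) = false by apply/negbTE; rewrite neq_ltn ltnS leqnSn.
  have -> : (m == m.+1) = false by apply/negbTE; rewrite neq_ltn ltnSn.
  have -> : m%:R * ((m.-1 == m.+1)%:R * MPq_norm m.+1) = 0.
    have -> : (m.-1 == m.+1) = false.
      by case: m {IH IH1} => [|m]//=; apply/negbTE; rewrite neq_ltn ltnS leqnSn.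
    by rewrite mul0r mulr0.
  by rewrite !mul0r !mulr0 subr0 addr0 subr0 add0r.
rewrite mul0r mulr0.
have [mn|mn] := eqVneq m n.
  subst n; have -> : (m == m.+1) = false by apply/negbTE; rewrite neq_ltn ltnSn.
  have -> : m%:R * ((m == m.-1)%:R * MPq_norm m.-1) = 0.
    case: m {IH IH1 nm} => [|m]; first by rewrite mul0r.
    have -> : (m.+1 == m.+1.-1) = false by apply/negbTE; rewrite neq_ltn ltnSn orbT.
    by rewrite mul0r mulr0.
  have -> : m%:R * ((m.-1 == m)%:R * MPq_norm m) = 0.
    case: m {IH IH1 nm} => [|m]; first by rewrite mul0r.
    have -> : (m.+1.-1 == m.+1) = false by apply/negbTE; rewrite neq_ltn ltnSn.
    by rewrite mul0r mulr0.
  by rewrite mul0r mulr0; ring.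
have -> : n%:R * ((m == n.-1)%:R * MPq_norm n.-1) = 0.
  case: n nm mn => [|n] nm mn; first by rewrite mul0r.
  have -> : (m == n.+1.-1) = false by apply/negbTE; apply: contra nm => /eqP ->.
  by rewrite mul0r mulr0.
rewrite !(mul0r, mulr0) subr0 addr0.
have [mn1|mn1] := eqVneq m n.+1.
  by subst m; rewrite /= eqxx !mul1r MPq_norm_rec addr0 subrr.
have -> : m%:R * ((m.-1 == n)%:R * MPq_norm n) = 0.
  case: m {IH IH1 nm} mn mn1 => [|m] mn mn1; first by rewrite mul0r.
  have -> : (m.+1.-1 == n) = false by apply/negbTE; apply: contra mn1 => /eqP /= ->.
  by rewrite mul0r mulr0.
by rewrite !(mul0r, mulr0) subr0 addr0.
Qed.

(** Vanishing on all products [X^m q_n] is proved by induction on [m]: as [sin psi] is nonzero,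
    [X q_n] is a combination of the q_j. No degree argument is required. *)
Lemma vanishing_on_MPq (L : {poly R} -> R) : sin psi != 0 ->
  {morph L : p q / p + q} -> (forall c p, L (c *: p) = c * L p) ->
  (forall n, L (MPq n) = 0) -> forall m, L 'X^m = 0.
Proof.
move=> s0 LD LZ L0.
have LN p : L (- p) = - L p by rewrite -scaleN1r LZ mulN1r.
have sA (c : R) (p q : {poly R}) : p * (c *: q) = c *: (p * q) by rewrite scalerAr.
suff H m n : L ('X^m * MPq n) = 0 by move=> m; have := H m 0%N; rewrite MPq0 mulr1.
elim: m n => [|m IH] n; first by rewrite expr0 mul1r.
have s20 : 2 * sin psi != 0 by rewrite mulf_neq0// pnatr_eq0.
apply: (mulfI s20); rewrite mulr0 -LZ exprSr -mulrA -sA mulX_MPq.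
by rewrite mulrDr mulrBr !sA !LD LN !LZ !IH !mulr0 subr0 addr0.
Qed.

End Meixner_Pollaczek_recurrence.

Section Meixner_Pollaczek_expectation.
Variables (R : realType) (a psi : R).
Hypothesis a0 : 0 < a.

(* By is_derive_tilt_exp, multiplying by X amounts to differentiating in th, so
   the recurrence determines the left side by induction. *)
Lemma tilt_exp_MPq n th : `|th| < pi / 2 ->
  tilt_exp a th (MPq a psi n) = (cos psi + tan th * sin psi) ^+ n * tilt_mass a th.
Proof.
suff H : (forall th, `|th| < pi / 2 -> tilt_exp a th (MPq a psi n) =
    (cos psi + tan th * sin psi) ^+ n * tilt_mass a th) /\
  (forall th, `|th| < pi / 2 -> n%:R * tilt_exp a th (MPq a psi n.-1) =
    n%:R * ((cos psi + tan th * sin psi) ^+ n.-1 * tilt_mass a th)) by exact: H.1.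
elim: n => [|n [IH IH1]].
  by split=> t tpi; rewrite ?mul0r// MPq0 tilt_exp1// expr0 mul1r.
split=> [t tpi|t tpi]; last by rewrite IH.
have c0 : 0 < cos t by apply: cos_gt0_pihalf; rewrite -ltr_norml.
apply: (mulfI (addn2a_neq0 a0 n)); rewrite -tilt_expZ// MPq_rec//.
rewrite tilt_expD// tilt_expN// tilt_expD// !tilt_expZ// IH1// IH//.
(* The mass is a constant times [(2 cos t)^(- 2 a)], so its logarithmic derivative is
   [2 a tan t]. *)
have dM : is_derive t 1 (tilt_mass a) (2 * a * tan t * tilt_mass a t).
  have dln : is_derive t 1 (fun t => ln (2 * cos t)) (- tan t).
    have d2c : is_derive t 1 (fun t => 2 * cos t) (- (2 * sin t)).
      by apply: is_derive_eq; rewrite /GRing.scale/=; ring.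
    have dl : is_derive (2 * cos t) 1 (@ln R) (2 * cos t)^-1.
      by apply: is_derive1_ln; rewrite mulr_gt0.
    have := @is_derive1_comp _ (@ln R) (fun t => 2 * cos t) t _ _ dl d2c.
    congr (is_derive _ _ _ _); rewrite /tan; field; rewrite gt_eqF//.
  by apply: is_derive_eq; rewrite /tilt_mass /GRing.scale/=; ring.
have dR : is_derive t 1 (fun t => (cos psi + tan t * sin psi) ^+ n * tilt_mass a t)
   (n%:R * (cos psi + tan t * sin psi) ^+ n.-1 * (1 + tan t ^+ 2) * sin psi * tilt_mass a t
    + (cos psi + tan t * sin psi) ^+ n * (2 * a * tan t * tilt_mass a t)).
  have dt : is_derive t 1 tan (1 + tan t ^+ 2).
    by rewrite -cos2_tan2 ?gt_eqF//; apply: is_derive_tan; rewrite gt_eqF.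
  pose g (t : R) := cos psi + tan t * sin psi.
  have dg : is_derive t 1 g ((1 + tan t ^+ 2) * sin psi).
    by rewrite /g; apply: is_derive_eq; rewrite /GRing.scale/=; ring.
  have dgn := @is_deriveX _ _ g n t 1 _ dg.
  have gnE : (g ^+ n : R -> R) = fun t => (cos psi + tan t * sin psi) ^+ n.
    by apply/funext => z; rewrite fctE.
  rewrite gnE in dgn.
  by apply: is_derive_eq; rewrite /g /GRing.scale/=; ring.
have dE := is_derive_tilt_exp a0 (MPq a psi n) tpi.
(* The induction hypothesis holds on a neighbourhood of [t] and may be differentiated there.
   Comparison with [is_derive_tilt_exp] evaluates the term of the recurrence that contains [X]. *)
have near_t : \near t, (cos psi + tan t * sin psi) ^+ n * tilt_mass a t = tilt_exp a t (MPq a psi n).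
  have tI : t \in `](- (pi / 2)), (pi / 2)[ by rewrite in_itv/= -ltr_norml.
  near=> z; rewrite IH// ltr_norml.
  have : z \in `](- (pi / 2)), (pi / 2)[ by near: z; exact: near_in_itvoo.
  by rewrite in_itv.
have dE' := near_eq_is_derive near_t dR.
have -> : 2 * sin psi * tilt_exp a t ('X * MPq a psi n) = sin psi * (2 * tilt_exp a t ('X * MPq a psi n)).
  by ring.
have -> : 2 * tilt_exp a t ('X * MPq a psi n) =
   (n%:R * (cos psi + tan t * sin psi) ^+ n.-1 * (1 + tan t ^+ 2) * sin psi * tilt_mass a t
    + (cos psi + tan t * sin psi) ^+ n * (2 * a * tan t * tilt_mass a t)).
  by case: dE => _ <-; case: dE' => _ <-.
move: (cos2Dsin2 psi); set cp := cos psi; set sp := sin psi; set T := tan t; set Z := tilt_mass a t.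
case: n {IH IH1 dE dE' near_t dR} => [|n] /= cs.
  by rewrite !mul0r expr0; ring.
rewrite !exprS; set P := (cp + T * sp) ^+ n.
apply/eqP; rewrite -subr_eq0.
(* The two sides differ by a multiple of [cos^2 + sin^2 - 1]. *)
rewrite [X in X == 0](_ : _ = n.+1%:R * P * Z * (cp ^+ 2 + sp ^+ 2 - 1)); last by ring.
by rewrite cs subrr mulr0.
Unshelve. all: by end_near. Qed.

End Meixner_Pollaczek_expectation.

(** * Uniqueness in the moment problem under exponential decay *)

Section determinate_moments.
Variable R : realType.
Local Notation mu := (@lebesgue_measure R).
Implicit Types (k : R -> R) (d x : R).

Lemma series_exp_coeff_le (y : R) n : 0 <= y -> series (exp_coeff y) n <= expR y.
Proof.
move=> y0; rewrite /expR/=; apply: nondecreasing_cvgn_le; last exact: is_cvg_series_exp_coeff.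
by apply: nondecreasing_series => i _ _; exact: exp_coeff_ge0.
Qed.

(* A power series dominated by the exponential series may be integrated
   termwise against a function with vanishing moments. *)
Lemma Rintegral_power_series_eq0 k d y (c : nat -> R) (F : R -> R) : 0 < d ->
  measurable_fun setT k -> rintegrable mu (fun x => `|k x| * expR (d * `|x|)) ->
  (forall m, \int[mu]_x (k x * x ^+ m) = 0) ->
  `|y| <= d -> measurable_fun setT F ->
  (forall m, `|c m| <= m`!%:R^-1) ->
  (forall x, series (fun m => c m * (y * x) ^+ m) n @[n --> \oo] --> F x) ->
  \int[mu]_x (k x * F x) = 0.
Proof.
move=> d0 mk kd k0 yd mF cE cF; have dge0 := ltW d0.
have ki m : rintegrable mu (fun x => k x * x ^+ m).
  apply: (@rintegrable_le _ (measurableTypeR R) R mu _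
    (fun x => m`!%:R / d ^+ m * (`|k x| * expR (d * `|x|)))).
  - apply: measurable_funM => //; apply: continuous_measurable_fun; ctns.
  - move=> x; rewrite normrM normrX [leRHS]mulrCA ler_wpM2l//.
    exact: normX_le_expR.
  - exact: rintegrableZ.
pose S (n : nat) x := series (fun m => c m * (y * x) ^+ m) n.
have ES n x : k x * S n x = \sum_(0 <= m < n) (c m * y ^+ m) * (k x * x ^+ m).
  rewrite /S /series/= big_distrr/=; apply: eq_bigr => m _.
  by rewrite exprMn; ring.
have Sle n x : `|k x * S n x| <= `|k x| * expR (d * `|x|).
  rewrite normrM ler_wpM2l//.
  apply: (@le_trans _ _ (series (exp_coeff (d * `|x|)) n)); last first.
    by apply: series_exp_coeff_le; rewrite mulr_ge0.
  apply: (le_trans (ler_norm_sum _ _ _)); apply: ler_sum => m _.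
  rewrite exp_coeffE normrM ler_pM// normrX lerXn2r ?nnegrE ?mulr_ge0//.
  by rewrite normrM ler_wpM2r.
have Z n : \int[mu]_x (k x * S n x) = 0.
  under eq_Rintegral do rewrite ES.
  rewrite Rintegral_sum; last by move=> m _; apply: rintegrableZ; exact: ki.
  rewrite big1// => m _; rewrite RintegralZl//.
  by rewrite k0 mulr0.
have H : \int[mu]_x (k x * S n x) @[n --> \oo] --> \int[mu]_x (k x * F x).
  apply: (@Rdominated_cvg _ _ _ mu (fun n x => k x * S n x) (fun x => k x * F x)
    (fun x => `|k x| * expR (d * `|x|)) _ _ _ kd Sle).2.
  - move=> n; apply: measurable_funM; first exact: mk.
    rewrite /S /series/=; apply: measurable_sum => m.
    by apply: measurable_funM => //; apply: measurable_funX; exact: measurable_funM.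
  - by apply: measurable_funM; [exact: mk|exact: mF].
  - by apply: aeW => x; apply: cvgM; [exact: cvg_cst|exact: cF].
move: H; under eq_fun do rewrite Z; move=> H.
by apply: (@cvg_unique _ (@Rhausdorff R) _ _ _ _ H); exact: cvg_cst.
Qed.

Lemma cvg_series_cos (y x : R) :
  series (fun m => ((~~ odd m)%:R * (-1) ^+ m./2 / m`!%:R) * (y * x) ^+ m) n
    @[n --> \oo] --> cos (x * y).
Proof.
have <- := cos_coeffE (y * x); rewrite (mulrC x) cos.unlock.
exact: is_cvg_series_cos_coeff.
Qed.

Lemma cvg_series_sin (y x : R) :
  series (fun m => ((odd m)%:R * (-1) ^+ m.-1./2 / m`!%:R) * (y * x) ^+ m) n
    @[n --> \oo] --> sin (x * y).
Proof.
have <- := sin_coeffE (y * x); rewrite (mulrC x) sin.unlock.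
exact: is_cvg_series_sin_coeff.
Qed.

Let coeff_le (b : bool) m p : `|b%:R * (-1) ^+ p / m`!%:R| <= m`!%:R^-1 :> R.
Proof.
rewrite !normrM normrX normrN1 expr1n mulr1 normr_nat normfV normr_nat.
by rewrite ler_piMl//; case: (b); rewrite ?ler01 ?lexx.
Qed.

Lemma Rintegral_cos_eq0 k d y : 0 < d -> measurable_fun setT k ->
  rintegrable mu (fun x => `|k x| * expR (d * `|x|)) ->
  (forall m, \int[mu]_x (k x * x ^+ m) = 0) -> `|y| <= d ->
  \int[mu]_x (k x * cos (x * y)) = 0 /\ \int[mu]_x (k x * sin (x * y)) = 0.
Proof.
move=> d0 mk kd k0 yd; split.
  apply: (Rintegral_power_series_eq0 d0 mk kd k0 yd _ _ (fun x => @cvg_series_cos y x)).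
    by apply: continuous_measurable_fun; ctns.
  by move=> m; exact: coeff_le.
apply: (Rintegral_power_series_eq0 d0 mk kd k0 yd _ _ (fun x => @cvg_series_sin y x)).
  by apply: continuous_measurable_fun; ctns.
by move=> m; exact: coeff_le.
Qed.

(* Analyticity in the strip: the vanishing of all moments propagates from
   frequency y to the frequencies within d / 2 of y. *)
Lemma ae_eq0_of_moments k d : 0 < d -> measurable_fun setT k ->
  rintegrable mu (fun x => `|k x| * expR (d * `|x|)) ->
  (forall m, \int[mu]_x (k x * x ^+ m) = 0) -> {ae mu, forall x, k x = 0}.
Proof.
move=> d0 mk kd k0.
have d20 : 0 < d / 2 by rewrite divr_gt0.
(* All powers of [x] are included because these integrals are, up to sign and factorials, the Taylor
   coefficients at [y]; they are what a further step starts from. *)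
pose V y := forall m, \int[mu]_x (k x * cos (x * y) * x ^+ m) = 0 /\
                      \int[mu]_x (k x * sin (x * y) * x ^+ m) = 0.
(* Half of the exponential weight absorbs the power [x ^+ m]; the other half remains available at
   every frequency, so the step length [d / 2] never shrinks. *)
have kdm m : rintegrable mu (fun x => `|k x * x ^+ m| * expR (d / 2 * `|x|)).
  apply: (@rintegrable_le _ (measurableTypeR R) R mu _
    (fun x => m`!%:R / (d / 2) ^+ m * (`|k x| * expR (d * `|x|)))).
  - apply: measurable_funM; last by apply: continuous_measurable_fun; ctns.
    apply: measurableT_comp => //; apply: measurable_funM; first exact: mk.
    by apply: continuous_measurable_fun; ctns.
  - move=> x; rewrite ger0_norm ?mulr_ge0 ?expR_ge0// normrM normrX.
    have -> : d * `|x| = d / 2 * `|x| + d / 2 * `|x| by field.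
    rewrite expRD (_ : _ * (_ * _) = `|k x| * (m`!%:R / (d / 2) ^+ m * expR (d / 2 * `|x|)) *
      expR (d / 2 * `|x|)); last by ring.
    by rewrite ler_wpM2r ?expR_ge0// ler_wpM2l// normX_le_expR.
  - exact: rintegrableZ.
have mcs (h : R -> R) y : continuous h -> measurable_fun setT (fun x : R => h (x * y)).
  by move=> ch; apply: continuous_measurable_fun; apply: continuous_fun_comp; ctns.
have mX m : measurable_fun setT (fun x : R => x ^+ m).
  by apply: continuous_measurable_fun; ctns.
have mkh (h : R -> R) y m : continuous h -> measurable_fun setT (fun x => k x * h (x * y) * x ^+ m).
  move=> ch; apply: measurable_funM => //; apply: measurable_funM; [exact: mk|exact: mcs].
have kdh (h : R -> R) y m : continuous h -> (forall x, `|h x| <= 1) ->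
    rintegrable mu (fun x => `|k x * h (x * y) * x ^+ m| * expR (d / 2 * `|x|)).
  move=> ch h1; apply: (@rintegrable_le _ (measurableTypeR R) R mu _ _ _ _ (kdm m)).
  - apply: measurable_funM; last by apply: continuous_measurable_fun; ctns.
    by apply: measurableT_comp => //; exact: mkh.
  - move=> x; rewrite ger0_norm ?mulr_ge0 ?expR_ge0// ler_wpM2r ?expR_ge0//.
    by rewrite !normrM mulrAC ler_piMr ?mulr_ge0.
have khi (h g : R -> R) y z m : continuous h -> (forall x, `|h x| <= 1) ->
    continuous g -> (forall x, `|g x| <= 1) ->
    rintegrable mu (fun x => k x * h (x * y) * x ^+ m * g (x * z)).
  move=> ch h1 cg g1.
  apply: (@rintegrable_le _ (measurableTypeR R) R mu _ _ _ _ (kdh h y m ch h1)).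
  - by apply: measurable_funM; [exact: mkh|exact: mcs].
  - move=> x; rewrite normrM ler_wpM2l// (le_trans (g1 _))//.
    by rewrite (le_trans _ (expR_ge1Dx _))// lerDl mulr_ge0// ltW.
have [cc cs] := (@continuous_cos R, @continuous_sin R).
have [c1 s1] := (@normr_cos_le1 R, @normr_sin_le1 R).
have step y z : V y -> `|z| <= d / 2 -> V (y + z).
  move=> Vy zd m.
  have mom (h : R -> R) : continuous h -> (forall x, `|h x| <= 1) ->
      (forall m, \int[mu]_x (k x * h (x * y) * x ^+ m) = 0) ->
      \int[mu]_x (k x * h (x * y) * x ^+ m * cos (x * z)) = 0 /\
      \int[mu]_x (k x * h (x * y) * x ^+ m * sin (x * z)) = 0.
    move=> ch h1 h0; apply: (Rintegral_cos_eq0 d20 (mkh h y m ch) (kdh h y m ch h1) _ zd) => n.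
    by rewrite -[RHS](h0 (m + n)%N); apply: eq_Rintegral => x _; rewrite exprD mulrA.
  have [C1 C2] := mom _ cc c1 (fun n => (Vy n).1).
  have [S1 S2] := mom _ cs s1 (fun n => (Vy n).2).
  split.
    rewrite -[RHS](subrr 0) -{1}C1 -S2 -RintegralB//; [|exact: khi|exact: khi].
    by apply: eq_Rintegral => x _; rewrite mulrDr cosD; ring.
  rewrite -[RHS](addr0 0) -{1}S1 -C2 -RintegralD//; [|exact: khi|exact: khi].
  by apply: eq_Rintegral => x _; rewrite mulrDr sinD; ring.
have V0 : V 0.
  move=> m; split.
    by rewrite -[RHS](k0 m); apply: eq_Rintegral => x _; rewrite mulr0 cos0 mulr1.
  rewrite -[RHS](Rintegral0 mu); apply: eq_Rintegral => x _.
  by rewrite mulr0 sin0 mulr0 mul0r.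
have Vn z n : `|z| <= d / 2 -> V (n%:R * z).
  move=> zd; elim: n => [|n IH]; first by rewrite mul0r.
  by rewrite -natr1 mulrDl mul1r; exact: step.
(* The frequency [y] is reached in [n.+1] equal steps, with [n] so large that each has length at
   most [d / 2]. *)
have VT y : V y.
  have [n _ /(_ n.+1 (leqnSn _))] := near_itv_symmetric (`|y| / (d / 2)).
  rewrite /= in_itv/= => /andP[_ yn].
  have -> : y = n.+1%:R * (y / n.+1%:R) by rewrite mulrCA divff ?mulr1// pnatr_eq0.
  apply: Vn; rewrite normrM normfV (ger0_norm (ler0n _ _)) ler_pdivrMr ?ltr0n//.
  by rewrite mulrC -ler_pdivrMr.
have ki : rintegrable mu k.
  apply: (@rintegrable_le _ (measurableTypeR R) R mu _ _ mk _ kd) => x.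
  by rewrite ler_peMr// (le_trans _ (expR_ge1Dx _))// lerDl mulr_ge0// ltW.
apply: ae_eq0_of_Fourier => // y.
  rewrite /cosT -[RHS](VT y 0%N).1; apply: eq_Rintegral => x _.
  by rewrite expr0 mulr1 mulrC [y * x]mulrC mulrC.
rewrite /sinT -[RHS](VT y 0%N).2; apply: eq_Rintegral => x _.
by rewrite expr0 mulr1 mulrC [y * x]mulrC mulrC.
Qed.

End determinate_moments.

(** * Hypergeometric form of the Meixner-Pollaczek polynomials *)

Section pochhammer.
Variable K : comPzRingType.
Implicit Types (x : K) (n j : nat).

Lemma pochhammer0 x : pochhammer x 0 = 1.
Proof. by rewrite /pochhammer big_ord0. Qed.

Lemma pochhammerS x j : pochhammer x j.+1 = pochhammer x j * (x + j%:R).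
Proof. by rewrite /pochhammer big_ord_recr. Qed.

Lemma pochhammerSl x j : pochhammer x j.+1 = x * pochhammer (x + 1) j.
Proof.
rewrite /pochhammer big_ord_recl addr0; congr (_ * _); apply: eq_bigr => i _.
by rewrite -addrA nat1r.
Qed.

Lemma pochhammerN_eq0 n j : (n < j)%N -> pochhammer (- n%:R : K) j = 0.
Proof.
move=> nj; rewrite /pochhammer (bigD1 (Ordinal nj))//= addNr mul0r.
by [].
Qed.

End pochhammer.

Section contiguous_relation.
Variable R : realType.
Local Notation C := R[i].
Implicit Types (a c z : C).

Let N0 (n : nat) : n.+1%:R != 0 :> C.
Proof. by rewrite pnatr_eq0. Qed.

Lemma hyp2F1_widen n N a c z : (n < N)%N ->
  hyp2F1_terminating n a c z = \sum_(j < N) pochhammer (- n%:R) j * pochhammer a j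
                  / (pochhammer c j * (j`!)%:R) * z ^+ j.
Proof.
move=> nN; rewrite /hyp2F1_terminating.
rewrite -(subnKC nN) big_split_ord/= [X in _ = _ + X]big1 ?addr0// => j _.
by rewrite pochhammerN_eq0 ?mul0r// ltnS leq_addr.
Qed.

(* The terms of the relation telescope. *)
Lemma hyp2F1_contiguous n a c z : (forall j, c + j%:R != 0) ->
  (n%:R + c) * hyp2F1_terminating n.+1 a c z =
  (2 * n%:R + c - z * (n%:R + a)) * hyp2F1_terminating n a c z
  - n%:R * (1 - z) * hyp2F1_terminating n.-1 a c z.
Proof.
move=> c0; pose P m j : C := pochhammer (- m%:R) j.
have p0 j : pochhammer c j != 0.
  by elim: j => [|j IH]; rewrite ?pochhammer0 ?oner_eq0// pochhammerS mulf_neq0.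
have f0 j : j`!%:R != 0 :> C by rewrite pnatr_eq0 -lt0n fact_gt0.
pose u j := pochhammer a j / (pochhammer c j * (j`!)%:R) * z ^+ j.
have uS j : u j.+1 * ((c + j%:R) * j.+1%:R) = u j * (z * (a + j%:R)).
  rewrite /u !pochhammerS factS natrM exprS; have := p0 j; have := f0 j.
  have := c0 j; have := N0 j.
  move: (j.+1%:R : C) (j`!%:R : C) (c + j%:R) => p q v h1 h2 h3 h4.
  by field; rewrite h1 h2 h3 h4.
(* The three sums are given a common range; the additional terms vanish because [(- m)_j = 0] for
   [j > m]. *)
have FE m : (m < n.+2)%N -> hyp2F1_terminating m a c z = \sum_(j < n.+2) P m j * u j.
  move=> mn; rewrite (hyp2F1_widen _ _ _ mn); apply: eq_bigr => j _.
  by rewrite /P /u; ring.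
rewrite !FE//; last by case: (n) => // m; rewrite ltnS leqW.
apply/eqP; rewrite -subr_eq0 !big_distrr/= -!sumrB; apply/eqP.
(* Closed form of the sum of the first [j] terms. The factor [(c + i) (i + 1)] is the one that [uS]
   trades for [u i]. At [j = n.+2] it contains [(- n)_(n+1) = 0]. *)
pose H j := if j is i.+1 then P n i * (u i.+1 * ((c + i%:R) * i.+1%:R)) else 0.
have Pn m j : P m j.+1 = P m j * (- m%:R + j%:R) by rewrite /P pochhammerS.
have PSn j : P n.+1 j.+1 = - n.+1%:R * P n j.
  rewrite /P pochhammerSl; congr (_ * pochhammer _ j).
  by rewrite -natr1 opprD addrNK.
have PnP m j : m%:R * P m.-1 j = - P m j.+1.
  rewrite /P; case: m => [|m]/=; first by rewrite mul0r pochhammerSl oppr0 mul0r oppr0.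
  by rewrite pochhammerSl (_ : - m.+1%:R + 1 = - m%:R) ?mulNr ?opprK// -natr1; ring.
have tele N : \sum_(j < N) ((n%:R + c) * (P n.+1 j * u j) -
    ((2 * n%:R + c - z * (n%:R + a)) * (P n j * u j) - n%:R * (1 - z) * (P n.-1 j * u j))) = H N.
  elim: N => [|N IH]; first by rewrite big_ord0.
  rewrite big_ord_recr/= IH.
  have -> : n%:R * (1 - z) * (P n.-1 N * u N) = - (1 - z) * u N * P n N.+1.
    by rewrite -[P n N.+1]opprK -PnP; ring.
  rewrite uS Pn.
  case: N {IH} => [|N] /=.
    by rewrite /P !pochhammer0; ring.
  rewrite uS PSn Pn -natr1.
  have := uS N; rewrite -natr1.
  by move=> <-; ring.
rewrite tele /H.
have -> : P n n.+1 = 0 by rewrite /P pochhammerN_eq0.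
by rewrite mul0r.
Qed.

End contiguous_relation.

Section Meixner_Pollaczek_polynomial.
Variables (R : realType) (a phi : R).
Hypothesis a0 : 0 < a.
Local Notation C := R[i].

Let e : C := cos phi +i* sin phi.
Let e' : C := cos phi +i* - sin phi.

Let ee' : e * e' = 1.
Proof.
apply/eqP; rewrite eq_complex /=; apply/andP; split; apply/eqP; last by ring.
by rewrite mulrN opprK -!expr2 cos2Dsin2.
Qed.

Lemma cexp_imaginary (t : R) : cexp (0 +i* t) = cos t +i* sin t.
Proof. by rewrite /cexp /= expR0 !mul1r. Qed.

Let cexpn n : cexp (0 +i* (n%:R * phi)) = e ^+ n.
Proof.
elim: n => [|n IH]; first by rewrite mul0r cexp_imaginary cos0 sin0 expr0.
rewrite exprSr -IH !cexp_imaginary -natr1 mulrDl mul1r cosD sinD /e.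
by apply/eqP; rewrite eq_complex /= eqxx/= addrC.
Qed.

Let cexpN2 : cexp (0 +i* - (2 * phi)) = e' ^+ 2.
Proof.
rewrite cexp_imaginary cosN sinN (_ : 2 * phi = phi + phi); last by ring.
rewrite cosD sinD expr2 /e'.
apply/eqP; rewrite eq_complex /=; apply/andP; split; apply/eqP; ring.
Qed.

Let F x n := hyp2F1_terminating n (a +i* x) (2 * a)%:C (1 - e' ^+ 2).

Let c0 j : (2 * a)%:C + j%:R != 0 :> C.
Proof.
rewrite -(rmorph_nat (real_complex R)) -rmorphD /= eq_complex /= negb_and.
by rewrite gt_eqF// ltr_pwDl// mulr_gt0.
Qed.

(** The contiguous relation multiplied by [e ^+ n.+1]. With [z = 1 - e^(- 2 i phi)] the phases then
    combine into real coefficients, namely those of [MPq_rec]. *)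
Let F_rec x n : (n%:R + 2 * a)%:C * (e ^+ n.+1 * F x n.+1) =
  (2 * sin phi * x + 2 * (n%:R + a) * cos phi)%:C * (e ^+ n * F x n)
  - n%:R%:C * (e ^+ n.-1 * F x n.-1).
Proof.
have := hyp2F1_contiguous n (a +i* x) (1 - e' ^+ 2) c0; rewrite -/(F x n.+1) -/(F x n) -/(F x n.-1).
rewrite subKr.
have nC : n%:R = n%:R%:C :> C by rewrite rmorph_nat.
rewrite rmorphD/= -nC => H.
have -> : (n%:R + (2 * a)%:C) * (e ^+ n.+1 * F x n.+1) =
   e ^+ n.+1 * ((n%:R + (2 * a)%:C) * F x n.+1) by ring.
rewrite H mulrBr; congr (_ - _); last first.
  case: n {H nC} => [|n]; first by rewrite !mul0r mulr0.
  rewrite /= (exprS e n.+1) (exprS e n).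
  have -> : e * (e * e ^+ n) * (n.+1%:R * e' ^+ 2 * F x n) =
    (e * e') ^+ 2 * (n.+1%:R * (e ^+ n * F x n)) by ring.
  by rewrite ee' expr1n mul1r.
(* The two summands on the right are complex conjugates, [e (n + a - i x)] and [e' (n + a + i x)],
   which is why the coefficient is real. *)
have -> : (2 * sin phi * x + 2 * (n%:R + a) * cos phi)%:C =
    e * (n%:R + (2 * a)%:C - (a +i* x)) + e' * (n%:R + (a +i* x)).
  rewrite nC /e /e'; apply/eqP; rewrite eq_complex /=.
  by apply/andP; split; apply/eqP; ring.
rewrite exprSr.
have -> : e ^+ n * e * ((2 * n%:R + (2 * a)%:C - (1 - e' ^+ 2) * (n%:R + (a +i* x))) * F x n) =
  (e * (n%:R + (2 * a)%:C - (a +i* x)) + (e * e') * e' * (n%:R + (a +i* x))) * (e ^+ n * F x n)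
  by ring.
by rewrite ee' mul1r.
Qed.

Lemma MPq_hyp2F1 x n : e ^+ n * F x n = ((MPq a phi n).[x])%:C.
Proof.
suff H : e ^+ n * F x n = ((MPq a phi n).[x])%:C /\
  n%:R%:C * (e ^+ n.-1 * F x n.-1) = n%:R%:C * ((MPq a phi n.-1).[x])%:C by exact: H.1.
elim: n => [|n [IH IH1]].
  split; last by rewrite !mul0r.
  rewrite MPq0 -polyC1 hornerC expr0 mul1r /F /hyp2F1_terminating big_ord1 !pochhammer0.
  by rewrite fact0 expr0 !mulr1 divr1.
split; last by rewrite IH.
have na : (n%:R + 2 * a)%:C != 0 :> C.
  by rewrite rmorphD/= rmorph_nat addrC c0.
apply: (mulfI na); rewrite F_rec IH IH1 -!rmorphM -rmorphB.
congr (real_complex R _).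
by rewrite -[RHS]hornerZ MPq_rec// hornerD hornerN hornerD !hornerZ hornerM hornerX; ring.
Qed.

Lemma MP_polyE n x : MP_poly a phi n x =
  (Num.sqrt (pochhammer (2 * a) n / n`!%:R) * (MPq a phi n).[x])%:C.
Proof.
by rewrite /MP_poly cexpn cexpN2 -/(F x n) rmorphM/= -MPq_hyp2F1; ring.
Qed.

End Meixner_Pollaczek_polynomial.

(** * Square-integrable functions *)

Import HBNNSimple.

Section density.
Context d (T : measurableType d) (R : realType).
Variables (mu nu : {measure set T -> \bar R}) (w : T -> R).
Hypothesis mw : measurable_fun setT w.
Hypothesis w0 : forall x, 0 <= w x.
Hypothesis nuE : forall A, measurable A -> nu A = (\int[mu]_(x in A) (w x)%:E)%E.

Let integral_density_nnsfun (f : {nnsfun T >-> R}) :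
  (\int[nu]_x (f x)%:E = \int[mu]_x (f x * w x)%:E)%E.
Proof.
under [LHS]eq_integral do rewrite fimfunE -fsumEFin//.
rewrite [LHS]ge0_integral_fsum//; last 2 first.
- by move=> r; exact/measurable_EFinP/measurableT_comp.
- by move=> n x _; rewrite EFinM nnfun_muleindic_ge0.
under [RHS]eq_integral.
  move=> x _; rewrite fimfunE EFinM -fsumEFin// ge0_mule_fsuml; last first.
    by move=> r; rewrite EFinM nnfun_muleindic_ge0.
  over.
rewrite [RHS]ge0_integral_fsum//; last 2 first.
- move=> r; apply: emeasurable_funM; last exact/measurable_EFinP.
  exact/measurable_EFinP/measurableT_comp.
- by move=> n x _; rewrite mule_ge0//; [rewrite EFinM nnfun_muleindic_ge0|rewrite lee_fin].
apply: eq_fsbigr => r; rewrite inE => -[t _ tr].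
have r0 : 0 <= r by rewrite -tr.
under [LHS]eq_integral do rewrite EFinM.
under [RHS]eq_integral do rewrite EFinM -muleA.
rewrite [LHS]ge0_integralZl//; last by apply/measurable_EFinP; exact: measurable_indic.
rewrite [RHS]ge0_integralZl//; last 2 first.
  apply: emeasurable_funM; last exact/measurable_EFinP.
  by apply/measurable_EFinP; exact: measurable_indic.
  by move=> x _; rewrite mule_ge0 ?lee_fin.
congr (_ * _)%E; rewrite integral_indic// setIT nuE// [LHS]integral_mkcond.
apply: eq_integral => x _; rewrite patchE indicE; case: ifP => _.
  by rewrite mul1e.
by rewrite mul0e.
Qed.

(** [MP_measure] is given by its values on sets. This passage through simple functions and monotone
    convergence turns integrals against it into weighted Lebesgue integrals. *)
Lemma ge0_integral_density (f : T -> \bar R) : measurable_fun setT f ->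
  (forall x, 0 <= f x)%E ->
  (\int[nu]_x f x = \int[mu]_x (f x * (w x)%:E))%E.
Proof.
move=> mf f0; pose f_ := nnsfun_approx measurableT mf.
transitivity (lim (\int[nu]_x (f_ n x)%:E @[n --> \oo])%E).
  rewrite -monotone_convergence//=.
  - apply: eq_integral => ? /[!inE] xD; apply/esym/cvg_lim => //=.
    exact: cvg_nnsfun_approx.
  - by move=> n; exact/measurable_EFinP/measurable_funTS.
  - by move=> n ? _; rewrite lee_fin.
  - by move=> ? _ ? ? mn; rewrite lee_fin; exact/lefP/nd_nnsfun_approx.
under eq_fun do rewrite integral_density_nnsfun.
rewrite -monotone_convergence//=.
- apply: eq_integral => x _; apply/cvg_lim => //=.
  under eq_fun do rewrite EFinM.
  by apply: cvgeZr => //; exact: cvg_nnsfun_approx.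
- move=> n; apply/measurable_EFinP; apply: measurable_funM => //.
- by move=> n x _; rewrite lee_fin mulr_ge0.
- by move=> x _ m n mn; rewrite lee_fin ler_wpM2r//; exact/lefP/nd_nnsfun_approx.
Qed.

Lemma rintegrable_density (f : T -> R) : measurable_fun setT f ->
  rintegrable nu f <-> rintegrable mu (fun x => f x * w x).
Proof.
move=> mf; have mfw : measurable_fun setT (fun x => f x * w x) by exact: measurable_funM.
have E : (\int[nu]_x `|(f x)%:E| = \int[mu]_x `|(f x * w x)%:E|)%E.
  rewrite ge0_integral_density//; last by apply: measurableT_comp => //; exact/measurable_EFinP.
  by apply: eq_integral => x _; rewrite EFinM abseM (@gee0_abs _ (w x)%:E) ?lee_fin.
by split=> /integrableP[_ fi]; apply/integrableP; split;
  [exact/measurable_EFinP|rewrite -E|exact/measurable_EFinP|rewrite E].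
Qed.

Lemma Rintegral_density (f : T -> R) : measurable_fun setT f -> rintegrable nu f ->
  \int[nu]_x f x = \int[mu]_x (f x * w x).
Proof.
move=> mf fi; have /(rintegrable_density mf) fwi := fi.
have fE : f = fun x => (f x + `|f x|) - `|f x| by apply/funext => x; rewrite addrK.
have fp0 x : 0 <= f x + `|f x| by have := ler_norm (- f x); rewrite normrN; lra.
have mn : measurable_fun setT (fun x => `|f x|) by exact: measurableT_comp.
have mp : measurable_fun setT (fun x => f x + `|f x|) by exact: measurable_funD.
have ni := rintegrable_norm fi; have pi := rintegrableD fi ni.
have /(rintegrable_density mn) nwi := ni; have /(rintegrable_density mp) pwi := pi.
have ge0E (h : T -> R) : measurable_fun setT h -> (forall x, 0 <= h x) ->
    \int[nu]_x h x = \int[mu]_x (h x * w x).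
  move=> mh h0; rewrite /Rintegral ge0_integral_density//; exact/measurable_EFinP.
rewrite fE RintegralB// !ge0E// -RintegralB//.
by apply: eq_Rintegral => x _; ring.
Qed.

(** Where [w] vanishes nothing is known about [f], but that set is null for [nu]; the argument
    compares the integrals of [|f|] and [|f w|]. *)
Lemma ae_eq0_density (f : T -> R) : measurable_fun setT f ->
  {ae mu, forall x, f x * w x = 0} -> {ae nu, forall x, f x = 0}.
Proof.
move=> mf f0.
have mfw : measurable_fun setT (fun x => f x * w x) by exact: measurable_funM.
have : (\int[nu]_x `|(f x)%:E| = 0)%E.
  rewrite ge0_integral_density//; last by apply: measurableT_comp => //; exact/measurable_EFinP.
  transitivity (\int[mu]_x `|(f x * w x)%:E|)%E.
    by apply: eq_integral => x _; rewrite EFinM abseM (@gee0_abs _ (w x)%:E) ?lee_fin.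
  apply/(ae_eq_integral_abs mu measurableT (f := EFin \o (fun x => f x * w x))); first exact/measurable_EFinP.
  by apply: filterS f0 => x /= -> _.
move/(ae_eq_integral_abs nu measurableT (f := EFin \o f)) => /(_ _)H.
have {}H := H (proj2 (measurable_EFinP _ _) mf).
by apply: filterS H => x /(_ I) /= [].
Qed.

End density.

Section L2_inner_product.
Context d (T : measurableType d) (R : realType).
Variable mu : {measure set T -> \bar R}.
Local Notation C := R[i].
Implicit Types (f g h : T -> C) (p q : T -> R) (a : C).

Definition sq_integrable p := measurable_fun setT p /\ rintegrable mu (fun x => p x ^+ 2).

Lemma sq_integrableD p q : sq_integrable p -> sq_integrable q ->
  sq_integrable (fun x => p x + q x).
Proof.
move=> [mp ip] [mq iq]; have m := measurable_funD mp mq; split => //.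
apply: (rintegrable_le (g := fun x => 2 * (p x ^+ 2) + 2 * (q x ^+ 2))).
- exact: measurable_funX.
- move=> x; rewrite ger0_norm ?sqr_ge0// -subr_ge0.
  by rewrite (_ : _ - _ = (p x - q x) ^+ 2) ?sqr_ge0//; ring.
- by apply: rintegrableD; exact: rintegrableZ.
Qed.

Lemma sq_integrableZ (c : R) p : sq_integrable p -> sq_integrable (fun x => c * p x).
Proof.
move=> [mp ip]; split; first exact: measurable_funM.
have -> : (fun x => (c * p x) ^+ 2) = fun x => c ^+ 2 * p x ^+ 2.
  by apply/funext => x; rewrite exprMn.
exact: rintegrableZ.
Qed.

Lemma sq_integrableB p q : sq_integrable p -> sq_integrable q ->
  sq_integrable (fun x => p x - q x).
Proof.
move=> hp hq; have := sq_integrableD hp (sq_integrableZ (-1) hq).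
by congr sq_integrable; apply/funext => x; rewrite mulN1r.
Qed.

Lemma sq_integrableM p q : sq_integrable p -> sq_integrable q ->
  rintegrable mu (fun x => p x * q x).
Proof.
move=> [mp ip] [mq iq].
apply: (rintegrable_le (g := fun x => p x ^+ 2 + q x ^+ 2)).
- exact: measurable_funM.
- move=> x; have h1 := sqr_ge0 (p x - q x); have h2 := sqr_ge0 (p x + q x).
  by rewrite ler_norml; apply/andP; split; nra.
- exact: rintegrableD.
Qed.

Lemma L2P f : L2 mu f <-> sq_integrable (Rec \o f) /\ sq_integrable (Imc \o f).
Proof.
split=> [[[mr mi] fi]|[[mr ir] [mi ii]]].
  have fi' : rintegrable mu (fun x => normc (f x) ^+ 2).
    apply: rintegrable_ge0P => //; last by move=> x; rewrite sqr_normc addr_ge0 ?sqr_ge0.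
    have -> : (fun x => normc (f x) ^+ 2) = fun x => Rec (f x) ^+ 2 + Imc (f x) ^+ 2.
      by apply/funext => x; rewrite sqr_normc.
    by apply: measurable_funD; exact: measurable_funX.
  split; split => //; apply: (rintegrable_le _ _ fi'); try exact: measurable_funX.
    by move=> x /=; rewrite sqr_normc ger0_norm ?sqr_ge0// lerDl sqr_ge0.
  by move=> x /=; rewrite sqr_normc ger0_norm ?sqr_ge0// lerDr sqr_ge0.
split => //; have /integrableP[_] := rintegrableD ir ii.
congr (_ < _)%E; apply: eq_integral => x _ /=.
by rewrite ger0_norm ?addr_ge0 ?sqr_ge0// sqr_normc.
Qed.

Lemma L2_lin a f g : L2 mu f -> L2 mu g -> L2 mu (a *: f + g).
Proof.
move=> /L2P[fr fi] /L2P[gr gi]; apply/L2P; split.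
  have := sq_integrableD (sq_integrableB (sq_integrableZ (Rec a) fr) (sq_integrableZ (Imc a) fi)) gr.
  by congr sq_integrable; apply/funext => x /=; rewrite -[(a *: f + g) x]/(a * f x + g x);
    case: a (f x) (g x) => ? ? [? ?] [? ?].
have := sq_integrableD (sq_integrableD (sq_integrableZ (Rec a) fi) (sq_integrableZ (Imc a) fr)) gi.
by congr sq_integrable; apply/funext => x /=; rewrite -[(a *: f + g) x]/(a * f x + g x);
  case: a (f x) (g x) => ? ? [? ?] [? ?].
Qed.

Lemma L2_0 : L2 mu (0 : T -> C).
Proof.
apply/L2P; split; split; try exact: measurable_cst.
  by rewrite /= expr0n; exact: rintegrable0.
by rewrite /= expr0n; exact: rintegrable0.
Qed.

Lemma L2B f g : L2 mu f -> L2 mu g -> L2 mu (f - g).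
Proof. by move=> hf hg; rewrite addrC -scaleN1r; exact: L2_lin. Qed.

Let Re_inner f g x : Rec (f x * (g x)^*%C) = Rec (f x) * Rec (g x) + Imc (f x) * Imc (g x).
Proof. by case: (f x) (g x) => ? ? [? ?] /=; ring. Qed.

Let Im_inner f g x : Imc (f x * (g x)^*%C) = Imc (f x) * Rec (g x) - Rec (f x) * Imc (g x).
Proof. by case: (f x) (g x) => ? ? [? ?] /=; ring. Qed.

Lemma rintegrable_Re_inner f g : L2 mu f -> L2 mu g ->
  rintegrable mu (fun x => Rec (f x * (g x)^*%C)).
Proof.
move=> /L2P[fr fi] /L2P[gr gi]; rewrite (funext (Re_inner f g)).
by apply: rintegrableD; exact: sq_integrableM.
Qed.

Lemma rintegrable_Im_inner f g : L2 mu f -> L2 mu g ->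
  rintegrable mu (fun x => Imc (f x * (g x)^*%C)).
Proof.
move=> /L2P[fr fi] /L2P[gr gi]; rewrite (funext (Im_inner f g)).
by apply: rintegrableB; exact: sq_integrableM.
Qed.

Lemma L2_inner_linl a f g h : L2 mu f -> L2 mu g -> L2 mu h ->
  L2_inner mu (a *: f + g) h = a * L2_inner mu f h + L2_inner mu g h.
Proof.
move=> hf hg hh; have hl := L2_lin a hf hg.
have [rf mf] := (rintegrable_Re_inner hf hh, rintegrable_Im_inner hf hh).
have [rg mg] := (rintegrable_Re_inner hg hh, rintegrable_Im_inner hg hh).
rewrite /L2_inner /cintegral.
have E x : (a *: f + g) x * (h x)^*%C = a * (f x * (h x)^*%C) + g x * (h x)^*%C.
  by rewrite -[(a *: f + g) x]/(a * f x + g x) mulrDl mulrA.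
have -> : \int[mu]_x (Rec \o (fun x => (a *: f + g) x * (h x)^*%C)) x =
    Rec a * \int[mu]_x Rec (f x * (h x)^*%C) - Imc a * \int[mu]_x Imc (f x * (h x)^*%C)
    + \int[mu]_x Rec (g x * (h x)^*%C).
  rewrite -!RintegralZl// -RintegralB//; [|exact: rintegrableZ..].
  rewrite -RintegralD//; last by apply: rintegrableB; exact: rintegrableZ.
  apply: eq_Rintegral => x _ /=; rewrite E.
  by case: a {hl E} (f x * _) (g x * _) => ? ? [? ?] [? ?].
have -> : \int[mu]_x (Imc \o (fun x => (a *: f + g) x * (h x)^*%C)) x =
    Rec a * \int[mu]_x Imc (f x * (h x)^*%C) + Imc a * \int[mu]_x Rec (f x * (h x)^*%C)
    + \int[mu]_x Imc (g x * (h x)^*%C).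
  rewrite -!RintegralZl// -RintegralD//; [|exact: rintegrableZ..].
  rewrite -RintegralD//; last by apply: rintegrableD; exact: rintegrableZ.
  apply: eq_Rintegral => x _ /=; rewrite E.
  by case: a {hl E} (f x * _) (g x * _) => ? ? [? ?] [? ?].
by case: a {hl E} => ? ?.
Qed.

Lemma L2_inner_conj f g : L2 mu f -> L2 mu g -> L2_inner mu g f = (L2_inner mu f g)^*%C.
Proof.
move=> hf hg; rewrite /L2_inner /cintegral /=; congr (_ +i* _).
  apply: eq_Rintegral => x _ /=; rewrite !Re_inner; ring.
rewrite -mulN1r -RintegralZl//; last exact: rintegrable_Im_inner.
by apply: eq_Rintegral => x _ /=; rewrite !Im_inner; ring.
Qed.

Lemma L2_inner0l g : L2_inner mu 0 g = 0.
Proof.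
rewrite /L2_inner /cintegral; congr (_ +i* _); rewrite -[RHS](Rintegral0 mu);
  by apply: eq_Rintegral => x _ /=; rewrite mul0r.
Qed.

Lemma L2_innerBl f g h : L2 mu f -> L2 mu g -> L2 mu h ->
  L2_inner mu (f - g) h = L2_inner mu f h - L2_inner mu g h.
Proof.
by move=> hf hg hh; rewrite addrC -scaleN1r L2_inner_linl// mulN1r addrC.
Qed.

Lemma L2_innerBr f g h : L2 mu f -> L2 mu g -> L2 mu h ->
  L2_inner mu h (f - g) = L2_inner mu h f - L2_inner mu h g.
Proof.
move=> hf hg hh; rewrite (L2_inner_conj (L2B hf hg) hh) L2_innerBl//.
rewrite (L2_inner_conj hf hh) (L2_inner_conj hg hh).
exact: rmorphB.
Qed.

Definition L2_norm2 f : R := \int[mu]_x (normc (f x) ^+ 2).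

Lemma rintegrable_normc2 f : L2 mu f -> rintegrable mu (fun x => normc (f x) ^+ 2).
Proof.
move=> /L2P[[_ fr] [_ fi]]; have := rintegrableD fr fi.
by congr (is_true (integrable _ _ _)); apply/funext => x /=; rewrite sqr_normc.
Qed.

Lemma L2_norm2_ge0 f : 0 <= L2_norm2 f.
Proof. by apply: Rintegral_ge0 => x _; rewrite sqr_normc addr_ge0 ?sqr_ge0. Qed.

Lemma L2_inner_self f : L2_inner mu f f = (L2_norm2 f)%:C.
Proof.
rewrite /L2_inner /cintegral; congr (_ +i* _).
  by apply: eq_Rintegral => x _ /=; rewrite Re_inner sqr_normc.
rewrite -[RHS](Rintegral0 mu); apply: eq_Rintegral => x _ /=.
by rewrite Im_inner; ring.
Qed.

(* A weighted arithmetic-geometric substitute for the Cauchy-Schwarz inequality. *)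
Lemma L2_inner_le (t : R) f g : 0 < t -> L2 mu f -> L2 mu g ->
  `|Rec (L2_inner mu f g)| <= t * L2_norm2 f + t^-1 * L2_norm2 g /\
  `|Imc (L2_inner mu f g)| <= t * L2_norm2 f + t^-1 * L2_norm2 g.
Proof.
move=> t0 hf hg.
have bi : rintegrable mu (fun x => t * normc (f x) ^+ 2 + t^-1 * normc (g x) ^+ 2).
  by apply: rintegrableD; apply: rintegrableZ; exact: rintegrable_normc2.
have bE : t * L2_norm2 f + t^-1 * L2_norm2 g =
    \int[mu]_x (t * normc (f x) ^+ 2 + t^-1 * normc (g x) ^+ 2).
  by rewrite RintegralD ?RintegralZl//; try apply: rintegrableZ; exact: rintegrable_normc2.
have key (p q r s : R) : `|p * q + r * s| <= t * (p ^+ 2 + r ^+ 2) + t^-1 * (q ^+ 2 + s ^+ 2).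
  have tV : t * t^-1 = 1 by rewrite divff// gt_eqF.
  have t'0 : 0 < t^-1 by rewrite invr_gt0.
  have sq (u v : R) : `|u * v| <= t * u ^+ 2 + t^-1 * v ^+ 2.
    have h1 : 0 <= t^-1 * (t * u - v) ^+ 2 by rewrite mulr_ge0 ?sqr_ge0 ?ltW.
    have h2 : 0 <= t^-1 * (t * u + v) ^+ 2 by rewrite mulr_ge0 ?sqr_ge0 ?ltW.
    have e1 : t^-1 * (t * u - v) ^+ 2 = t * u ^+ 2 + t^-1 * v ^+ 2 - 2 * (u * v).
      by field; rewrite gt_eqF.
    have e2 : t^-1 * (t * u + v) ^+ 2 = t * u ^+ 2 + t^-1 * v ^+ 2 + 2 * (u * v).
      by field; rewrite gt_eqF.
    have h3 : 0 <= t * u ^+ 2 + t^-1 * v ^+ 2.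
      by rewrite addr_ge0// mulr_ge0 ?sqr_ge0 ?ltW.
    by rewrite ler_norml; apply/andP; split; lra.
  apply: (le_trans (ler_normD _ _)); have := sq p q; have := sq r s; lra.
rewrite bE; split; apply: (le_trans (le_normr_Rintegral _ _)) => //.
- exact: rintegrable_Re_inner.
- apply: le_Rintegral => //; first exact: rintegrable_norm (rintegrable_Re_inner hf hg).
  by move=> x _ /=; rewrite Re_inner !sqr_normc key.
- exact: rintegrable_Im_inner.
- apply: le_Rintegral => //; first exact: rintegrable_norm (rintegrable_Im_inner hf hg).
  move=> x _ /=; rewrite Im_inner !sqr_normc.
  have := key (Imc (f x)) (Rec (g x)) (- Rec (f x)) (Imc (g x)).
  by rewrite mulNr sqrrN [Imc (f x) ^+ 2 + _]addrC.
Qed.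

Lemma L2_norm2C f g : L2_norm2 (f - g) = L2_norm2 (g - f).
Proof.
apply: eq_Rintegral => x _; rewrite !sqr_normc -[(f - g) x]/(f x - g x) -[(g - f) x]/(g x - f x).
by case: (f x) (g x) => ? ? [? ?] /=; ring.
Qed.

End L2_inner_product.

(** * Orthonormal bases of L2 *)

Section counting_integral.
Variable R : realType.
Local Notation cnt := (@counting nat R).

Lemma counting_set1 i : cnt [set i] = 1%E.
Proof. by rewrite /counting asboolT// fset_set1 finmap.cardfs1. Qed.

(** Partial sums are integrals of truncations of [f], which are dominated by [|f|]. *)
Lemma cvg_sum_counting (f : nat -> R) : rintegrable cnt f ->
  \sum_(i < n) f i @[n --> \oo] --> \int[cnt]_i f i.
Proof.
move=> fi; have mf (g : nat -> R) : measurable_fun setT g by [].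
have iI i : rintegrable cnt (\1_[set i] : nat -> R).
  by apply: rintegrable_ge0P => //; rewrite integral_indic// setIT [X in (X < _)%E](counting_set1 i) ltry.
have E n : \sum_(i < n) f i = \int[cnt]_k \sum_(i < n) f i * \1_[set (i : nat)] k.
  rewrite Rintegral_sum; last by move=> i _; exact: (rintegrableZ (f i) (iI i)).
  apply: eq_bigr => i _; rewrite RintegralZl//.
  by rewrite /Rintegral integral_indic// setIT [X in fine X](counting_set1 i) mulr1.
rewrite (funext E).
have vE n k : \sum_(i < n) f i * \1_[set (i : nat)] k = if (k < n)%N then f k else 0.
  case: ltnP => kn.
    rewrite (bigD1 (Ordinal kn))//= indicE mem_set// mulr1 big1 ?addr0// => i ik.
    rewrite indicE memNset ?mulr0// => /= ki; move: ik; apply/negP/negPn/eqP.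
    exact: val_inj.
  rewrite big1// => i _; rewrite indicE memNset ?mulr0// => /= ki.
  by have := ltn_ord i; rewrite -ki ltnNge kn.
apply: (Rdominated_cvg (g := fun k => `|f k|) _ _ _ _ _).2 => //.
- apply: aeW => k; apply: cvg_near_cst; near=> n; rewrite vE.
  by have -> : (k < n)%N by near: n; exact: nbhs_infty_gt.
- exact: rintegrable_norm.
- by move=> n k; rewrite vE; case: ifP; rewrite ?normr0.
Unshelve. all: by end_near. Qed.

Lemma L2_counting_of_bounded (a : nat -> R[i]) (B : R) :
  (forall n, \sum_(i < n) normc (a i) ^+ 2 <= B) -> L2 cnt a.
Proof.
move=> aB; split; first by split.
have a0 k : (0 <= (normc (a k) ^+ 2)%:E)%E by rewrite lee_fin sqr_normc addr_ge0 ?sqr_ge0.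
rewrite ge0_integral_count//; apply: (@le_lt_trans _ _ B%:E); last exact: ltry.
apply: lime_le; first exact: is_cvg_nneseries.
by apply: nearW => n; rewrite big_mkord sumEFin lee_fin.
Qed.

End counting_integral.

Section orthonormal_basis.
Context d (T : measurableType d) (R : realType).
Variables (mu : {measure set T -> \bar R}) (P : nat -> T -> R[i]).
Local Notation C := R[i].
Local Notation cnt := (@counting nat R).
Implicit Types (a b : nat -> C) (f g : T -> C).
Hypothesis P_L2 : forall n, L2 mu (P n).
Hypothesis P_orthonormal : forall m n, L2_inner mu (P m) (P n) = (m == n)%:R.

Definition partial_sum a N : T -> C := \sum_(n < N) a n *: P n.

Lemma partial_sumS a N : partial_sum a N.+1 = a N *: P N + partial_sum a N.
Proof. by rewrite /partial_sum big_ord_recr addrC. Qed.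

Lemma L2_partial_sum a N : L2 mu (partial_sum a N).
Proof.
elim: N => [|N IH]; first by rewrite /partial_sum big_ord0; exact: L2_0.
by rewrite partial_sumS; exact: L2_lin.
Qed.

Lemma L2_inner_partial_suml a N g : L2 mu g ->
  L2_inner mu (partial_sum a N) g = \sum_(n < N) a n * L2_inner mu (P n) g.
Proof.
move=> hg; elim: N => [|N IH]; first by rewrite /partial_sum !big_ord0 L2_inner0l.
rewrite partial_sumS L2_inner_linl//; last exact: L2_partial_sum.
by rewrite IH big_ord_recr addrC.
Qed.

Lemma L2_inner_partial_sumP a N m :
  L2_inner mu (partial_sum a N) (P m) = if (m < N)%N then a m else 0.
Proof.
rewrite L2_inner_partial_suml//; case: ltnP => mN.
  rewrite (bigD1 (Ordinal mN))//= P_orthonormal eqxx mulr1 big1 ?addr0// => i im.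
  by rewrite P_orthonormal (_ : (i == m :> nat) = false) ?mulr0//; exact/negbTE.
rewrite big1// => i _; rewrite P_orthonormal ltn_eqF ?mulr0//.
exact: leq_trans (ltn_ord i) mN.
Qed.

Lemma mulcJ_normc (z : C) : z * z^*%C = (normc z ^+ 2)%:C.
Proof.
rewrite sqr_normc; case: z => p q; apply/eqP; rewrite eq_complex /=.
by apply/andP; split; apply/eqP; ring.
Qed.

Lemma L2_norm2_partial_sum a N :
  L2_norm2 mu (partial_sum a N) = \sum_(n < N) normc (a n) ^+ 2.
Proof.
have hS := L2_partial_sum a N.
have : (L2_norm2 mu (partial_sum a N))%:C = (\sum_(n < N) normc (a n) ^+ 2)%:C :> C.
  rewrite -L2_inner_self L2_inner_partial_suml// rmorph_sum; apply: eq_bigr => n _.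
  rewrite (L2_inner_conj hS (P_L2 n)) L2_inner_partial_sumP ltn_ord.
  exact: mulcJ_normc.
by case.
Qed.

Lemma L2_norm2_partial_sumB a N M : (N <= M)%N ->
  L2_norm2 mu (partial_sum a M - partial_sum a N) =
  \sum_(n < M) normc (a n) ^+ 2 - \sum_(n < N) normc (a n) ^+ 2.
Proof.
(* The difference is itself a partial sum, with the first [N] coefficients set to 0. *)
move=> NM; pose b n := if (n < N)%N then 0 else a n.
have -> : partial_sum a M - partial_sum a N = partial_sum b M.
  rewrite /partial_sum (big_ord_widen M (fun n => a n *: P n) NM) [X in _ - X]big_mkcond -sumrB.
  by apply: eq_bigr => i _; rewrite /b; case: ifP => _; rewrite ?subrr ?scale0r ?subr0.
rewrite L2_norm2_partial_sum (big_ord_widen M (fun n => normc (a n) ^+ 2) NM).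
rewrite [X in _ - X]big_mkcond -sumrB; apply: eq_bigr => i _; rewrite /b.
case: ifP => _; rewrite ?subr0// subrr sqr_normc /= expr0n addr0.
by [].
Qed.

Definition coefficients g : nat -> C := fun n => L2_inner mu g (P n).

(** The two sides differ by the squared norm of [g] minus its partial sum. *)
Lemma Bessel g N : L2 mu g -> \sum_(n < N) normc (coefficients g n) ^+ 2 <= L2_norm2 mu g.
Proof.
move=> hg; set b := coefficients g; have hS := L2_partial_sum b N.
set s := \sum_(n < N) _.
have Sg : L2_inner mu (partial_sum b N) g = s%:C.
  rewrite L2_inner_partial_suml// rmorph_sum; apply: eq_bigr => n _.
  by rewrite (L2_inner_conj hg (P_L2 n)) mulcJ_normc.
have : (L2_norm2 mu (g - partial_sum b N))%:C = (L2_norm2 mu g - s)%:C :> C.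
  rewrite -L2_inner_self L2_innerBl ?L2_innerBr//; try exact: L2B.
  rewrite Sg (L2_inner_conj hS hg) Sg !L2_inner_self L2_norm2_partial_sum -/s subrr subr0.
  by rewrite rmorphB/=; congr (_ - _); apply/eqP; rewrite eq_complex /= oppr0 !eqxx.
by case=> E; rewrite -subr_ge0 -E L2_norm2_ge0.
Qed.

Lemma L2_coefficients g : L2 mu g -> L2 cnt (coefficients g).
Proof. by move=> hg; apply: (@L2_counting_of_bounded _ _ (L2_norm2 mu g)) => N; exact: Bessel. Qed.

Lemma coefficients_lin (c : C) f g : L2 mu f -> L2 mu g ->
  coefficients (c *: f + g) = c *: coefficients f + coefficients g.
Proof. by move=> hf hg; apply/funext => n; rewrite /coefficients L2_inner_linl. Qed.

End orthonormal_basis.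

(** * Completeness of L2 *)

Section L2_completeness.
Context d (T : measurableType d) (R : realType).
Variable mu : {measure set T -> \bar R}.
Local Notation C := R[i].
Implicit Types S : nat -> T -> C.

Lemma cvg_telescope_le (p : nat -> R) (B : R) :
  (forall j, `|p j.+1 - p j| <= B * 2^-1 ^+ j) -> cvgn p.
Proof.
move=> pB.
have : cvgn (series (telescope p)).
  apply: normed_cvg; apply: (@series_le_cvg _ _ (geometric B 2^-1)).
  - by move=> n; exact: normr_ge0.
  - by move=> n; apply: le_trans (pB n); exact: normr_ge0.
  - exact: pB.
  - by apply: is_cvg_geometric_series; rewrite ger0_norm; lra.
rewrite telescopeK => h.
have -> : p = fun n => p 0%N + (p n - p 0%N) by apply/funext => n; rewrite addrC subrK.
by apply: is_cvgD; [exact: is_cvg_cst|exact: h].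
Qed.

Lemma limn_einf_le (v : nat -> \bar R) (c : \bar R) : (forall n, v n <= c)%E -> (limn_einf v <= c)%E.
Proof.
move=> vc; rewrite limn_einf_lim; apply: lime_le; first exact: is_cvg_einfs.
apply: nearW => n; apply: le_trans (vc n); apply: ereal_inf_lbound.
by exists n => //=.
Qed.

Lemma sqr_Re_le_normc (z : C) : Rec z ^+ 2 <= normc z ^+ 2.
Proof. by rewrite sqr_normc lerDl sqr_ge0. Qed.

Lemma sqr_Im_le_normc (z : C) : Imc z ^+ 2 <= normc z ^+ 2.
Proof. by rewrite sqr_normc lerDr sqr_ge0. Qed.

Lemma normc2_ge0 (z : C) : 0 <= normc z ^+ 2.
Proof. by rewrite sqr_normc addr_ge0 ?sqr_ge0. Qed.

Lemma measurable_normc2 (f : T -> C) : cmeasurable f ->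
  measurable_fun setT (fun x => normc (f x) ^+ 2).
Proof.
move=> [mr mi]; have -> : (fun x => normc (f x) ^+ 2) = fun x => Rec (f x) ^+ 2 + Imc (f x) ^+ 2.
  by apply/funext => x; rewrite sqr_normc.
by apply: measurable_funD; exact: measurable_funX.
Qed.

Lemma L2_norm2E (f : T -> C) : L2 mu f ->
  (\int[mu]_x (normc (f x) ^+ 2)%:E)%E = (L2_norm2 mu f)%:E.
Proof. by move=> hf; rewrite -EFin_Rintegral//; exact: rintegrable_normc2. Qed.

(* The series of 4 ^ j |S (j + 1) - S j| ^ 2 has a finite integral. *)
Lemma L2_ae_cvg S : (forall j, L2 mu (S j)) ->
  (forall j, L2_norm2 mu (S j.+1 - S j) <= 8^-1 ^+ j) ->
  {ae mu, forall x, cvgn (fun j => Rec (S j x)) /\ cvgn (fun j => Imc (S j x))}.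
Proof.
(* The rate [8^-1] leaves room for the factor [4 ^+ j]: the integrals are at most [2^-j] and
   summable, while a finite sum at [x] bounds the increments there by a multiple of [2^-j], which is
   summable as well. *)
move=> S_L2 S8; pose f j x := (4 ^+ j * normc ((S j.+1 - S j) x) ^+ 2)%:E : \bar R.
have dL2 j : L2 mu (S j.+1 - S j) by exact: L2B.
have f0 j x : (0 <= f j x)%E by rewrite lee_fin mulr_ge0 ?normc2_ge0// exprn_ge0.
have mf j : measurable_fun setT (f j).
  apply/measurable_EFinP; apply: measurable_funM => //; apply: measurable_normc2.
  by have [] := dL2 j.
have int_lt : (\int[mu]_x (\sum_(n <oo) f n x) < +oo)%E.
  rewrite integral_nneseries//.
  apply: (@le_lt_trans _ _ (\sum_(n <oo) (geometric 1 2^-1 n)%:E)%E).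
    apply: lee_nneseries; first by move=> n _ _; exact: integral_ge0.
    move=> n _.
    rewrite /f; under eq_integral do rewrite EFinM.
    rewrite ge0_integralZl//=; [|by apply/measurable_EFinP; apply: measurable_normc2; have [] := dL2 n
      |by move=> x _; rewrite lee_fin normc2_ge0].
    rewrite L2_norm2E// -EFinM lee_fin mul1r.
    have -> : 2^-1 ^+ n = 4 ^+ n * 8^-1 ^+ n :> R by rewrite -exprMn; congr (_ ^+ _); lra.
    by rewrite ler_wpM2l// exprn_ge0.
  have gc : cvgn (series (geometric (1 : R) 2^-1)) by apply: is_cvg_geometric_series; rewrite ger0_norm; lra.
  rewrite (_ : (fun n => _) = EFin \o series (geometric (1:R) 2^-1)); last first.
    by apply/funext => n; rewrite /= /series/= sumEFin.
  by rewrite EFin_lim// ltry.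
have mF : measurable_fun setT (fun x => \sum_(n <oo) f n x)%E.
  by apply: ge0_emeasurable_sum => // n x _ _; exact: f0.
have Fi : mu.-integrable setT (fun x => \sum_(n <oo) f n x)%E.
  apply/integrableP; split => //; under eq_integral do rewrite gee0_abs ?nneseries_ge0//.
  exact: int_lt.
have aeF := integrable_ae measurableT Fi.
have Fae : Filter (almost_everywhere mu) by exact: ae_filter_ringOfSetsType.
apply: filterS aeF => x /(_ I) /fineK; set B := fine _ => FB.
have B0 : 0 <= B by rewrite -lee_fin FB; apply: nneseries_ge0.
have key j : normc ((S j.+1 - S j) x) ^+ 2 <= B * (2^-1 ^+ j) ^+ 2.
  have : (f j x <= B%:E)%E.
    rewrite FB; apply: le_trans (nneseries_lim_ge j.+1 _) => //.
    by rewrite big_nat_recr//= leeDr// sume_ge0.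
  rewrite lee_fin => h; rewrite -exprM mulnC exprM.
  have -> : (2^-1 ^+ 2 : R) = 4^-1 by lra.
  by rewrite exprVn ler_pdivlMr ?exprn_gt0// mulrC.
have root (q : R) j : q ^+ 2 <= B * (2^-1 ^+ j) ^+ 2 -> `|q| <= Num.sqrt B * 2^-1 ^+ j.
  move=> h; rewrite -[leLHS]ger0_norm// -[leRHS]ger0_norm ?mulr_ge0 ?sqrtr_ge0 ?exprn_ge0 ?invr_ge0//.
  by rewrite -ler_sqr ?nnegrE// ?real_normK ?num_real// exprMn sqr_sqrtr// !normr_id ?real_normK ?num_real.
split; apply: (@cvg_telescope_le _ (Num.sqrt B)) => j; apply: root; apply: le_trans (key j).
  by apply: le_trans (sqr_Re_le_normc _); rewrite -[(S j.+1 - S j) x]/(S j.+1 x - S j x) raddfB.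
by apply: le_trans (sqr_Im_le_normc _); rewrite -[(S j.+1 - S j) x]/(S j.+1 x - S j x) raddfB.
Qed.

(** The limit exists almost everywhere, and Fatou's lemma passes the Cauchy estimate to it with the
    same rate. *)
Lemma L2_complete S : (forall j, L2 mu (S j)) ->
  (forall j m, (j <= m)%N -> L2_norm2 mu (S m - S j) <= 8^-1 ^+ j) ->
  exists2 f, L2 mu f & forall j, L2_norm2 mu (f - S j) <= 8^-1 ^+ j.
Proof.
move=> S_L2 S8; have ae := L2_ae_cvg S_L2 (fun j => S8 j j.+1 (leqnSn j)).
(* The upper limit is defined and measurable everywhere, and it is the limit wherever the sequence
   converges. *)
pose p x := fine (limn_esup (fun j => (Rec (S j x))%:E)).
pose q x := fine (limn_esup (fun j => (Imc (S j x))%:E)).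
pose f x : C := p x +i* q x.
have mf : cmeasurable f.
  by split; apply: (measurableT_comp (fine_measurable measurableT));
    apply: measurable_fun_limn_esup => j; apply/measurable_EFinP; have [[]] := S_L2 j.
have aef : {ae mu, forall x, Rec (S j x) @[j --> \oo] --> p x /\ Imc (S j x) @[j --> \oo] --> q x}.
  have Fae : Filter (almost_everywhere mu) by exact: ae_filter_ringOfSetsType.
  apply: filterS ae.
  have lp (v : nat -> R) : cvgn v -> v n @[n --> \oo] --> fine (limn_esup (EFin \o v)).
    move=> cv; have cE : (EFin \o v) n @[n --> \oo] --> (limn v)%:E.
      by apply/fine_cvgP; split; [exact: nearW|].
    by rewrite (cvg_limn_einf_sup cE).2.
  by move=> x [cr ci]; split; [exact: lp cr|exact: lp ci].
have bound j : (\int[mu]_x (normc ((f - S j) x) ^+ 2)%:E <= (8^-1 ^+ j)%:E)%E.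
  pose F m x := (normc ((S (m + j)%N - S j) x) ^+ 2)%:E : \bar R.
  have mF m : measurable_fun setT (F m).
    apply/measurable_EFinP; apply: measurable_normc2.
    by have [] := L2B (S_L2 (m + j)%N) (S_L2 j).
  have F0 m x : (0 <= F m x)%E by rewrite lee_fin normc2_ge0.
  apply: (@le_trans _ _ (\int[mu]_x limn_einf (F ^~ x))%E).
    rewrite le_eqVlt; apply/orP; left; apply/eqP; apply: ae_eq_integral => //.
    - apply/measurable_EFinP; apply: measurable_normc2; split.
        rewrite (_ : Rec \o _ = fun x => p x - Rec (S j x)); last by apply/funext => x /=; rewrite raddfB.
        by apply: measurable_funB; [exact: mf.1|have [[]] := S_L2 j].
      rewrite (_ : Imc \o _ = fun x => q x - Imc (S j x)); last by apply/funext => x /=; rewrite raddfB.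
      by apply: measurable_funB; [exact: mf.2|have [[]] := S_L2 j].
    - rewrite /limn_einf; apply: (measurableT_comp (@oppe_measurable R setT)).
      by apply: measurable_fun_limn_esup => m; exact: (measurableT_comp (@oppe_measurable R setT)).
    - have Fae : Filter (almost_everywhere mu) by exact: ae_filter_ringOfSetsType.
      apply: filterS aef => x [hp hq] _; apply/esym; apply: (cvg_limn_einf_sup _).1.
      apply/fine_cvgP; split; first exact: nearW.
      have E (z w : C) : normc (z - w) ^+ 2 = (Rec z - Rec w) ^+ 2 + (Imc z - Imc w) ^+ 2.
        by rewrite sqr_normc !raddfB.
      rewrite /F /= E; under eq_fun do rewrite E.
      move: hp hq; rewrite -(cvg_shiftn j) => hp; rewrite -(cvg_shiftn j) => hq.
      by apply: cvgD; apply: cvgM; apply: cvgB => //; exact: cvg_cst.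
  apply: (le_trans (fatou mu measurableT mF _)); first by move=> *; exact: F0.
  apply: limn_einf_le => m; rewrite /F L2_norm2E; last exact: L2B.
  by rewrite lee_fin S8// leq_addl.
have fB j : L2 mu (f - S j).
  split; last by apply: le_lt_trans (bound j) _; exact: ltry.
  split.
    rewrite (_ : Rec \o _ = fun x => p x - Rec (S j x)); last by apply/funext => x /=; rewrite raddfB.
    by apply: measurable_funB; [exact: mf.1|have [[]] := S_L2 j].
  rewrite (_ : Imc \o _ = fun x => q x - Imc (S j x)); last by apply/funext => x /=; rewrite raddfB.
  by apply: measurable_funB; [exact: mf.2|have [[]] := S_L2 j].
exists f.
  have -> : f = 1 *: (f - S 0%N) + S 0%N by rewrite scale1r subrK.
  exact: L2_lin.
by move=> j; rewrite -lee_fin -L2_norm2E.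
Qed.

End L2_completeness.

(** * Riesz-Fischer theorem and construction of the unitary map *)

Section Riesz_Fischer.
Context d (T : measurableType d) (R : realType).
Variables (mu : {measure set T -> \bar R}) (P : nat -> T -> R[i]).
Local Notation C := R[i].
Local Notation cnt := (@counting nat R).
Local Notation S := (partial_sum P).
Local Notation V := (coefficients mu P).
Implicit Types (a b : nat -> C) (f g : T -> C).
Hypothesis P_L2 : forall n, L2 mu (P n).
Hypothesis P_orthonormal : forall m n, L2_inner mu (P m) (P n) = (m == n)%:R.
Hypothesis P_complete : forall g, L2 mu g -> V g = 0 -> g = 0 %[ae mu].

(** Encodes that [f] is the sum of the series with coefficients [a], through a rapidly convergent
    sequence of partial sums. The condition [j <= N j] makes the indices tend to infinity; the rate
    is the one of [L2_complete]. *)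
Definition fast_expansion a f (N : nat -> nat) :=
  [/\ L2 mu f, forall j, (j <= N j)%N & forall j, L2_norm2 mu (f - S a (N j)) <= 8^-1 ^+ j].

Lemma Riesz_Fischer a : L2 cnt a -> exists f N, fast_expansion a f N.
Proof.
move=> ha; pose A n := \sum_(i < n) normc (a i) ^+ 2.
have AL := cvg_sum_counting (rintegrable_normc2 ha); set L := Rintegral _ _ _ in AL.
have ndA : nondecreasing_seq A.
  apply/nondecreasing_seqP => n; rewrite /A big_ord_recr lerDl; exact: normc2_ge0.
have A_le n : A n <= L.
  rewrite -(cvg_lim _ AL)//; apply: nondecreasing_cvgn_le => //.
  by apply/cvg_ex; exists L.
have ex j : exists n, (j <= n)%N /\ L - A n <= 8^-1 ^+ j.
  have e0 : 0 < (8^-1 ^+ j : R) by rewrite exprn_gt0.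
  have /cvgrPdist_le /(_ _ e0) [n _ H] := AL.
  exists (maxn n j); split; first exact: leq_maxr.
  by apply: le_trans (H (maxn n j) _); [exact: ler_norm|rewrite /= leq_maxl].
have [N NP] := choice ex.
have [|j m jm|f hf fS] := @L2_complete _ _ _ mu (fun j => S a (N j)).
- by move=> j; exact: L2_partial_sum.
- have [Nj Nm] := ((NP j).2, (NP m).2).
  have jm8 : 8^-1 ^+ m <= (8^-1 ^+ j : R) by apply: ler_wiXn2l => //; lra.
  (* The chosen indices [N j] need not be monotone in [j]. *)
  case: (leqP (N j) (N m)) => [h|/ltnW h].
    by rewrite L2_norm2_partial_sumB//; have := A_le (N m); rewrite -/(A _) -/(A _); lra.
  rewrite L2_norm2C L2_norm2_partial_sumB//; have := A_le (N j); rewrite -/(A _) -/(A _); lra.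
by exists f, N; split => // j; exact: (NP j).1.
Qed.

Lemma cvg_inner_partial_sum a f N g : fast_expansion a f N -> L2 mu g ->
  Rec (L2_inner mu (S a (N j)) g) @[j --> \oo] --> Rec (L2_inner mu f g) /\
  Imc (L2_inner mu (S a (N j)) g) @[j --> \oo] --> Imc (L2_inner mu f g).
Proof.
move=> [hf jN fS] hg; set B := L2_norm2 mu g.
have bound j :
    `|Rec (L2_inner mu f g - L2_inner mu (S a (N j)) g)| <= (1 + B) * 2^-1 ^+ j /\
    `|Imc (L2_inner mu f g - L2_inner mu (S a (N j)) g)| <= (1 + B) * 2^-1 ^+ j.
  have hS : L2 mu (S a (N j)) by exact: L2_partial_sum.
  rewrite -L2_innerBl//.
  (* The parameter [t = 4 ^+ j] balances the estimate: [4^j * 8^-j = 2^-j] in one term, and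
     [4^-j <= 2^-j] in the other. *)
  have t0 : 0 < (4 ^+ j : R) by rewrite exprn_gt0.
  have [h1 h2] := L2_inner_le t0 (L2B hf hS) hg.
  have le1 : 4 ^+ j * L2_norm2 mu (f - S a (N j)) <= 2^-1 ^+ j.
    have -> : 2^-1 ^+ j = 4 ^+ j * 8^-1 ^+ j :> R by rewrite -exprMn; congr (_ ^+ _); lra.
    by rewrite ler_wpM2l// ltW.
  have le2 : (4 ^+ j)^-1 * B <= B * 2^-1 ^+ j.
    rewrite mulrC ler_wpM2l ?L2_norm2_ge0// -exprVn lerXn2r ?nnegrE ?invr_ge0//; lra.
  by rewrite mulrDl mul1r; split; rewrite -/B in h1 h2; lra.
have e0 : (1 + B) * 2^-1 ^+ j @[j --> \oo] --> (0 : R).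
  by apply: cvg_geometric; rewrite ger0_norm; lra.
have sq (v : nat -> R) (l : R) : (forall j, `|l - v j| <= (1 + B) * 2^-1 ^+ j) ->
    v j @[j --> \oo] --> l.
  move=> h; apply/cvgrPdist_le => e ep; near=> j; apply: le_trans (h j) _.
  apply: le_trans (ler_norm _) _; rewrite -normrN -sub0r.
  by near: j; move/cvgrPdist_le: e0; exact.
by split; apply: sq => j; have [h1 h2] := bound j; rewrite -raddfB.
Unshelve. all: by end_near. Qed.

Lemma cvg_infty_of_ge (N : nat -> nat) : (forall j, (j <= N j)%N) -> N j @[j --> \oo] --> \oo.
Proof. by move=> jN A [n _ An]; exists n => // j /= nj; apply: An; exact: leq_trans nj _. Qed.

Lemma eq_ReIm (z w : C) : Rec z = Rec w -> Imc z = Imc w -> z = w.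
Proof. by case: z w => ? ? [? ?] /= -> ->. Qed.

(** Parseval's identity in the form which makes [coefficients] the adjoint of the expansion map. *)
Lemma inner_expansion a f N g : L2 cnt a -> fast_expansion a f N -> L2 mu g ->
  L2_inner mu f g = L2_inner cnt a (V g).
Proof.
move=> ha fN hg; have [hr hi] := cvg_inner_partial_sum fN hg.
have hV := L2_coefficients P_L2 P_orthonormal hg; have [hf jN _] := fN.
have E j : L2_inner mu (S a (N j)) g = \sum_(n < N j) a n * (V g n)^*%C.
  rewrite L2_inner_partial_suml//; apply: eq_bigr => n _.
  by rewrite (L2_inner_conj hg (P_L2 n)).
have sr := cvg_comp _ _ (cvg_infty_of_ge jN) (cvg_sum_counting (rintegrable_Re_inner ha hV)).
have si := cvg_comp _ _ (cvg_infty_of_ge jN) (cvg_sum_counting (rintegrable_Im_inner ha hV)).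
have Er j : Rec (L2_inner mu (S a (N j)) g) = \sum_(n < N j) Rec (a n * (V g n)^*%C).
  by rewrite E raddf_sum.
have Ei j : Imc (L2_inner mu (S a (N j)) g) = \sum_(n < N j) Imc (a n * (V g n)^*%C).
  by rewrite E raddf_sum.
rewrite (funext Er) in hr; rewrite (funext Ei) in hi.
by apply: eq_ReIm; [exact: (@cvg_unique _ (@Rhausdorff R) _ _ _ _ hr sr)
               |exact: (@cvg_unique _ (@Rhausdorff R) _ _ _ _ hi si)].
Qed.

Lemma coefficients_expansion a f N : fast_expansion a f N -> V f = a.
Proof.
move=> fN; apply/funext => m; have [hr hi] := cvg_inner_partial_sum fN (P_L2 m).
have [hf jN _] := fN; rewrite /coefficients.
have ev : \forall j \near \oo, L2_inner mu (S a (N j)) (P m) = a m.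
  near=> j; rewrite L2_inner_partial_sumP//.
  have -> // : (m < N j)%N by apply: leq_trans (jN j); near: j; exact: nbhs_infty_gt.
apply: eq_ReIm.
  apply: (@cvg_unique _ (@Rhausdorff R) _ _ _ _ hr).
  by apply: cvg_near_cst; apply: filterS ev => j ->.
apply: (@cvg_unique _ (@Rhausdorff R) _ _ _ _ hi).
by apply: cvg_near_cst; apply: filterS ev => j ->.
Unshelve. all: by end_near. Qed.

Lemma ae_eq_of_coefficients f g : L2 mu f -> L2 mu g -> V f = V g -> f = g %[ae mu].
Proof.
move=> hf hg E; have h0 : V (f - g) = 0.
  by rewrite addrC -scaleN1r coefficients_lin// scaleN1r E addNr.
have Fae : Filter (almost_everywhere mu) by exact: ae_filter_ringOfSetsType.
by apply: filterS (P_complete (L2B hf hg) h0) => x h /h /eqP; rewrite subr_eq0 => /eqP.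
Qed.

Lemma coefficients_basis n : V (P n) = ebasis R n.
Proof. by apply/funext => m; rewrite /coefficients P_orthonormal eq_sym. Qed.

(** [U] picks one expansion for each sequence, and these choices are unrelated. Linearity therefore
    holds almost everywhere only, and it follows because coefficients determine a function up to a
    null set. *)
Lemma L2_unitary_coefficients : exists U : (nat -> C) -> (T -> C),
  (forall n, U (ebasis R n) = P n %[ae mu]) /\ L2_unitary cnt mu U V.
Proof.
(* Choice needs a function for every sequence; on sequences outside L2 nothing is claimed about
   it. *)
have ex a : exists f, L2 cnt a -> exists N, fast_expansion a f N.
  have [ha|na] := pselect (L2 cnt a); last by exists 0.
  by have [f [N fN]] := Riesz_Fischer ha; exists f => _; exists N.
have [U UP] := choice ex.
have U_L2 a : L2 cnt a -> L2 mu (U a) by move=> ha; have [N []] := UP a ha.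
have VU a : L2 cnt a -> V (U a) = a.
  by move=> ha; have [N fN] := UP a ha; exact: coefficients_expansion fN.
have V_L2 g : L2 mu g -> L2 cnt (V g) by move=> hg; exact: L2_coefficients.
exists U; split.
  move=> n; have hn : L2 cnt (ebasis R n) by rewrite -coefficients_basis; exact: V_L2.
  by apply: ae_eq_of_coefficients; rewrite ?VU ?coefficients_basis//; exact: U_L2.
split.
- split=> // c a b ha hb; have hl := L2_lin c ha hb; apply: ae_eq_of_coefficients.
  + exact: U_L2.
  + by apply: L2_lin; exact: U_L2.
  + by rewrite coefficients_lin ?VU//; exact: U_L2.
- by split=> // a g ha hg; have [N fN] := UP a ha; exact: inner_expansion fN hg.
- by move=> a ha; rewrite VU//; exact: ae_eq_refl.
- by move=> g hg; apply: ae_eq_of_coefficients => //; [apply: U_L2; exact: V_L2|rewrite VU//; exact: V_L2].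
Qed.

End Riesz_Fischer.

(** * Orthonormality and completeness *)

(* The display of the measurable structure of R differs from that of
   measurableTypeR R, on which the Lebesgue measure is defined. *)
Section Lebesgue_measure_on_reals.
Variable R : realType.
Local Notation leb := (@lebesgue_measure R).
Implicit Types f : R -> R.

Let toR : measurableTypeR R -> R := id.

Lemma measurable_toR : measurable_fun setT toR.
Proof. by move=> _ A mA; rewrite setTI. Qed.

Definition lebR : {measure set R -> \bar R} :=
  measure_function_pushforward__canonical__measure_function_Measure leb measurable_toR.

Lemma lebRE (A : set R) f : measurable A -> measurable_fun A f -> (forall x, 0 <= f x) ->
  (\int[lebR]_(x in A) (f x)%:E = \int[leb]_(x in A) (f x)%:E)%E.
Proof.
move=> mA mf f0; rewrite ge0_integral_pushforward//; first exact: measurable_toR.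
  exact/measurable_EFinP.
by move=> x _; rewrite lee_fin.
Qed.

Lemma rintegrable_lebR f : measurable_fun setT f -> rintegrable lebR f <-> rintegrable leb f.
Proof.
move=> mf; have mn : measurable_fun setT (fun x => `|f x|) by exact: measurableT_comp.
have E := lebRE measurableT mn (fun x => normr_ge0 (f x)).
by split=> /integrableP[_ fi]; apply/integrableP; split;
  [exact/measurable_EFinP|rewrite -E|exact/measurable_EFinP|rewrite E].
Qed.

Lemma Rintegral_lebR f : measurable_fun setT f -> rintegrable leb f ->
  \int[lebR]_x f x = \int[leb]_x f x.
Proof.
move=> mf fi; congr fine.
exact: (integral_pushforward measurable_toR (proj2 (measurable_EFinP _ _) mf) fi measurableT).
Qed.

Lemma ae_lebR (Q : R -> Prop) : {ae leb, forall x, Q x} -> {ae lebR, forall x, Q x}.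
Proof. by move=> [A [mA A0 QA]]; exists A. Qed.

End Lebesgue_measure_on_reals.

Section Meixner_Pollaczek_basis.
Variables (R : realType) (k phi : R).
Hypothesis k0 : 0 < k.
Hypothesis phi0 : 0 < phi.
Hypothesis phipi : phi < pi.
Local Notation C := R[i].
Local Notation leb := (@lebesgue_measure R).
Local Notation W := (MP_measure k phi).
Local Notation P := (MP_poly k phi).
Implicit Types (p q : {poly R}) (x d : R) (m n : nat).

Let th : R := phi - pi / 2.

Let th_lt : `|th| < pi / 2.
Proof. by rewrite ltr_norml /th; apply/andP; split; have := phi0; have := phipi; lra. Qed.

Let sphi0 : 0 < sin phi.
Proof. by apply: sin_gt0_pi; rewrite phi0 phipi. Qed.

Let K : R := (2 * sin phi) `^ (2 * k) / (2 * pi * Rec (cGamma (2 * k)%:C)).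

Let weightE x : MP_weight k phi x = K * tilt k th x.
Proof.
rewrite /MP_weight /tilt /Gamma_sqr -/K [RHS]mulrA; congr (K * _ * _).
by rewrite /th; congr (expR _); field.
Qed.

Let cos_th : cos th = sin phi.
Proof. by rewrite /th cosBpihalf. Qed.

(** The normalising constant of the weight is the inverse of the mass at [th], because
    [cos th = sin phi]. *)
Let K_mass : K * tilt_mass k th = 1.
Proof.
rewrite /K /tilt_mass cos_th /powR gt_eqF ?mulr_gt0// expRN.
have g0 : Rec (cGamma (2 * k)%:C) != 0 by rewrite gt_eqF// cGamma_real_gt0// mulr_gt0.
have p0 : (pi : R) != 0 by rewrite gt_eqF// pi_gt0.
have e0 : expR (2 * k * ln (2 * sin phi)) != 0 by rewrite gt_eqF// expR_gt0.
move: (expR _) (Rec _) (pi : R) e0 g0 p0 => e G p e0 g0 p0.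
by field; rewrite e0 g0 p0.
Qed.

Let mw : measurable_fun setT (MP_weight k phi).
Proof. exact: measurable_MP_weight. Qed.

Let w0 x : 0 <= MP_weight k phi x.
Proof. exact: MP_weight_ge0. Qed.

Let WE (A : set R) : measurable A -> W A = (\int[lebR R]_(x in A) (MP_weight k phi x)%:E)%E.
Proof. by move=> mA; rewrite lebRE//; exact: measurable_funTS. Qed.

Let rintegrable_W (f : R -> R) : measurable_fun setT f ->
  rintegrable leb (fun x => f x * tilt k th x) -> rintegrable W f.
Proof.
move=> mf fi; apply/(rintegrable_density mw w0 WE mf)/rintegrable_lebR; first exact: measurable_funM.
have := rintegrableZ K fi; congr (is_true (integrable _ _ _)).
by apply/funext => x /=; rewrite weightE mulrCA.
Qed.

Lemma rintegrable_horner_MP p : rintegrable W (fun x => p.[x]).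
Proof. by apply: rintegrable_W; [exact: measurable_horner|exact: rintegrable_horner_tilt]. Qed.

Lemma sq_integrable_horner_MP p : sq_integrable W (fun x => p.[x]).
Proof.
split; first exact: measurable_horner.
have := rintegrable_horner_MP (p ^+ 2); congr (is_true (integrable _ _ _)).
by apply/funext => x /=; rewrite horner_exp.
Qed.

Lemma sq_integrable_expR_norm_MP d : 0 <= d -> `|th| + d < pi / 2 ->
  sq_integrable W (fun x => expR (d * `|x|)).
Proof.
move=> d0 dpi; have me c : measurable_fun setT (fun x : R => expR (c * `|x|)).
  by apply: continuous_measurable_fun; ctns.
split => //.
rewrite (_ : (fun x => _) = fun x => expR (2 * d * `|x|)).
  by apply: rintegrable_W => //; exact: rintegrable_expR_norm_tilt.
by apply/funext => x; rewrite expr2 -expRD; congr expR; ring.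
Qed.

Let E p : R := \int[W]_x p.[x].

Let EE p : E p = K * tilt_exp k th p.
Proof.
rewrite /E (Rintegral_density mw w0 WE (measurable_horner p) (rintegrable_horner_MP p)).
rewrite /tilt_exp -RintegralZl//; last exact: rintegrable_horner_tilt.
have i1 := rintegrableZ K (rintegrable_horner_tilt k0 p th_lt).
have fE : (fun x => p.[x] * MP_weight k phi x) = fun x => K * (p.[x] * tilt k th x).
  by apply/funext => x; rewrite weightE mulrCA.
have m1 : measurable_fun setT (fun x : R => K * (p.[x] * tilt k th x)).
  by rewrite -fE; exact: (measurable_funM (measurable_horner p) mw).
rewrite -(Rintegral_lebR m1 i1).
by apply: eq_Rintegral => x _; rewrite weightE mulrCA.
Qed.

Let E_MPq n : E (MPq k phi n) = (n == 0%N)%:R.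
Proof.
rewrite EE tilt_exp_MPq//.
have -> : cos phi + tan th * sin phi = 0.
  have -> : tan th = - cos phi / sin phi.
    rewrite /tan cos_th; congr (_ / _); rewrite /th sinBpihalf.
    by [].
  by rewrite divfK ?gt_eqF// subrr.
by rewrite expr0n; case: eqP => _; rewrite ?mul1r ?K_mass// mul0r mulr0.
Qed.

Let sq n : R := Num.sqrt (pochhammer (2 * k) n / n`!%:R).

Let sq_gt0 n : 0 < sq n.
Proof. by rewrite sqrtr_gt0 divr_gt0 ?pochhammer2a_gt0// ltr0n fact_gt0. Qed.

Lemma MP_orthogonal m n :
  \int[W]_x ((MPq k phi m).[x] * (MPq k phi n).[x]) =
  (m == n)%:R * MPq_norm k n.
Proof.
have ED : {morph E : p q / p + q}.
  move=> p q; rewrite /E -RintegralD//; try exact: rintegrable_horner_MP.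
  by apply: (@eq_Rintegral _ _ _ W) => x _; rewrite hornerD.
have EZ c p : E (c *: p) = c * E p.
  rewrite /E -RintegralZl//; last exact: rintegrable_horner_MP.
  by apply: eq_Rintegral => x _; rewrite hornerZ.
rewrite -(MPq_orthogonal k0 ED EZ E_MPq).
by apply: eq_Rintegral => x _; rewrite hornerM.
Qed.

Lemma L2_MP n : L2 W (P n).
Proof.
apply/L2P; split.
  have := sq_integrable_horner_MP (sq n *: MPq k phi n); congr (sq_integrable _ _).
  by apply/funext => x; rewrite /= MP_polyE// hornerZ.
rewrite (_ : _ \o _ = fun x => (0 : {poly R}).[x]); first exact: sq_integrable_horner_MP.
by apply/funext => x; rewrite /= MP_polyE// horner0.
Qed.

Lemma MP_orthonormal m n : L2_inner W (P m) (P n) = (m == n)%:R.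
Proof.
have -> : L2_inner W (P m) (P n) = (sq m * sq n * ((m == n)%:R * MPq_norm k n))%:C.
  apply: eq_ReIm.

    rewrite /= -MP_orthogonal -RintegralZl//; last first.
      by apply: sq_integrableM; exact: sq_integrable_horner_MP.
    apply: eq_Rintegral => x _ /=; rewrite !MP_polyE//= -/(sq _) -/(sq _); ring.
  rewrite /= -[RHS](Rintegral0 W); apply: eq_Rintegral => x _.
  by rewrite /= !MP_polyE//=; ring.
case: eqP => [->|_]; last by rewrite mul0r mulr0.
rewrite mul1r -expr2 sqr_sqrtr ?divr_ge0 ?ltW ?pochhammer2a_gt0//.
rewrite /MPq_norm mulrA divfK ?divff//.
  by rewrite gt_eqF// pochhammer2a_gt0.
Qed.

(** Orthogonality to all q_n kills the moments of [h] times the weight, and exponential decay makes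
    these moments determinate. *)
Lemma MP_complete_real (h : R -> R) : sq_integrable W h ->
  (forall n, \int[W]_x (h x * (MPq k phi n).[x]) = 0) -> {ae W, forall x, h x = 0}.
Proof.
move=> hh h0; have [mh _] := hh.
have hp p : rintegrable W (fun x => h x * p.[x]).
  by apply: sq_integrableM => //; exact: sq_integrable_horner_MP.
have moments m : \int[W]_x (h x * x ^+ m) = 0.
  have := @vanishing_on_MPq R k phi k0 (fun p => \int[W]_x (h x * p.[x])) _ _ _ h0 m.
  under eq_Rintegral do rewrite hornerXn; apply; first by rewrite gt_eqF.
    move=> p q; rewrite -RintegralD//.
    by apply: eq_Rintegral => x _; rewrite hornerD mulrDr.
  move=> c p; rewrite -RintegralZl//.
  by apply: eq_Rintegral => x _; rewrite hornerZ mulrCA.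
(* Half the distance from [|th|] to [pi / 2], so that the tilts [th + d] and [th - d] are
   admissible. *)
pose d := (pi / 2 - `|th|) / 2.
have d0 : 0 < d by have := th_lt; rewrite /d; lra.
have dpi : `|th| + d < pi / 2 by have := th_lt; rewrite /d; lra.
apply: (ae_eq0_density mw w0 WE mh); apply: ae_lebR; apply: (@ae_eq0_of_moments _ _ d) => //.
- exact: measurable_funM.
- have hn : sq_integrable W (fun x => `|h x|).
    split; first exact: measurableT_comp.
    have [_] := hh; congr (is_true (integrable _ _ _)); apply/funext => x /=.
    by rewrite real_normK// num_real.
  (* [|h|] and [e^(d |x|)] are both square integrable for the weight, so their product is
     integrable. *)
  have i1 := sq_integrableM hn (sq_integrable_expR_norm_MP (ltW d0) dpi).
  have /(rintegrable_density mw w0 WE (rintegrable_measurable i1)) i2 := i1.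
  have {i2} := (rintegrable_lebR (rintegrable_measurable i2)).1 i2.
  congr (is_true (integrable _ _ _)); apply/funext => x /=.
  by rewrite normrM (ger0_norm (w0 x)) mulrAC.
- move=> m; rewrite -[RHS](moments m).
  have i2 : rintegrable W (fun x => h x * x ^+ m).
    by have := hp 'X^m; under eq_fun do rewrite hornerXn.
  have m2 := rintegrable_measurable i2.
  have /(rintegrable_density mw w0 WE m2) i3 := i2; have m3 := rintegrable_measurable i3.
  rewrite (Rintegral_density mw w0 WE m2 i2) (Rintegral_lebR m3 ((rintegrable_lebR m3).1 i3)).
  by apply: eq_Rintegral => x _; rewrite mulrAC.
Qed.

(** The [P n] take real values, so the real and imaginary parts of [g] are separately orthogonal to
    them. *)
Lemma MP_complete (g : R -> C) : L2 W g -> coefficients W P g = 0 -> g = 0 %[ae W].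
Proof.
move=> hg g0; have /L2P[hr hi] := hg.
have int_Re n : \int[W]_x (Rec (g x) * (MPq k phi n).[x]) = 0.
  have h := f_equal Rec (f_equal (fun v => v n) g0).
  apply: (mulfI (lt0r_neq0 (sq_gt0 n))); rewrite mulr0 -[RHS]h /coefficients /=.
  rewrite -RintegralZl//; last by apply: (sq_integrableM hr); exact: sq_integrable_horner_MP.
  by apply: eq_Rintegral => x _ /=; rewrite MP_polyE//= -/(sq _); case: (g x) => ? ? /=; ring.
have int_Im n : \int[W]_x (Imc (g x) * (MPq k phi n).[x]) = 0.
  have h := f_equal Imc (f_equal (fun v => v n) g0).
  apply: (mulfI (lt0r_neq0 (sq_gt0 n))); rewrite mulr0 -[RHS]h /coefficients /=.
  rewrite -RintegralZl//; last by apply: (sq_integrableM hi); exact: sq_integrable_horner_MP.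
  by apply: eq_Rintegral => x _ /=; rewrite MP_polyE//= -/(sq _); case: (g x) => ? ? /=; ring.
have aer := MP_complete_real hr int_Re; have aei := MP_complete_real hi int_Im.
have F : Filter (almost_everywhere W) by exact: ae_filter_ringOfSetsType.
by apply: filterS2 aer aei => x hx hy _; apply: eq_ReIm.
Qed.

End Meixner_Pollaczek_basis.

(** * The Lax equation and the Jacobi operator *)

Section half_line.
Variable R : realType.
Implicit Types (f : R -> R) (t l : R).

(** A Lipschitz estimate at [t] that includes [y = t]; continuity from within the half-line follows
    from it, also at 0. *)
Lemma halfline_derive_le f t l : is_derive_halfline f t l ->
  \forall y \near t, 0 <= y -> `|f y - f t| <= (`|l| + 1) * `|y - t|.
Proof.
move=> /cvgrPdist_lt /(_ _ ltr01); rewrite !near_withinE => H.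
have {}H : \forall y \near t, y - t != 0 -> 0 <= t + (y - t) ->
    `|l - (f (t + (y - t)) - f t) / (y - t)| < 1.
  have ct : y - t @[y --> t] --> (0 : R).
    by rewrite -[X in _ --> X](subrr t); apply: cvgB; [exact: cvg_id|exact: cvg_cst].
  exact: (ct _ H).
apply: filterS H => y H y0; have [->|yt] := eqVneq y t.
  by rewrite !subrr normr0 mulr0.
have yt0 : y - t != 0 by rewrite subr_eq0.
have {H} := H yt0; rewrite addrC subrK => /(_ y0) H.
have -> : f y - f t = ((f y - f t) / (y - t)) * (y - t) by rewrite divfK.
rewrite normrM ler_wpM2r//; set q := _ / _ in H *.
have -> : q = l - (l - q) by ring.
by apply: (le_trans (ler_normB _ _)); rewrite lerD2l ltW.
Qed.

Lemma halfline_cvg f t l : is_derive_halfline f t l ->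
  f y @[y --> within [set y | 0 <= y] (nbhs t)] --> f t.
Proof.
move=> /halfline_derive_le H; apply/cvgrPdist_le => e e0.
rewrite near_withinE; near=> y => y0; rewrite distrC.
apply: (@le_trans _ _ ((`|l| + 1) * `|y - t|)).
  by move: y0; near: y; exact: H.
have l1 : 0 < `|l| + 1 by rewrite ltr_wpDl.
rewrite -ler_pdivlMl// mulrC distrC; near: y.
by apply: (@cvgr_dist_le _ _ _ _ _ id); [exact: cvg_id|rewrite divr_gt0].
Unshelve. all: by end_near. Qed.

Lemma halfline_continuous f (b : R) : (forall t, 0 <= t -> exists l, is_derive_halfline f t l) ->
  {within `[0, b], continuous f}.
Proof.
move=> df; apply/subspace_continuousP => t; rewrite /= in_itv/= => /andP[t0 _].
have [l /halfline_cvg H] := df t t0.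
apply: cvg_trans H; apply: cvg_app => A; rewrite /= !nbhs_simpl /within /=.
by apply: filterS => y h; rewrite in_itv/= => /andP[y0 _]; exact: h.
Qed.

Lemma halfline_is_derive f t l : 0 < t -> is_derive_halfline f t l -> is_derive t 1 f l.
Proof.
move=> t0 H.
have H' : h^-1 *: (f (h *: (1 : R) + t) - f t) @[h --> 0^'] --> l.
  apply/cvgrPdist_le => e e0; move/cvgrPdist_le : H => /(_ _ e0); rewrite !near_withinE => H.
  have n0 : \forall h \near (0 : R), 0 <= t + h.
    near=> h; have : `|0 - h| <= t by near: h; exact: (@cvgr_dist_le _ _ _ _ _ id).
    by rewrite sub0r normrN ler_norml => /andP[]; lra.
  near=> h => h0; have th : 0 <= t + h by near: h.
  rewrite /GRing.scale/= mulr1 (addrC h) mulrC.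
  by move: h0 th; near: h.
by apply: DeriveDef; [apply/cvg_ex; exists l|apply/cvg_lim].
Unshelve. all: by end_near. Qed.

(** The derivative of [r^2 - s^2] at positive times is [- 4 u r s + 4 u s r = 0]; the one-sided
    continuity at 0 lets the mean value theorem reach the initial time. *)
Lemma halfline_sqr_sub_cst (s r u : R -> R) :
  (forall t, 0 <= t -> is_derive_halfline s t (- (2 * u t * r t))) ->
  (forall t, 0 <= t -> is_derive_halfline r t (- (2 * u t * s t))) ->
  forall t, 0 <= t -> r t ^+ 2 - s t ^+ 2 = r 0 ^+ 2 - s 0 ^+ 2.
Proof.
move=> ds dr t; rewrite le_eqVlt => /predU1P[<-//|t0].
have cs : {within `[0, t], continuous s}.
  by apply: halfline_continuous => x x0; exists (- (2 * u x * r x)); exact: ds.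
have cr : {within `[0, t], continuous r}.
  by apply: halfline_continuous => x x0; exists (- (2 * u x * s x)); exact: dr.
pose q x := r x ^+ 2 - s x ^+ 2.
have cq : {within `[0, t], continuous q}.
  by move=> x; apply: cvgB; apply: cvgM; (exact: cs || exact: cr).
have dq x : x \in `]0, t[ -> is_derive x 1 q 0.
  rewrite in_itv/= => /andP[x0 _].
  have dsx := halfline_is_derive x0 (ds x (ltW x0)).
  have drx := halfline_is_derive x0 (dr x (ltW x0)).
  by apply: is_derive_eq; rewrite /GRing.scale/=; ring.
have [c _] := MVT t0 dq cq.
by rewrite mul0r => /eqP; rewrite subr_eq0 => /eqP.
Qed.

Lemma halfline_gt0 f : (forall t, 0 <= t -> exists l, is_derive_halfline f t l) ->
  0 < f 0 -> (forall t, 0 <= t -> f t != 0) -> forall t, 0 <= t -> 0 < f t.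
Proof.
move=> df f0 fn0 t t0; rewrite ltNge; apply/negP => ft.
have [c] : exists2 c, c \in `[0, t] & f c = 0.
  apply: IVT => //; first exact: halfline_continuous.
  by rewrite ge_min le_max (ltW f0) ft orbT.
by rewrite in_itv/= => /andP[c0 _] /eqP; apply/negP; exact: fn0.
Qed.

End half_line.

(** * The Lax operator in coordinates *)

Section Jacobi_operator.
Variable R : realType.
Variables (k s r : R).
Local Notation C := R[i].
Implicit Types (a : nat -> C) (m n : nat).

Lemma scale_ebasis (z : C) n m : (z *: ebasis R n) m = z * (m == n)%:R.
Proof. by []. Qed.

(** Only one basis vector contributes to coordinate [m] under each of H, E and F. The sum over all
    indices then collapses for every sequence [a], finitely supported or not. *)
Lemma on_basis_single (v : nat -> nat -> C) a m n0 :
  (forall n, n != n0 -> v n m = 0) -> on_basis v a m = a n0 * v n0 m.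
Proof.
move=> v0; rewrite /on_basis -(fsbig_widen [set n0])//; first by rewrite fsbig_set1.
by move=> n /= [_ /eqP nn0]; rewrite v0// mulr0.
Qed.

Lemma discHE a m : discH k a m = (2 * (k + m%:R))%:C * a m.
Proof.
rewrite /discH (@on_basis_single _ _ _ m); last first.
  by move=> n nm; rewrite scale_ebasis eq_sym (negbTE nm) mulr0.
by rewrite scale_ebasis eqxx mulr1 mulrC.
Qed.

(** The matrix entry linking [e_(n-1)] and [e_n], up to sign the same for E and F. Its vanishing at
    [n = 0] stands for [e_(-1) = 0]. *)
Definition jacobi_coeff n : R := Num.sqrt (n%:R * (2 * k + n%:R - 1)).
Local Notation c := jacobi_coeff.

Lemma jacobi_coeff0 : c 0 = 0. Proof. by rewrite /jacobi_coeff mul0r sqrtr0. Qed.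

Lemma discEE a m : discE k a m = (c m)%:C * a m.-1.
Proof.
case: m => [|m].
  rewrite jacobi_coeff0 mul0r /discE (@on_basis_single _ _ _ 0%N); last first.
    by move=> n _; rewrite scale_ebasis mulr0.
  by rewrite scale_ebasis !mulr0.
rewrite /discE (@on_basis_single _ _ _ m); last first.
  by move=> n nm; rewrite scale_ebasis eqSS eq_sym (negbTE nm) mulr0.
rewrite scale_ebasis eqxx mulr1 mulrC /jacobi_coeff.
by congr ((Num.sqrt _)%:C * _); rewrite -natr1 addrA addrK.
Qed.

Lemma discFE a m : discF k a m = - ((c m.+1)%:C * a m.+1).
Proof.
rewrite /discF (@on_basis_single _ _ _ m.+1); last first.
  case=> [|n] nm; first by rewrite mul0r sqrtr0 oppr0 scale0r.
  by rewrite scale_ebasis eq_sym -eqSS (negbTE nm) mulr0.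
by rewrite scale_ebasis eqxx mulr1 rmorphN mulrN mulrC.
Qed.

(* By jacobiE this is the Lax operator conjugated by the sign change; a m.-1 is
   harmless for m = 0 because c 0 = 0. *)
Definition jacobi a m : C :=
  (2 * s * (k + m%:R))%:C * a m - (r * c m)%:C * a m.-1 - (r * c m.+1)%:C * a m.+1.

Lemma jacobiE (S T : R -> R) t a : S t = s -> T t = r ->
  alternate (disc_series k (lax_operator S T t) (alternate a)) = jacobi a.
Proof.
move=> St Tt; apply/funext => m.
have X00 : lax_operator S T t 0 0 = s%:C.
  by rewrite /lax_operator !mxE St /= !mulr1n; ring.
have X01 : lax_operator S T t 0 1 = r%:C.
  by rewrite /lax_operator !mxE Tt /=; ring.
have X10 : lax_operator S T t 1 0 = - r%:C.
  by rewrite /lax_operator !mxE Tt /=; ring.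
rewrite /alternate /disc_series X00 X01 X10.
rewrite -[(_ + _ + _) m]/(s%:C * discH k _ m + r%:C * discE k _ m + - r%:C * discF k _ m).
rewrite discHE discEE discFE /jacobi !rmorphM/= !rmorphD/= exprS.
(* The diagonal entry meets the same sign twice and is unchanged; the off-diagonal ones meet two
   opposite signs and are negated. *)
have sq : (-1) ^+ m * (-1) ^+ m = 1 :> C by rewrite -exprD addnn -signr_odd odd_double.
case: m {X00 X01 X10} sq => [|m] sq.
  rewrite jacobi_coeff0 expr0 /=; ring.
rewrite [in (-1) ^+ m.+1.-1]/= exprS; rewrite exprS in sq.
set e := (-1) ^+ m in sq *.
have e2 : e * e = 1 by rewrite -[RHS]sq; ring.
transitivity (e * e * ((2 * s%:C * (k%:C + m.+1%:R%:C)) * a m.+1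
  - r%:C * (c m.+1)%:C * a m - r%:C * (c m.+2)%:C * a m.+2)).
  by rewrite /=; ring.
by rewrite e2 mul1r.
Qed.

End Jacobi_operator.

Section Jacobi_diagonalization.
Variables (R : realType) (k phi s r : R).
Hypothesis k0 : 0 < k.
Hypothesis phi0 : 0 < phi.
Hypothesis phipi : phi < pi.
Hypothesis sE : s = r * cos phi.
Local Notation C := R[i].
Local Notation W := (MP_measure k phi).
Local Notation P := (MP_poly k phi).
Local Notation c := (jacobi_coeff k).
Local Notation Cst := (r * sin phi).
Implicit Types (a : nat -> C) (x : R).

Let sq n : R := Num.sqrt (pochhammer (2 * k) n / n`!%:R).

Let sqS n : sq n.+1 = sq n * (Num.sqrt (2 * k + n%:R) / Num.sqrt n.+1%:R).
Proof.
have k2 : 0 <= 2 * k + n%:R by rewrite addr_ge0// mulr_ge0// ltW.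
rewrite /sq -sqrtrV ?ler0n// -sqrtrM// -sqrtrM; last first.
  by rewrite divr_ge0 ?ler0n// ltW// pochhammer2a_gt0.
congr Num.sqrt; rewrite pochhammerS factS natrM -nat1r.
have h1 : 1 + n%:R != 0 :> R by rewrite nat1r pnatr_eq0.
have h2 : n`!%:R != 0 :> R by rewrite pnatr_eq0 -lt0n fact_gt0.
by field; rewrite h1 h2.
Qed.

Let cS n : c n.+1 = Num.sqrt n.+1%:R * Num.sqrt (2 * k + n%:R).
Proof. by rewrite /jacobi_coeff -natr1 addrA addrK sqrtrM// natr1 ler0n. Qed.

Let sqrt_sqr n : Num.sqrt (2 * k + n%:R) * Num.sqrt (2 * k + n%:R) = 2 * k + n%:R :> R.
Proof. by rewrite -expr2 sqr_sqrtr// addr_ge0// mulr_ge0// ltW. Qed.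

Let sqrtS_sqr n : Num.sqrt n.+1%:R * Num.sqrt n.+1%:R = n.+1%:R :> R.
Proof. by rewrite -expr2 sqr_sqrtr. Qed.

Let sqrtS_neq0 n : Num.sqrt n.+1%:R != 0 :> R.
Proof. by rewrite gt_eqF// sqrtr_gt0. Qed.

(** Together with [sq_down]: normalising by [sq] symmetrises the recurrence, since the unequal
    coefficients [n + 2 k] and [n] of [mulX_MPq] become values of [jacobi_coeff]. *)
Let sq_up n : (n%:R + 2 * k) * sq n = c n.+1 * sq n.+1.
Proof.
rewrite sqS cS [n%:R + _]addrC; have := sqrt_sqr n; have := sqrtS_neq0 n.
by set A := Num.sqrt (2 * k + _); set B := Num.sqrt _ => B0 <-; field.
Qed.

Let sq_down n : n%:R * sq n = c n * sq n.-1.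
Proof.
case: n => [|n]; first by rewrite jacobi_coeff0 !mul0r.
rewrite sqS cS /=; have := sqrtS_sqr n; have := sqrtS_neq0 n.
by set A := Num.sqrt (2 * k + _); set B := Num.sqrt _ => B0 <-; field.
Qed.

Lemma MP_recurrence n x : (2 * Cst * x)%:C * P n x =
  (r * c n.+1)%:C * P n.+1 x - (2 * s * (k + n%:R))%:C * P n x + (r * c n)%:C * P n.-1 x.
Proof.
have key : 2 * Cst * x * (sq n * (MPq k phi n).[x]) =
    r * c n.+1 * (sq n.+1 * (MPq k phi n.+1).[x])
    - 2 * s * (k + n%:R) * (sq n * (MPq k phi n).[x])
    + r * c n * (sq n.-1 * (MPq k phi n.-1).[x]).
  have := f_equal (fun p : {poly R} => p.[x]) (mulX_MPq phi k0 n).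
  rewrite hornerZ hornerM hornerX hornerD hornerD hornerN !hornerZ => H.
  have -> : 2 * Cst * x * (sq n * (MPq k phi n).[x]) =
    r * sq n * (2 * sin phi * (x * (MPq k phi n).[x])) by ring.
  rewrite H sE.
  have -> : r * c n.+1 * (sq n.+1 * (MPq k phi n.+1).[x]) =
    r * ((n%:R + 2 * k) * sq n) * (MPq k phi n.+1).[x] by rewrite sq_up; ring.
  have -> : r * c n * (sq n.-1 * (MPq k phi n.-1).[x]) =
    r * (n%:R * sq n) * (MPq k phi n.-1).[x] by rewrite sq_down; ring.
  ring.
rewrite !MP_polyE// -!/(sq _); apply: eq_ReIm; last by rewrite /=; ring.
by rewrite /= !(mul0r, mulr0, subr0) key; ring.
Qed.

(* Summation by parts; the last term is the boundary contribution. *)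
Lemma partial_sum_jacobi a N x : partial_sum P (jacobi k s r a) N x =
  (- 2 * Cst * x)%:C * partial_sum P a N x
  + (r * c N)%:C * (a N.-1 * P N x - a N * P N.-1 x).
Proof.
elim: N => [|N IH].
  rewrite /partial_sum !big_ord0 jacobi_coeff0 [r * 0]mulr0 [X in _ + X]mul0r addr0.
  by rewrite mulr0.
have E b : partial_sum P b N.+1 x = b N * P N x + partial_sum P b N x.
  by rewrite partial_sumS.
rewrite !E IH /jacobi /=.
have H := MP_recurrence N x.
have -> : (- 2 * Cst * x)%:C = - (2 * Cst * x)%:C by rewrite -rmorphN; congr (_%:C); ring.
rewrite [in RHS]mulrDr [in X in _ = X + _ + _]mulNr [in X in _ = - X + _ + _]mulrCA H.
ring.
Qed.

(** [U] is known only on coefficient sequences and up to null sets. Finite support makes both [U b]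
    and [g] almost everywhere equal to finite sums of the [P n], for which [partial_sum_jacobi] is a
    pointwise identity. *)
Lemma jacobi_diagonalization (U : (nat -> C) -> R -> C) g :
  (forall f, L2 W f -> U (coefficients W P f) = f %[ae W]) ->
  L2 W g -> finsupp (coefficients W P g) ->
  U (jacobi k s r (coefficients W P g)) = mult_op (fun x => (- 2 * Cst * x)%:C) g %[ae W].
Proof.
set a := coefficients W P g => UV hg fin_a.
have [N aN] : exists N, forall n, (N <= n)%N -> a n = 0.
  have /finite_seqP[l lE] := fin_a; exists (\max_(i <- l) i).+1 => n nN.
  apply/eqP/negPn/negP => an; have : [set` l] n by rewrite -lE.
  move=> /= nl; have := @leq_bigmax_seq _ l xpredT id n nl isT.
  by rewrite leqNgt nN.
(* [a] vanishes from index [N] on and [b] from [N.+1] on, as each entry of [b] involves the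
   neighbours. With [N.+1] terms nothing is lost, and the boundary coefficients [a N] and [a N.+1]
   are both 0. *)
set b := jacobi k s r a; pose h := partial_sum P b N.+1.
have P_L2 n : L2 W (P n) by exact: L2_MP.
have P_on m n : L2_inner W (P m) (P n) = (m == n)%:R by exact: MP_orthonormal.
have bN n : (N < n)%N -> b n = 0.
  move=> Nn; rewrite /b /jacobi !aN ?mulr0 ?subr0//; [exact: leqW (ltnW Nn)| |exact: ltnW].
  by case: n Nn.
have coeff_partial v M : (forall n, (M <= n)%N -> v n = 0) ->
    coefficients W P (partial_sum P v M) = v.
  move=> vM; apply/funext => n; rewrite /coefficients L2_inner_partial_sumP//.
  by case: ltnP => // /vM ->.
have hE : U b = h %[ae W].
  have <- : coefficients W P h = b by exact: coeff_partial.
  by apply: UV; exact: L2_partial_sum.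
have gE : g = partial_sum P a N.+1 %[ae W].
  apply: (@ae_eq_of_coefficients _ _ _ W P) => //.
  - by move=> f; exact: MP_complete.
  - exact: L2_partial_sum.
  - by rewrite coeff_partial// => n Nn; apply: aN; exact: ltnW.
have F : Filter (almost_everywhere W) by exact: ae_filter_ringOfSetsType.
apply: filterS2 hE gE => x hx gx _; rewrite hx// /mult_op gx// /h partial_sum_jacobi.
by rewrite /= !aN// !mul0r subr0 mulr0 addr0.
Qed.

End Jacobi_diagonalization.

Theorem theorem4p5 (R : realType) (r s u : R -> R) (k : R)
  (r_C1 : C1_halfline r) (s_C1 : C1_halfline s) (u_C0 : C0_halfline u)
  (s_ode : forall t, 0 <= t -> is_derive_halfline s t (- (2 * u t * r t)))
  (r_ode : forall t, 0 <= t -> is_derive_halfline r t (- (2 * u t * s t)))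
  (sgn_u : forall t, 0 < t -> Num.sg (u t) = - Num.sg (r t))
  (s0_gt0 : 0 < s 0) (r0_gt0 : 0 < r 0)
  (s2_lt_r2 : forall t, 0 <= t -> s t ^+ 2 - r t ^+ 2 < 0)
  (k_gt0 : 0 < k) :
  exists2 C : R,
    forall t, 0 <= t -> C = Num.sqrt (r t ^+ 2 - s t ^+ 2) &
    forall t, 0 <= t ->
      let phi := acos (s t / r t) in
      let W := MP_measure k phi in
      exists (U : (nat -> R[i]) -> (R -> R[i]))
             (Ustar : (R -> R[i]) -> (nat -> R[i])),
        [/\ forall n, U (ebasis R n) = MP_poly k phi n %[ae W],
            L2_unitary (@counting nat R) W U Ustar &
            forall g, L2 W g -> finsupp (Ustar g) ->
              (U \o alternate (R := R)
                 \o disc_series k (lax_operator s r t)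
                 \o alternate (R := R) \o Ustar) g
              = mult_op (fun x => (- 2 * C * x)%:C) g %[ae W]].
Proof.
(* A zero of [r] would give [s t ^+ 2 < 0], so [r] keeps its initial sign. *)
have r_gt0 : forall t, 0 <= t -> 0 < r t.
  apply: halfline_gt0 => // t t0; first by exists (- (2 * u t * s t)); exact: r_ode.
  by apply/eqP => rt; have := s2_lt_r2 t t0; rewrite rt expr0n subr0 ltNge sqr_ge0.
have cst := halfline_sqr_sub_cst s_ode r_ode.
(* The witness is taken at time 0, before [t] is introduced; conservation identifies it with the
   value at [t]. *)
exists (Num.sqrt (r 0 ^+ 2 - s 0 ^+ 2)) => [t t0|t t0 phi W]; first by rewrite cst.
(* Strictness puts [phi] in the open interval []0, pi[], where [sin phi > 0] and the weight is not
   degenerate. *)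
have rt := r_gt0 t t0; have lt1 : `|s t / r t| < 1.
  rewrite normrM normfV ltr_pdivrMr ?normr_gt0 ?gt_eqF// mul1r.
  by rewrite -ltr_sqr ?nnegrE// !real_normK ?num_real// -subr_lt0; exact: s2_lt_r2.
have [lt1l lt1r] : -1 < s t / r t /\ s t / r t < 1 by move: lt1; rewrite ltr_norml => /andP.
have cphi : cos phi = s t / r t by rewrite acosK// in_itv/= !ltW.
have phi0 : 0 < phi by apply: acos_gt0; rewrite lt1r ltW.
have phipi : phi < pi by apply: acos_ltpi; rewrite lt1l ltW.
have sE : s t = r t * cos phi by rewrite cphi mulrCA divff ?mulr1// gt_eqF.
(* Positivity of [r t] selects the sign of the root: [r sin (arccos (s / r))] is the nonnegative
   square root of [r^2 - s^2]. *)
have CE : r t * sin phi = Num.sqrt (r 0 ^+ 2 - s 0 ^+ 2).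
  rewrite -(cst t t0) /phi sin_acos ?ltW//.
  rewrite -[X in X * _ = _](ger0_norm (ltW rt)) -sqrtr_sqr -sqrtrM ?sqr_ge0//; congr Num.sqrt.
  by field; rewrite gt_eqF.
have [U [Ue Uu]] := L2_unitary_coefficients (L2_MP k_gt0 phi0 phipi)
  (MP_orthonormal k_gt0 phi0 phipi) (@MP_complete _ _ _ k_gt0 phi0 phipi).
exists U, (coefficients W (MP_poly k phi)); split => // g hg fin_g.
rewrite -CE /= (@jacobiE _ _ (s t) (r t))//.
by apply: jacobi_diagonalization => //; case: Uu.
Qed.
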